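(* For any $\varepsilon<1/2$ and any positive integer $k$, there is a randomized distributed $\mathsf{CONGEST}$ algorithm that, on an $n$-node graph $G$, computes a $k$-connectivity certificate of $G$ with at most $kn(1+\varepsilon)$ edges in $\frac{\mathrm{polylog}(n)}{\varepsilon^3}$ rounds.
   Context: For a graph $G=(V,E)$, a $k$-connectivity certificate is a spanning subgraph $H=(V,E')$, $E'\subseteq E$, such that $H$ is $k$-edge-connected if and only if $G$ is $k$-edge-connected. $\mathsf{CONGEST}$ model: the network is $G$; each node has a unique $O(\log n)$-bit identifier, initially knows only its incident edges, and per synchronous round sends one $O(\log n)$-bit message to each neighbor; at the end each node must know which of its incident edges are in $H$. *)

(* Defs.v *)
From HB Require Import structures.
From mathcomp Require Import all_boot all_order all_algebra.
From mathcomp Require Import all_classical all_reals all_analysis.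

Set Implicit Arguments.
Unset Strict Implicit.
Unset Printing Implicit Defensive.

Import Order.TTheory GRing.Theory Num.Theory.

(* A graph on the finite type V is given by its set of edges, an edge being
   the two-element set of its endpoints.  All (sub)graphs on V are spanning. *)
Section Graphs.
Variable V : finType.
Implicit Types E H F : {set {set V}}.

Definition simple_graph E : bool := [forall e in E, #|e| == 2].

Definition adj E : rel V := [rel u v | [set u; v] \in E].

Definition connected_graph E : bool :=
  [forall u, forall v, connect (adj E) u v].

Definition edge_connected (k : nat) E : bool :=
  [forall F : {set {set V}},
     (F \subset E) && (#|F| < k) ==> connected_graph (E :\: F)].

Definition connectivity_certificate (k : nat) E H : bool :=
  (H \subset E) && (edge_connected k H == edge_connected k E).

(* [port v] lists the neighbours of [v] in an arbitrary order; its i-th item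
   is the other endpoint of the i-th edge incident to [v]. *)
Definition port_numbering E (port : V -> seq V) : Prop :=
  forall v, uniq (port v) /\ port v =i adj E v.

End Graphs.

(* A randomized CONGEST algorithm with messages of at most b bits.  Initially
   a node is given its identifier, its number of incident edges and its private
   random bits; it refers to its incident edges only through the port numbers
   0, ..., degree - 1.  Local computation is unrestricted. *)
Record congest_algorithm (b : nat) := CongestAlgorithm {
  state : Type;
  coins : nat;
  rounds : nat;
  init : nat -> nat -> coins.-tuple bool -> state;
  send : state -> nat -> {bseq b of bool};
  receive : state -> seq {bseq b of bool} -> state;
  output : state -> nat -> bool
}.

Section Execution.
Variables (b : nat) (A : congest_algorithm b) (V : finType).
Variables (ident : V -> nat) (port : V -> seq V).

Definition tapes := {ffun V -> (coins A).-tuple bool}.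

(* In one round, v receives on each of its ports the message that the
   neighbour w at that port sent on its own port leading to v. *)
Fixpoint run (r : tapes) (t : nat) (v : V) : state A :=
  if t is t'.+1 then
    receive (run r t' v)
      [seq send (run r t' w) (index v (port w)) | w <- port v]
  else init (ident v) (size (port v)) (r v).

(* Every node knows which of its incident edges are in H; in particular the
   two endpoints of each edge agree. *)
Definition outputs (r : tapes) (H : {set {set V}}) : bool :=
  [forall v, forall w in port v,
     output (run r (rounds A) v) (index w (port v)) == ([set v; w] \in H)].

(* Probability over independent and uniform random bits at all the nodes. *)
Definition Pr_tapes (R : realType) (P : pred tapes) : R :=
  (#|[set r : tapes | P r]|%:R / #|{: tapes}|%:R)%R.

End Execution.

Definition computes_certificate (R : realType) (b : nat)
    (A : congest_algorithm b) (V : finType) (E : {set {set V}})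
    (ident : V -> nat) (port : V -> seq V) (k : nat) (eps : R)
    (r : tapes A V) : bool :=
  [exists H : {set {set V}},
     [&& outputs ident port r H,
         connectivity_certificate k E H &
         (#|H|%:R <= k%:R * #|V|%:R * (1 + eps))%R]].

Definition ceil_log2 (n : nat) : nat := up_log 2 n.

(* Main.v *)
(* The edges are split at random into g groups, where g is the largest power of
   two for which k / g is still of order log n / eps^2.  By Chernoff's bound and
   Karger's bound on the number of small cuts, with high probability every cut
   with s >= k edges has (1 +- theta) s / g edges in every group, for a theta of
   order eps.  It then suffices to keep, in every group and every cut, about
   (1 + eps / 3) k / g edges (or all of them if there are fewer).  This is done
   by removing from each group, that many times, a subgraph with at most
   n (1 + eps / 3) edges that connects the endpoints of all remaining edges; all
   groups work in parallel, since every edge belongs to a single group.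

   To find such a subgraph, a ruling set yields clusters of radius O(r log n),
   each of which contains at least r + 1 vertices unless it is a whole component.
   A spanning tree of every cluster costs at most n edges.  The clusters are then
   themselves grouped around hubs: a cluster becomes a hub at a random time with
   geometric tail, and hubs propagate to neighbouring clusters by one step per
   unit of time (the random shifts of Miller, Peng and Xu and of Elkin and
   Neiman).  Every cluster keeps one edge towards each hub of a neighbouring
   cluster that was reached no later than itself; with high probability there are
   at most T = O(log n) of these, so that they cost at most n T / (r + 1) edges
   altogether, and r is a multiple of T / eps. *)

Require Import Defs.
From HB Require Import structures.
From mathcomp Require Import all_boot all_order all_algebra.
From mathcomp Require Import all_classical all_reals all_analysis.
From mathcomp Require Import fintype finset zify ring lra.
Import Order.TTheory GRing.Theory Num.Theory.

Set Implicit Arguments.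
Unset Strict Implicit.
Unset Printing Implicit Defensive.

Local Open Scope nat_scope.

(** * Ruling sets and clusters *)

(** Peeling about [k] forests one after the other would cost [k] times polylog rounds. Grouping
    leaves only [K] successive forests, of order [m ^ 2 * log n] with [m] about 1 / eps. A forest
    takes of order [m * log n ^ 3] rounds, as [r] is of order [m * log n]. Hence eps ^ 3 and the
    exponent 4. A forest need not be minimal: it only has to cross every cut that still has edges in
    its group, so that [K] of them save at least [minn K s] of the [s] edges of a cut. A graph that
    is not [k]-edge-connected has no [k]-edge-connected spanning subgraph, so the analysis may
    assume that every cut has [k] edges, as Karger's argument requires. The number of edges is
    bounded for every outcome of the coins; chance only affects connectivity. The two losses, from
    [K] and from the edges between clusters, combine to [(1 + 1 / (3 * m)) ^ 2 <= 1 + 1 / m].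
    Successive forests are not independent, but forest [j] is built on a subgraph fixed by the
    groups and the earlier shifts, so its own shifts can be redrawn with all else fixed. *)

Section Spread.
Variables (V : finType) (nb : V -> seq V).
Implicit Types (x y : V -> bool) (u v w : V).

(** One [spread] is one round of one-bit messages; [near t (pred1 u)] is the ball of radius [t]
    around [u]. *)
Definition spread x v := x v || has x (nb v).
Definition near t x := iter t spread x.

Lemma nearS t x v : near t.+1 x v = near t x v || has (near t x) (nb v).
Proof. by []. Qed.

Lemma near_mono t x y : (forall v, x v -> y v) -> forall v, near t x v -> near t y v.
Proof.
move=> xy; elim: t => [|t IHt] v; first exact: xy.
rewrite !nearS => /orP[/IHt->//|/hasP[w wv /IHt yw]].
by apply/orP; right; apply/hasP; exists w.
Qed.

Lemma near_le s t x v : s <= t -> near s x v -> near t x v.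
Proof. by move=> /subnK<- sx; elim: (t - s) => // d IHd; rewrite addSn nearS IHd. Qed.

Lemma nearD s t x v : near (s + t) x v = near s (near t x) v.
Proof. by rewrite /near iterD. Qed.

Lemma near_ex t x v : near t x v -> exists2 u, x u & near t (pred1 u) v.
Proof.
elim: t v => [|t IHt] v; first by exists v => //=.
rewrite nearS; case/orP=> [/IHt[u xu uv]|/hasP[w wv /IHt[u xu uw]]]; exists u => //.
  exact: (near_le (leqnSn t)).
by rewrite nearS; apply/orP; right; apply/hasP; exists w.
Qed.

Lemma near_of t x u v : x u -> near t (pred1 u) v -> near t x v.
Proof. by move=> xu; apply: near_mono => w /eqP->. Qed.

Lemma near_trans s t u v w :
  near s (pred1 w) v -> near t (pred1 u) w -> near (s + t) (pred1 u) v.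
Proof. by move=> wv uw; rewrite nearD; apply: near_of wv. Qed.

Hypothesis nb_sym : forall v w, (w \in nb v) = (v \in nb w).

Lemma near_sym t u v : near t (pred1 u) v -> near t (pred1 v) u.
Proof.
elim: t v => [|t IHt] v; first by rewrite /= eq_sym.
rewrite nearS; case/orP=> [/IHt|/hasP[w wv /IHt uw]]; first exact: near_le.
rewrite /near iterSr; apply: near_of uw; apply/orP; right.
by apply/hasP; exists v; rewrite /= // -nb_sym.
Qed.

End Spread.

Definition bit j a := odd (a %/ 2 ^ j).

Lemma bit_inj b a c : a < 2 ^ b -> c < 2 ^ b ->
  (forall j, j < b -> bit j a = bit j c) -> a = c.
Proof.
elim: b a c => [|b IHb] a c; first by rewrite expn0; lia.
rewrite expnS => ha hc e; have e0 := e 0 (ltn0Sn _).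
have e1 : a %/ 2 = c %/ 2.
  apply: IHb; [lia|lia|move=> j jb]; have := e j.+1 jb.
  by rewrite /bit expnS !divnMA.
rewrite /bit expn0 !divn1 in e0.
by rewrite (divn_eq a 2) (divn_eq c 2) e1 !modn2 e0.
Qed.

Lemma foldr_minn_le a s x : x \in a :: s -> foldr minn a s <= x.
Proof.
elim: s => [|y s IHs] /=; first by rewrite inE => /eqP->.
rewrite !inE => /or3P[xa|/eqP->|xs]; last 1 first.
- by rewrite geq_min IHs ?orbT // inE xs orbT.
- by rewrite geq_min IHs ?orbT // inE xa.
by rewrite geq_min leqnn.
Qed.

Lemma foldr_minn_in a s : foldr minn a s \in a :: s.
Proof.
elim: s => [|y s IHs] /=; first by rewrite inE.
rewrite /minn; case: ifP => _; first by rewrite !inE eqxx orbT.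
by move: IHs; rewrite !inE => /orP[->//|->]; rewrite !orbT.
Qed.

Section Forest.
Variables (V : finType) (nb : V -> seq V) (ident : V -> nat) (b0 r : nat).
Hypothesis nb_sym : forall v w, (w \in nb v) = (v \in nb w).
Hypothesis id_inj : injective ident.
Let M := 2 ^ b0.
Hypothesis id_lt : forall v, ident v < M.

(* Round j drops the candidates with bit j set that have a candidate with bit j
   clear within distance 2r.  Two survivors differ in some bit, hence are further
   than 2r apart, and every drop moves the nearest candidate by at most 2r. *)
Fixpoint ruling j : V -> bool :=
  if j is j'.+1 then
    fun v => ruling j' v &&
      ~~ (bit j' (ident v) && near nb r.*2 (fun u => ruling j' u && ~~ bit j' (ident u)) v)
  else xpredT.

Lemma ruling_le i j v : i <= j -> ruling j v -> ruling i v.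
Proof. by move=> /subnK<-; elim: (j - i) => //= d IHd /andP[/IHd]. Qed.

Lemma ruling_separated u v : ruling b0 u -> ruling b0 v ->
  near nb r.*2 (pred1 u) v -> u = v.
Proof.
move=> ru rv uv; apply/id_inj; apply: (bit_inj (id_lt u) (id_lt v)) => j jb.
wlog suff H : u v ru rv uv / bit j (ident v) -> bit j (ident u).
  have uv' := near_sym nb_sym uv.
  by apply/idP/idP; apply: H.
move=> bv; apply: contraT => bu.
have /= /andP[_ /negP[]] := ruling_le jb rv; rewrite bv /=.
by apply: near_of uv; rewrite bu (ruling_le (ltnW jb) ru).
Qed.

Lemma ruling_dominating j v : near nb (r.*2 * j) (ruling j) v.
Proof.
elim: j => [|j IHj]; first by rewrite muln0.
have [u ru uv] := near_ex IHj; rewrite mulnS.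
have [ru1|] := boolP (ruling j.+1 u).
  by apply: (@near_le _ _ (r.*2 * j)); [lia|apply: near_of uv].
rewrite /= ru /= negbK => /andP[_ /near_ex[w /andP[rw bw] wu]].
have := near_trans uv wu; rewrite addnC; apply: near_of.
by rewrite /= rw (negbTE bw).
Qed.

Let R := r.*2 * b0.
Let ctr := ruling b0.

(* A label is a pair (identifier of the center, identifier of the parent); the
   message 0 stands for the absence of a label. *)
Definition label_msg (o : option (nat * nat)) := if o is Some p then p.1.+1 else 0.
Definition first_label (l : seq (nat * nat)) : option (nat * nat) :=
  if [seq p <- l | p.2 != 0] is p :: _ then Some (p.2.-1, p.1) else None.
Definition label_start v := if ctr v then Some (ident v, ident v) else None.
Definition label_step (x : V -> option (nat * nat)) v :=
  if x v is Some p then Some p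
  else first_label [seq (ident w, label_msg (x w)) | w <- nb v].
Definition label t := iter t label_step label_start.

Lemma label_stepS t v :
  label t.+1 v = if label t v is Some p then Some p
    else first_label [seq (ident w, label_msg (label t w)) | w <- nb v].
Proof. by []. Qed.

Lemma first_labelP (x : V -> option (nat * nat)) v :
  (forall w, w \in nb v -> x w = None) /\
    first_label [seq (ident w, label_msg (x w)) | w <- nb v] = None \/
  exists w c p, [/\ w \in nb v, x w = Some (c, p) &
    first_label [seq (ident w, label_msg (x w)) | w <- nb v] = Some (c, ident w)].
Proof.
elim: (nb v) => [|w s IHs]; first by left.
rewrite /first_label /=; case xw: (x w) => [[c p]|] /=.
  by right; exists w, c, p; rewrite mem_head.
case: IHs => [[sN e]|[w' [c [p [w's xw' e]]]]]; [left; split=> // w1|right].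
  by rewrite inE => /predU1P[->|/sN].
by exists w', c, p; rewrite inE w's orbT.
Qed.

Lemma label_le s t v p : s <= t -> label s v = Some p -> label t v = Some p.
Proof. by move=> /subnK<- sp; elim: (t - s) => //= d; rewrite /label_step => ->. Qed.

Lemma label_ident t v c p : label t v = Some (c, p) ->
  (exists u, ident u = c) /\ (exists u, ident u = p).
Proof.
elim: t v c p => [|t IHt] v c p.
  by rewrite /= /label_start; case: ifP => // _ [<- <-]; split; exists v.
rewrite label_stepS; case xv: (label t v) => [cp|].
  by move=> [cpe]; rewrite cpe in xv; apply: IHt xv.
case: (first_labelP (label t) v) => [[_ ->]//|[w [c' [p' [wv xw ->]]]]] [<- <-].
by split; [have [] := IHt _ _ _ xw|exists w].
Qed.

Lemma label_near t v : near nb t ctr v -> label t v <> None.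
Proof.
elim: t v => [|t IHt] v; first by rewrite /= /label_start => ->.
rewrite nearS label_stepS; case/orP=> [/IHt|/hasP[w wv /IHt xw]]; case: (label t v) => //.
by case: (first_labelP (label t) v) => [[/(_ w wv)]//|[w' [c [p [_ _ ->]]]]].
Qed.

Lemma label_total v : label R v <> None.
Proof. exact/label_near/ruling_dominating. Qed.

Definition cluster v := if label R v is Some p then p.1 else 0.
Definition parent v := if label R v is Some p then p.2 else 0.
Definition cluster_nb v := [seq w <- nb v | cluster w == cluster v].

Lemma nbC_sym v w : (w \in cluster_nb v) = (v \in cluster_nb w).
Proof. by rewrite !mem_filter eq_sym nb_sym. Qed.

Lemma label_cl t v c p : t <= R -> label t v = Some (c, p) -> cluster v = c /\ parent v = p.
Proof. by move=> tR /(label_le tR) e; rewrite /cluster /parent e. Qed.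

(** Labels are never revised, so all vertices that passed a label on end up in the same cluster. The
    center is thus reached inside the cluster, where minima will be computed. *)
Lemma label_center t v c p : t <= R -> label t v = Some (c, p) ->
  exists u, [/\ ctr u, ident u = c & near cluster_nb t (pred1 u) v].
Proof.
elim: t v c p => [|t IHt] v c p tR.
  by rewrite /= /label_start; case: ifP => // cv [<- _]; exists v.
rewrite label_stepS; case xv: (label t v) => [q|].
  move=> [qe]; rewrite qe in xv; have [u [cu uc uv]] := IHt _ _ _ (ltnW tR) xv.
  by exists u; split=> //; apply: near_le uv.
case: (first_labelP (label t) v) => [[_ ->]//|[w [c' [p' [wv xw e]]]]].
move=> lv; have [u [cu uc uw]] := IHt _ _ _ (ltnW tR) xw.
have ce : c' = c by move: lv; rewrite e => -[].
exists u; split; rewrite ?uc //; rewrite nearS; apply/orP; right; apply/hasP.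
exists w => //; rewrite mem_filter wv andbT.
rewrite (label_cl (ltnW tR) xw).1.
have lv' : label t.+1 v = Some (c, p) by rewrite label_stepS xv.
by rewrite (label_cl tR lv').1 ce.
Qed.

Lemma near_nbC t x v : near cluster_nb t x v -> near nb t x v.
Proof.
elim: t v => // t IHt v; rewrite !nearS => /orP[/IHt->//|/hasP[w]].
rewrite mem_filter => /andP[_ wv] /IHt xw.
by apply/orP; right; apply/hasP; exists w.
Qed.

Lemma center_ex v : exists u, [/\ ctr u, ident u = cluster v & near cluster_nb R (pred1 u) v].
Proof.
case xv: (label R v) (@label_total v) => [[c p]|//] _.
have [u [cu uc uv]] := label_center (leqnn R) xv.
by exists u; split=> //; rewrite /cluster xv.
Qed.

(** At time [r] the vertex [v] already has a label, whose center is also within distance [r]; two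
    centers within [2 * r] coincide. *)
Lemma cl_ball u v : ctr u -> near nb r (pred1 u) v -> r <= R -> cluster v = ident u.
Proof.
move=> cu uv rR; have /label_near := near_of cu uv.
case xv: (label r v) => [[c p]|//] _.
have [u' [cu' uc' /near_nbC u'v]] := label_center rR xv.
rewrite (label_cl rR xv).1 -uc' -(@ruling_separated u u') //.
have := near_trans (near_sym nb_sym u'v) uv; rewrite addnn.
by [].
Qed.

Lemma cl_center u : ctr u -> cluster u = ident u.
Proof.
move=> cu; have e : label 0 u = Some (ident u, ident u) by rewrite /= /label_start cu.
by have [] := label_cl (leq0n R) e.
Qed.

Lemma near_same v w : cluster v = cluster w -> near cluster_nb R.*2 (pred1 w) v.
Proof.
have [u [cu eu uv]] := center_ex v; have [u' [cu' eu' uw]] := center_ex w.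
move=> e; have uu' : u = u' by apply: id_inj; rewrite eu e.
by rewrite -addnn; apply: near_trans uv (near_sym nbC_sym _); rewrite uu'.
Qed.

(** Follow the parents: each was labelled earlier, with the same center. [F] is left open because
    the forest is defined only after the shifts. *)
Lemma par_connect (F : rel V) :
  (forall v w, w \in nb v -> parent v = ident w -> F v w) ->
  forall v, exists2 u, ident u = cluster v & connect F v u.
Proof.
move=> FP; suff H t v c p : t <= R -> label t v = Some (c, p) ->
    exists2 u, ident u = c & connect F v u.
  move=> v; case xv: (label R v) (@label_total v) => [[c p]|//] _.
  by have [u uc uv] := H _ _ _ _ (leqnn R) xv; exists u => //; rewrite /cluster xv.
elim: t v c p => [|t IHt] v c p tR.
  by rewrite /= /label_start; case: ifP => // cv [<- _]; exists v.
rewrite label_stepS; case xv: (label t v) => [q|].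
  by move=> [qe]; rewrite qe in xv; exact: IHt (ltnW tR) xv.
case: (first_labelP (label t) v) => [[_ ->]//|[w [c' [p' [wv xw e]]]]].
move=> lv; have [u uc uw] := IHt _ _ _ (ltnW tR) xw.
have lv' : label t.+1 v = Some (c, p) by rewrite label_stepS xv.
move: (lv); rewrite e => -[ce pe].
exists u; rewrite ?uc //; apply: connect_trans uw; apply/connect1/FP => //.
by rewrite (label_cl tR lv').2 pe.
Qed.

(** A cluster takes every decision as a minimum over its members, so that all of them know it. Via
    the center, two members are at most [2 * R] steps apart within the cluster, whence [R.*2]
    rounds. *)
Definition cmin_step (x : V -> nat) v := foldr minn (x v) [seq x w | w <- cluster_nb v].
Definition cmin (x : V -> nat) := iter R.*2 cmin_step x.

Lemma cmin_near t x v w : near cluster_nb t (pred1 w) v -> iter t cmin_step x v <= x w.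
Proof.
elim: t v => [|t IHt] v; first by move=> /eqP->.
rewrite nearS; case/orP=> [/IHt|/hasP[v' v'v /IHt]] /=; apply: leq_trans; apply: foldr_minn_le.
  exact: mem_head.
by rewrite inE; apply/orP; right; apply/mapP; exists v'.
Qed.

Lemma cmin_le x v w : cluster v = cluster w -> cmin x v <= x w.
Proof. by move=> /near_same; apply: cmin_near. Qed.

Lemma cmin_ex x v : exists2 w, cluster w = cluster v & cmin x v = x w.
Proof.
rewrite /cmin; elim: R.*2 v => [|t IHt] v; first by exists v.
have := foldr_minn_in (iter t cmin_step x v) [seq iter t cmin_step x w | w <- cluster_nb v].
rewrite inE => /predU1P[|/mapP[w]].
  by have [w ew e2] := IHt v; move=> e; exists w; rewrite // -e2.
rewrite mem_filter => /andP[/eqP ew _]; have [w' ew' e2] := IHt w; move=> e.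
by exists w'; rewrite ?ew' // -e2.
Qed.

Lemma cmin_const x v w : cluster v = cluster w -> cmin x v = cmin x w.
Proof.
wlog suff H : v w / cluster v = cluster w -> cmin x v <= cmin x w.
  by move=> e; apply/eqP; rewrite eqn_leq !H.
by move=> e; have [w' ew' ->] := cmin_ex x w; apply: cmin_le; rewrite ew'.
Qed.

End Forest.

(** * Random shifts between clusters *)

Section Shifts.
Variables (V : finType) (nb : V -> seq V) (ident : V -> nat) (b0 r : nat).
Hypothesis nb_sym : forall v w, (w \in nb v) = (v \in nb w).
Hypothesis ident_inj : injective ident.
Hypothesis ident_lt : forall v, ident v < 2 ^ b0.
Variables (start : V -> nat) (L T : nat).
Hypothesis start_le : forall v, start v <= L.

Local Notation M := (2 ^ b0).
Local Notation cluster := (cluster nb ident b0 r).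
Local Notation parent := (parent nb ident b0 r).
Local Notation cmin := (cmin nb ident b0 r).
Let cminC x v w : cluster v = cluster w -> cmin x v = cmin x w.
Proof. exact: cmin_const. Qed.
Let cminL x v w : cluster v = cluster w -> cmin x v <= x w.
Proof. exact: cmin_le. Qed.
Let cminX x v : exists2 w, cluster w = cluster v & cmin x v = x w.
Proof. exact: cmin_ex. Qed.

(* [mark t v = Some (f, c)] means that the cluster of [v] was reached at time
   [f < t] by the hub [c]; the message [M] stands for the absence of a hub. *)
Definition mark_msg (o : option (nat * nat)) := if o is Some p then p.2 else M.
(** A center proposes itself once its start time has come; a neighbour passes on its own hub. Among
    hubs that arrive together the least identifier wins, so a cluster is marked as a whole. *)
Definition mark_cand t (a : V -> option (nat * nat)) v :=
  foldr minn (if (cluster v == ident v) && (start v <= t) then ident v else M)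
    [seq mark_msg (a w) | w <- nb v].
Definition mark_step t a v :=
  if a v is Some p then Some p else
  let y := cmin (mark_cand t a) v in if y < M then Some (t, y) else None.
Fixpoint mark t : V -> option (nat * nat) :=
  if t is t'.+1 then mark_step t' (mark t') else fun => None.

Lemma mark_leq t t' v p : t <= t' -> mark t v = Some p -> mark t' v = Some p.
Proof. by move=> /subnK<- sp; elim: (t' - t) => //= d; rewrite /mark_step => ->. Qed.

Lemma mark_const t v w : cluster v = cluster w -> mark t v = mark t w.
Proof. by move=> e; elim: t => //= t IHt; rewrite /mark_step IHt (cminC _ e). Qed.

Lemma mark_lt t v f c : mark t v = Some (f, c) ->
  [/\ f < t, c < M, mark f v = None & mark f.+1 v = Some (f, c)].
Proof.
elim: t => //= t IHt; rewrite {1}/mark_step; case e: (mark t v) => [p|].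
  by move=> [pe]; rewrite pe in e; have [ft cM h1 h2] := IHt e; split=> //; lia.
by case: ifP => // yM [<- <-]; split=> //; rewrite /= /mark_step e yM.
Qed.

Lemma mark_cand_lt t v w : cluster v = cluster w -> mark_cand t (mark t) w < M -> mark t.+1 v
  <> None.
Proof.
move=> e cM /=; rewrite /mark_step; case: (mark t v) => //.
by rewrite (leq_ltn_trans (cminL _ e) cM).
Qed.

Lemma mark_start t u v : cluster v = ident u -> start u <= t -> mark t.+1 v <> None.
Proof.
move=> e st; have [u' [cu' eu' _]] := center_ex nb ident b0 r v.
have uu' : u' = u by apply: ident_inj; rewrite eu'.
have cu : cluster u = ident u by rewrite -uu'; apply: cl_center.
apply: (@mark_cand_lt t v u); first by rewrite e cu.
rewrite /mark_cand cu eqxx st /=.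
by apply: leq_ltn_trans (ident_lt u); apply: foldr_minn_le; rewrite mem_head.
Qed.

Lemma mark_spread t v w : w \in nb v -> mark t w <> None -> mark t.+1 v <> None.
Proof.
move=> wv; case e: (mark t w) => [[f c]|//] _.
apply: (@mark_cand_lt t v v) => //; have [_ cM _ _] := mark_lt e.
apply: leq_ltn_trans cM; apply: foldr_minn_le; rewrite inE; apply/orP; right.
by apply/mapP; exists w; rewrite // e.
Qed.

(** The graph of clusters pulled back to vertices, so that [near] measures distances in it. *)
Definition cluster_adj v := [seq w <- enum V | [exists v', (cluster v' == cluster v) &&
   [exists w', (cluster w' == cluster w) && (w' \in nb v')]]].

Lemma cnbP v w : reflect (exists v' w', [/\ cluster v' = cluster v,
  cluster w' = cluster w & w' \in nb v']) (w \in cluster_adj v).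
Proof.
rewrite mem_filter mem_enum andbT; apply: (iffP existsP) => [[v' /andP[/eqP e /existsP[w'
  /andP[/eqP e' h]]]]|].
  by exists v', w'.
move=> [v' [w' [e e' h]]]; exists v'; rewrite e eqxx; apply/existsP; exists w'.
by rewrite e' eqxx.
Qed.

(* [cnear t u v]: the cluster centered at [u] is within [t] steps of the cluster
   of [v] in the graph of clusters. *)
Definition cnear t u v := near cluster_adj t (fun w => cluster w == ident u) v.

(** With [mark_cnear], this makes the marking time of a cluster the minimum of [start u + d] over
    the centers [u] at distance [d]. *)
Lemma cnear_mark d u v : cnear d u v -> mark (start u + d).+1 v <> None.
Proof.
rewrite /cnear; elim: d v => [|d IHd] v.
  by move=> /eqP e; rewrite addn0; apply: mark_start e _.
rewrite nearS; case/orP=> [/IHd|/hasP[w /cnbP[v' [w' [ev ew h]]] /IHd]].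
  rewrite addnS; case e: (mark _ v) => [p|//] _.
  by rewrite (mark_leq _ e).
rewrite addnS -(mark_const _ ew) -(mark_const _ ev); exact: mark_spread.
Qed.

Lemma mark_cnear t v f c : mark t v = Some (f, c) ->
  exists u d, [/\ cluster u = ident u, ident u = c, cnear d u v & start u + d <= f].
Proof.
elim: t v f c => // t IHt v f c /=; rewrite /mark_step; case e: (mark t v) => [p|].
  by move=> [pe]; apply: IHt; rewrite e pe.
case: ifP => // + [<- yc]; rewrite yc; have [v' ev ec] := cminX (mark_cand t (mark t)) v.
move: ec; rewrite yc {yc} => -> {c}.
have := foldr_minn_in (if (cluster v' == ident v') && (start v' <= t) then ident v' else M)
    [seq mark_msg (mark t w) | w <- nb v'].
rewrite -/(mark_cand t (mark t) v') inE => /predU1P[->|/mapP[w wv ->]].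
  case: ifP => [/andP[/eqP e1 e2] _|]; last by rewrite ltnn.
  by exists v', 0; rewrite addn0 /cnear /= -ev e1 eqxx.
case ew: (mark t w) => [[f' c']|] /=; last by rewrite ltnn.
have [u [d [cu uc ud le]]] := IHt _ _ _ ew => _; exists u, d.+1; split=> //.
  rewrite /cnear nearS; apply/orP; right; apply/hasP; exists w => //.
  by apply/cnbP; exists v', w.
by have [ft _ _ _] := mark_lt ew; rewrite addnS; lia.
Qed.

(** A hub other than the cluster itself arrived from a cluster marked strictly earlier; iterating
    this traces a mark back to its hub. *)
Lemma mark_pred t v f c : mark t v = Some (f, c) -> c = cluster v \/
  exists v' w f', [/\ cluster v' = cluster v, w \in nb v', f' < f & mark t w = Some (f', c)].
Proof.
move=> h; have [ft cM fN] := mark_lt h; rewrite /= /mark_step fN.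
case: ifP => // _ [yc]; have [v' ev ec] := cminX (mark_cand f (mark f)) v.
move: ec; rewrite yc => ec.
have := foldr_minn_in (if (cluster v' == ident v') && (start v' <= f) then ident v' else M)
    [seq mark_msg (mark f w) | w <- nb v'].
rewrite -/(mark_cand f (mark f) v') -ec inE => /predU1P[|/mapP[w wv]].
  by case: ifP => [/andP[/eqP e1 e2] ->|]; [left; rewrite -ev e1|lia].
case ew: (mark f w) => [[f' c']|] /= ce; last by lia.
right; exists v', w, f'; have [f'f _ _ _] := mark_lt ew; split=> //.
by rewrite ce; apply: mark_leq ew; lia.
Qed.

Definition mark_time v := if mark L.+1 v is Some p then p.1 else 0.
Definition hub v := if mark L.+1 v is Some p then p.2 else 0.

Lemma mark_end v : mark L.+1 v = Some (mark_time v, hub v).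
Proof.
have [u [_ eu _]] := center_ex nb ident b0 r v.
have := @mark_start L u v; rewrite eu => /(_ erefl (start_le u)).
by rewrite /mark_time /hub; case: (mark L.+1 v) => [[]|].
Qed.

Lemma tm_const v w : cluster v = cluster w -> mark_time v = mark_time w.
Proof. by move=> e; rewrite /mark_time (mark_const _ e). Qed.
Lemma hub_const v w : cluster v = cluster w -> hub v = hub w.
Proof. by move=> e; rewrite /hub (mark_const _ e). Qed.
Lemma hub_lt v : hub v < M.
Proof. by have [] := mark_lt (mark_end v). Qed.
Lemma tm_leq v : mark_time v <= L.
Proof. by have [] := mark_lt (mark_end v). Qed.

Lemma tm_le u d v : cnear d u v -> mark_time v <= start u + d.
Proof.
move=> h; rewrite leqNgt; apply/negP => lt.
have [_ _ tN _] := mark_lt (mark_end v).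
case e: (mark (start u + d).+1 v) (cnear_mark h) => [p|//] _.
by have := mark_leq lt e; rewrite tN.
Qed.

Lemma hub_near v : exists u d, [/\ cluster u = ident u, ident u = hub v,
  cnear d u v & start u + d <= mark_time v].
Proof. exact: mark_cnear (mark_end v). Qed.

Lemma hub_pred v : hub v = cluster v \/
  exists v' w, [/\ cluster v' = cluster v, w \in nb v', mark_time w < mark_time v & hub w = hub
    v].
Proof.
have [->|[v' [w [f' [e wv' f'f e']]]]] := mark_pred (mark_end v); first by left.
by right; exists v', w; rewrite /mark_time /hub e' -/(mark_time v) -/(hub v); split.
Qed.

(* An edge to a cluster of the same hub is only useful if it leads closer to that
   hub.  The hub of [w] would reach the cluster of [v] at time at most
   [(mark_time w).+1 <= (mark_time v).+1]; this is what bounds the keys below. *)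
Definition eligible v w := (cluster w != cluster v) &&
  ((mark_time w < mark_time v) || (mark_time w == mark_time v) && (hub w != hub v)).

Lemma eligC v v' w : cluster v = cluster v' -> eligible v w = eligible v' w.
Proof. by move=> e; rewrite /eligible e (tm_const e) (hub_const e). Qed.

Definition keyset v : {set V} := [set u | [exists v', exists w,
   [&& cluster v' == cluster v, w \in nb v', eligible v' w & hub w == ident u]]].

Lemma keysetP v u : reflect (exists v' w, [/\ cluster v' = cluster v, w \in nb v',
  eligible v' w & hub w = ident u])
  (u \in keyset v).
Proof.
rewrite inE; apply: (iffP existsP) => [[v' /existsP[w /and4P[/eqP ? ? ? /eqP ?]]]|].
  by exists v', w.
by move=> [v' [w [e h h' e']]]; exists v'; apply/existsP; exists w; rewrite e e' h h' !eqxx.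
Qed.

(** A key has reached the neighbour [w] by the time of [w], which is at most that of [v], and is one
    step from there. All keys thus arrive within one unit of the earliest arrival, a window that
    random shifts rarely fill. *)
Lemma keyset_near u v : u \in keyset v ->
  exists2 d, cnear d u v & start u + d <= (mark_time v).+1.
Proof.
move=> /keysetP[v' [w [e wv' el eh]]].
have [u' [d [_ eu' ud sd]]] := hub_near w.
have uu' : u' = u by apply: ident_inj; rewrite eu'.
rewrite {}uu' in ud sd.
exists d.+1.
  rewrite /cnear nearS; apply/orP; right; apply/hasP; exists w => //.
  by apply/cnbP; exists v', w.
have : mark_time w <= mark_time v by rewrite -(tm_const e); move: el => /andP[_]; lia.
lia.
Qed.

(* Minimizing the code minimizes the hub first, and then designates one edge. *)
Definition edge_code v w := (hub w * M + ident v) * M + ident w.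

Lemma M_gt0 : 0 < M. Proof. by rewrite expn_gt0. Qed.

Lemma code_ident2 v w : edge_code v w %% M = ident w.
Proof. by rewrite modnMDl modn_small. Qed.
Lemma code_div v w : edge_code v w %/ M = hub w * M + ident v.
Proof. by rewrite divnMDl ?M_gt0 // (divn_small (ident_lt w)) addn0. Qed.
Lemma code_ident1 v w : edge_code v w %/ M %% M = ident v.
Proof. by rewrite code_div modnMDl modn_small. Qed.
Lemma code_hub v w : edge_code v w %/ M ^ 2 = hub w.
Proof.
by rewrite expnS expn1 divnMA code_div divnMDl ?M_gt0 // (divn_small (ident_lt v)) addn0.
Qed.
Lemma code_lt v w : edge_code v w < M ^ 3.
Proof.
have lt a c n m : a < n -> c < m -> a * m + c < n * m.
  move=> an cm; apply: (@leq_trans (a.+1 * m)); first by rewrite mulSn addnC ltn_add2r.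
  by rewrite leq_mul2r an orbT.
have -> : M ^ 3 = M * M * M by rewrite !expnS expn0 muln1 mulnA.
exact: lt (lt _ _ _ _ (hub_lt w) (ident_lt v)) (ident_lt w).
Qed.

(** * Serving the keys of a cluster one by one *)

Definition pick_cand (bound : V -> nat) v := foldr minn (M ^ 3)
  [seq edge_code v w | w <- nb v & eligible v w && (bound v <= hub w)].

(** Keys are served by increasing hub: the cutoff lies just above the hub of the last choice. Once
    no candidate is left, the default [M ^ 3] gives the cutoff [M.+1], above every hub. *)
Fixpoint cutoff q : V -> nat :=
  if q is q'.+1 then fun v => (cmin (pick_cand (cutoff q')) v %/ M ^ 2).+1
  else fun => 0.
Definition choice q := cmin (pick_cand (cutoff q)).

Lemma cutoffS q v : cutoff q.+1 v = (choice q v %/ M ^ 2).+1.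
Proof. by []. Qed.

Lemma cutoff_const q v w : cluster v = cluster w -> cutoff q v = cutoff q w.
Proof. by case: q => // q e; rewrite !cutoffS /choice (cminC _ e). Qed.

Lemma choice_const q v w : cluster v = cluster w -> choice q v = choice q w.
Proof. exact: cminC. Qed.

Lemma pick_cand_le la v w : w \in nb v -> eligible v w -> la v <= hub w ->
  pick_cand la v <= edge_code v w.
Proof.
move=> wv el lw; apply: foldr_minn_le; rewrite inE; apply/orP; right.
by apply/mapP; exists w; rewrite // mem_filter el lw wv.
Qed.

Lemma choice_le q v v' w : cluster v' = cluster v -> w \in nb v' -> eligible v' w ->
  cutoff q v <= hub w -> choice q v <= edge_code v' w.
Proof.
move=> e wv' el lw; apply: leq_trans (cminL _ (esym e)) _; apply: pick_cand_le => //.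
by rewrite (cutoff_const q e).
Qed.

Lemma choiceP q v : choice q v = M ^ 3 \/ exists v' w,
  [/\ cluster v' = cluster v, w \in nb v', eligible v' w, cutoff q v <= hub w & choice q v =
    edge_code v' w].
Proof.
rewrite /choice; have [v' e ->] := cminX (pick_cand (cutoff q)) v.
have := foldr_minn_in (M ^ 3) [seq edge_code v' w | w <- nb v' & eligible v' w && (cutoff q v'
  <= hub w)].
rewrite -/(pick_cand _ _) inE => /predU1P[->|/mapP[w]]; first by left.
rewrite mem_filter (cutoff_const q e) => /andP[/andP[el lw] wv'] ->.
by right; exists v', w.
Qed.

Lemma cutoff_keys q v v' w : cluster v' = cluster v -> w \in nb v' -> eligible v' w ->
  hub w < cutoff q v -> exists q' v1 w1, [/\ q' < q, cluster v1 = cluster v, w1 \in nb v1,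
    eligible v1 w1 &
   hub w1 = hub w /\ choice q' v1 = edge_code v1 w1].
Proof.
move=> e wv' el; elim: q => // q IHq; rewrite cutoffS => lt.
have [/IHq [q' [v1 [w1 [? ? ? ? ?]]]]|ge] := ltnP (hub w) (cutoff q v).
  by exists q', v1, w1; split=> //; lia.
(* The hub of [w] lies between two consecutive cutoffs, so the choice made in between, being
   minimal, has the same hub, though perhaps another edge. *)
have le := choice_le e wv' el ge.
have le2 := leq_div2r (M ^ 2) le; rewrite code_hub in le2.
case: (choiceP q v) => [eM|[v1 [w1 [e1 w1v el1 _ ec]]]].
  by have := code_lt v' w; lia.
exists q, v1, w1; split=> //; split; last by rewrite (choice_const _ e1).
by move: lt le2; rewrite ec code_hub; lia.
Qed.

Lemma cutoff_mono q v : cutoff q v <= cutoff q.+1 v.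
Proof.
rewrite cutoffS; case: (choiceP q v) => [->|[v1 [w1 [_ _ _ l ->]]]]; last by rewrite code_hub;
  lia.
rewrite expnS mulnK ?expn_gt0 //.
case: q => // q; rewrite cutoffS ltnS; case: (choiceP q v) => [->|[? [w1 [_ _ _ _ ->]]]].
  by rewrite expnS mulnK ?expn_gt0.
by rewrite code_hub ltnW // hub_lt.
Qed.

(** Each choice puts a further key below the cutoff, unless none is left and then all are below; so
    [T] choices serve up to [T] keys. *)
Lemma cutoff_count q v : minn q #|keyset v| <= #|[set u in keyset v | ident u < cutoff q v]|.
Proof.
elim: q => [|q IHq]; first by rewrite min0n.
have sub : [set u in keyset v | ident u < cutoff q v] \subset [set u in keyset v | ident u <
  cutoff q.+1 v].
  by apply/subsetP => u; rewrite !inE => /andP[-> /leq_trans]; apply; exact: cutoff_mono.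
case: (choiceP q v) => [eM|[v1 [w1 [e1 w1v el1 l ec]]]].
  suff -> : [set u in keyset v | ident u < cutoff q.+1 v] = keyset v by rewrite geq_minr.
  apply/setP => u; rewrite inE cutoffS eM expnS mulnK ?expn_gt0 //.
  by rewrite ltnS ltnW ?andbT.
have [u [d [_ eu _ _]]] := hub_near w1.
have uk : u \in keyset v by apply/keysetP; exists v1, w1.
have : u |: [set u in keyset v | ident u < cutoff q v] \subset [set u in keyset v | ident u <
  cutoff q.+1 v].
  rewrite subUset sub andbT sub1set !inE -/(keyset v).
  by move: uk; rewrite inE => ->; rewrite cutoffS ec code_hub eu ltnSn.
move=> /subset_leq_card; rewrite cardsU1 inE -eu in l *.
rewrite [ident u < _]ltnNge l andbF add1n.
by apply: leq_trans; lia.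
Qed.

Lemma keys_found v v' w : #|keyset v| <= T -> cluster v' = cluster v -> w \in nb v' -> eligible
  v' w ->
  exists q v1 w1, [/\ q < T, cluster v1 = cluster v, w1 \in nb v1, eligible v1 w1 &
   hub w1 = hub w /\ choice q v1 = edge_code v1 w1].
Proof.
move=> kT e wv' el; apply: (cutoff_keys e wv' el).
have := cutoff_count T v; rewrite (minn_idPr kT) => le.
have sub : [set u in keyset v | ident u < cutoff T v] \subset keyset v.
  by apply/subsetP => u; rewrite inE => /andP[].
have /eqP eqk : [set u in keyset v | ident u < cutoff T v] == keyset v by rewrite eqEcard sub.
have [u [d [_ eu _ _]]] := hub_near w.
have : u \in keyset v by apply/keysetP; exists v', w.
by rewrite -eqk inE eu => /andP[].
Qed.

(** The whole cluster knows the choice, but only the endpoint named in its code points along the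
    edge. [M] is the identifier of no vertex. *)
Definition pointer q v :=
  if (choice q v < M ^ 3) && (choice q v %/ M %% M == ident v) then choice q v %% M else M.
Definition pointers v := parent v :: [seq pointer q v | q <- iota 0 T].
Definition forest : rel V := fun v w =>
  (w \in nb v) && ((ident w \in pointers v) || (ident v \in pointers w)).

Lemma forest_sym v w : forest v w = forest w v.
Proof. by rewrite /forest nb_sym orbC. Qed.

Lemma forest_choice q v w : q < T -> w \in nb v -> choice q v = edge_code v w -> forest v w.
Proof.
move=> qT wv e; rewrite /forest wv; apply/orP; left; rewrite inE; apply/orP; right.
apply/mapP; exists q; first by rewrite mem_iota.
by rewrite /pointer e code_lt code_ident1 code_ident2 eqxx.
Qed.

(** * Connectivity of the forest *)

Section Connect.
Hypothesis keyset_small : forall v, #|keyset v| <= T.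

Let csym : connect_sym forest.
Proof. exact: sym_connect_sym forest_sym. Qed.

Lemma forest_same v w : cluster v = cluster w -> connect forest v w.
Proof.
have H : forall v w, w \in nb v -> parent v = ident w -> forest v w.
  by move=> v' w' h e; rewrite /forest h /pointers e mem_head.
have [u eu vu] := par_connect H v.
have [u' eu' wu'] := par_connect H w.
move=> e; have uu' : u = u' by apply: ident_inj; rewrite eu eu'.
by apply: connect_trans vu _; rewrite csym uu'.
Qed.

(** The edge kept towards the hub of [w] may be another one, but it is eligible too; if its hub is
    also that of [v], eligibility forces an earlier time. *)
Lemma forest_elig v w : w \in nb v -> eligible v w ->
  exists w', [/\ connect forest v w', hub w' = hub w & hub w = hub v -> mark_time w' <
    mark_time v].
Proof.
move=> wv el; have [q [v1 [w1 [qT e1 w1v1 el1 [eh ec]]]]] := keys_found (keyset_small v) erefl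
  wv el.
exists w1; split=> // [|hv].
  apply: connect_trans (forest_same (esym e1)) (connect1 _).
  exact: forest_choice ec.
by move: el1; rewrite (eligC _ e1) /eligible eh hv eqxx andbF orbF => /andP[].
Qed.

(** Induction on the marking time: the edge kept towards one's own hub leads to a cluster marked
    earlier, so every vertex is joined to the center that is its hub. *)
Lemma forest_hub v w : hub v = hub w -> connect forest v w.
Proof.
have H n v' : mark_time v' < n -> exists2 u, cluster u = hub v' & connect forest v' u.
  elim: n v' => // n IHn {}v tn; case: (hub_pred v) => [->|]; first by exists v.
  move=> [v' [w' [e w'v' lt eh]]].
  have el : eligible v' w'.
    by rewrite (eligC _ e) /eligible lt andbT; apply/eqP => /tm_const; lia.
  have [w1 [c1 eh1 /(_ _)]] := forest_elig w'v' el.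
  rewrite eh (hub_const e) (tm_const e) => /(_ erefl) lt1.
  have [|u eu cu] := IHn w1; first by lia.
  exists u; first by rewrite eu eh1.
  by apply: connect_trans cu; apply: connect_trans c1; apply: forest_same.
have [u eu cu] := H _ _ (ltnSn (mark_time v)); have [u' eu' cu'] := H _ _ (ltnSn (mark_time w)).
move=> e; apply: connect_trans cu _; rewrite csym; apply: connect_trans cu' _.
by apply: forest_same; rewrite eu' eu.
Qed.

Theorem forest_connect v w : w \in nb v -> connect forest v w.
Proof.
move=> wv; have [/forest_same//|cvw] := eqVneq (cluster v) (cluster w).
have [/forest_hub//|hvw] := eqVneq (hub v) (hub w).
(* The endpoint that was not marked earlier finds the edge eligible, its hubs being different. *)
wlog le : v w wv cvw hvw / mark_time w <= mark_time v.
  move=> H; case: (leqP (mark_time w) (mark_time v)) => [|/ltnW] /H; first exact.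
  by rewrite csym eq_sym [hub w == _]eq_sym -nb_sym; apply.
have el : eligible v w by rewrite /eligible eq_sym cvw [hub w == _]eq_sym hvw andbT; lia.
have [w' [c' e' _]] := forest_elig wv el.
exact: connect_trans c' (forest_hub e').
Qed.

End Connect.

(** * Number of edges of a forest *)

Definition edges (e : rel V) : {set {set V}} :=
  [set x | [exists v, exists w, e v w && (x == [set v; w])]].

Lemma edgesP (e : rel V) x : reflect (exists v w, e v w /\ x = [set v; w]) (x \in edges e).
Proof.
rewrite inE; apply: (iffP existsP) => [[v /existsP[w /andP[? /eqP]]]|]; first by exists v, w.
by move=> [v [w [h ->]]]; exists v; apply/existsP; exists w; rewrite h eqxx.
Qed.

Let named a := [set v | ident v == a].
Let namedE v : named (ident v) = [set v].
Proof. by apply/setP => w; rewrite !inE (inj_eq ident_inj). Qed.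

Definition open_centers := [set u | ruling nb ident r b0 u &&
  [exists v, exists w, [&& cluster v == ident u, w \in nb v & cluster w != ident u]]].

(** Each vertex pays for its parent edge. The choice is constant on a cluster, so a cluster with
    outgoing edges pays for one edge per index [q < T]; the others have nothing to choose. *)
Lemma card_forest : #|edges forest| <= #|V| + #|open_centers| * T.
Proof.
pose P := [set [set v] :|: named (parent v) | v in V].
pose Q := [set named (choice p.2 p.1 %/ M %% M) :|: named (choice p.2 p.1 %% M)
            | p : V * 'I_T in setX open_centers [set: 'I_T]].
have sub : edges forest \subset P :|: Q.
  apply/subsetP => x /edgesP[v [w [+ ->]]].
  wlog h : v w / ident w \in pointers v.
    move=> H; rewrite /forest => /andP[wv /orP[]] h; first by apply: H => //;
      rewrite /forest wv h.
    by rewrite setUC; apply: H => //; rewrite forest_sym /forest wv h orbT.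
  move=> /andP[wv _]; rewrite inE; move: h; rewrite inE => /predU1P[e|].
    by apply/orP; left; apply/imsetP; exists v; rewrite // -e namedE.
  move=> /mapP[q]; rewrite mem_iota add0n => /andP[_ qT]; rewrite /pointer.
  case: ifP => [/andP[cM /eqP e1] e2|_ e]; last by have := ident_lt w; rewrite e; lia.
  case: (choiceP q v) => [|[v' [w' [ev w'v' el _ ec]]]]; first by lia.
  have [u [cu eu _]] := center_ex nb ident b0 r v.
  apply/orP; right; apply/imsetP; exists (u, Ordinal qT).
    rewrite in_setX in_setT andbT inE /= cu; apply/existsP; exists v'; apply/existsP; exists w'.
    by rewrite ev eu eqxx w'v' -ev; case/andP: el.
  rewrite /= (choice_const q (w := v)) ?e1 -?e2 ?namedE //.
  by rewrite (cl_center cu).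
apply: leq_trans (subset_leq_card sub) _; apply: leq_trans (leq_card_setU _ _).1 _.
apply: leq_add; first by rewrite (leq_trans (leq_imset_card _ _)) // max_card.
by apply: leq_trans (leq_imset_card _ _) _; rewrite cardsX cardsT card_ord.
Qed.

(** A ball that stops growing is a whole component. It then contains a vertex [w] adjacent to the
    cluster but outside it, which contradicts [cl_ball]. *)
Lemma ball_grow u t : ruling nb ident r b0 u -> r <= r.*2 * b0 ->
  u \in open_centers -> t <= r -> t < #|[set v | near nb t (pred1 u) v]|.
Proof.
move=> cu rR; rewrite inE => /andP[_ /existsP[v /existsP[w /and3P[/eqP ev wv nw]]]].
elim: t => [|t IHt] tr; first by apply/card_gt0P; exists u; rewrite inE /=.
apply: leq_ltn_trans (IHt (ltnW tr)) _; apply: proper_card.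
have sub : [set v | near nb t (pred1 u) v] \subset [set v | near nb t.+1 (pred1 u) v].
  by apply/subsetP => x; rewrite !inE; apply: near_le.
rewrite properE sub; apply: contra nw => sub'.
have cl_all s x : near nb s (pred1 u) x -> near nb t (pred1 u) x.
  elim: s x => [|s IHs] x; first exact: near_le.
  rewrite nearS => /orP[/IHs//|/hasP[y yx /IHs uy]].
  have /subsetP/(_ x) := sub'; rewrite !inE; apply.
  by rewrite nearS; apply/orP; right; apply/hasP; exists y.
have [u' [_ eu' uv]] := center_ex nb ident b0 r v.
have uu' : u' = u by apply: ident_inj; rewrite eu'.
rewrite {}uu' in uv; have uw : near nb (r.*2 * b0).+1 (pred1 u) w.
  rewrite nearS; apply/orP; right; apply/hasP; exists v; first by rewrite -nb_sym.
  exact: near_nbC uv.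
apply/eqP; apply: cl_ball => //; apply: near_le (cl_all _ _ uw).
exact: ltnW.
Qed.

Lemma card_open_centers : r <= r.*2 * b0 -> #|open_centers| * r.+1 <= #|V|.
Proof.
move=> rR; rewrite -sum_nat_const.
have h u : u \in open_centers -> r.+1 <= \sum_v (cluster v == ident u).
  move=> uo; have cu : ruling nb ident r b0 u by move: (uo); rewrite inE => /andP[].
  apply: leq_trans (ball_grow cu rR uo (leqnn r)) _.
  rewrite -sum1_card [X in X <= _]big_mkcond leq_sum // => v _.
  by rewrite inE; case: ifP => // uv; rewrite (cl_ball nb_sym ident_inj ident_lt cu uv rR) eqxx.
apply: (@leq_trans (\sum_(u in open_centers) \sum_v (cluster v == ident u))).
  by apply: leq_sum => u; apply: h.
rewrite exchange_big -sum1_card /= leq_sum // => v _.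
have [u /andP[uo /eqP e]|no] := pickP [pred u | (u \in open_centers) && (cluster v == ident u)].
  rewrite (bigD1 u) //= e eqxx big1 // => u' /andP[_ ne].
  by rewrite (inj_eq ident_inj) eq_sym (negbTE ne).
by rewrite big1 // => u uo; have := no u; rewrite /= uo /= => ->.
Qed.

End Shifts.

(** * Distributed computability *)

Definition bits q a : seq bool := [seq bit j a | j <- iota 0 q].
Definition unbits q (s : seq bool) : nat :=
  if [pick a : 'I_(2 ^ q) | bits q a == s] is Some a then a else 0.

Lemma size_bits q a : size (bits q a) = q.
Proof. by rewrite size_map size_iota. Qed.

Lemma bitsK q a : a < 2 ^ q -> unbits q (bits q a) = a.
Proof.
move=> lt; rewrite /unbits; case: pickP => [c /eqP e|/(_ (Ordinal lt))];
  last by rewrite /= eqxx.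
apply: (@bit_inj q) => // j jq.
by have := congr1 (fun s => nth false s j) e; rewrite !(nth_map 0) ?size_iota // nth_iota.
Qed.

Notation msg := (nat * nat * nat)%type.
Definition small q (x : msg) := [&& x.1.1 < 2 ^ q, x.1.2 < 2 ^ q & x.2 < 2 ^ q].

Definition encode b q (x : msg) : {bseq b of bool} :=
  insub_bseq b (bits q x.1.1 ++ bits q x.1.2 ++ bits q x.2).
Definition decode b q (s : {bseq b of bool}) : msg :=
  locked (unbits q (take q s), unbits q (take q (drop q s)), unbits q (drop q (drop q s))).

Lemma encodeK b q x : 3 * q <= b -> small q x -> decode q (encode b q x) = x.
Proof.
case: x => [[x y] z] qb /and3P[/= xq yq zq]; rewrite /decode -lock.
have -> : (encode b q (x, y, z) : seq bool) = bits q x ++ bits q y ++ bits q z.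
  by rewrite insubdK // unfold_in !size_cat !size_bits; lia.
rewrite take_size_cat ?size_bits // !drop_size_cat ?size_bits //.
by rewrite take_size_cat ?size_bits // !bitsK.
Qed.

(** Everything an execution depends on, random bits included. Only [c], [s] and [n] are parameters,
    so that one algorithm is obtained for all graphs on [n] nodes. *)
Record network (c s n : nat) := Network {
  node : finType;
  link : {set {set node}};
  ident : node -> nat;
  port : node -> seq node;
  tape : {ffun node -> s.-tuple bool};
  node_card : #|node| = n;
  link_simple : simple_graph link;
  ident_inj : injective ident;
  ident_lt : forall v, ident v < 2 ^ (c * ceil_log2 n);
  portP : port_numbering link port
}.

Arguments link {c s n} _.
Arguments tape {c s n} _.
Arguments link_simple {c s n} _.
Arguments ident_inj {c s n} _ [x1 x2] _.
Arguments ident_lt {c s n} _ _.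
Arguments portP {c s n} _ _.

Section Computable.
Variables (c s n b : nat).
Local Notation net := (network c s n).
Implicit Types (N : net).

Lemma port_sym N (v w : node N) : (w \in port v) = (v \in port w).
Proof. by rewrite !(proj2 (portP N _)) !unfold_in /adj /= setUC. Qed.

Lemma port_neq N (v w : node N) : w \in port v -> v != w.
Proof.
rewrite (proj2 (portP N _)) => vw; have := forall_inP (link_simple N) _ vw.
by rewrite cards2 eqSS; case: (v != w).
Qed.

Definition history := (nat * nat * s.-tuple bool * seq (seq {bseq b of bool}))%type.

Fixpoint view (f : history -> nat -> {bseq b of bool}) N t (v : node N) : history :=
  if t is t'.+1 then
    ((view f t' v).1, rcons (view f t' v).2
       [seq f (view f t' w) (index v (port w)) | w <- port v])
  else (ident v, size (port v), tape N v, [::]).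

Lemma size_view f N t (v : node N) : size (view f t v).2 = t.
Proof. by elim: t => //= t IHt; rewrite size_rcons IHt. Qed.

(* Local computation is unrestricted, so it is no loss to let the state of a node
   be its complete history. *)
Definition computable T t (X : forall N, node N -> T) :=
  exists f (phi : history -> T), forall N (v : node N), phi (view f t v) = X N v.

Lemma computable_init :
  computable 0 (fun N v => (ident v, size (port v), tape N v)).
Proof. by exists (fun _ _ => [bseq]), (fun h => h.1). Qed.

Lemma computable_ext T t (X Y : forall N, node N -> T) :
  (forall N v, X N v = Y N v) -> computable t X -> computable t Y.
Proof. by move=> XY [f [phi e]]; exists f, phi => N v; rewrite e. Qed.

Lemma computable_map T U (F : T -> U) t (X : forall N, node N -> T) :
  computable t X -> computable t (fun N v => F (X N v)).
Proof. by move=> [f [phi e]]; exists f, (F \o phi) => N v /=; rewrite e. Qed.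

Lemma computable_exch T t (X : forall N, node N -> T) (m : T -> nat -> {bseq b of bool}) :
  computable t X ->
  computable t.+1 (fun N v => (X N v, [seq m (X N w) (index v (port w)) | w <- port v])).
Proof.
(* The length of the history tells the round: the old protocol runs for [t] rounds, then [m] is
   sent. *)
move=> [f [phi e]]; pose g (h : history) p := if size h.2 < t then f h p else m (phi h) p.
exists g, (fun h => (phi (h.1, take t h.2), last [::] h.2)) => N v.
have vE k (w : node N) : k <= t -> view g k w = view f k w.
  elim: k w => //= k IHk w kt; rewrite IHk; last lia; congr (_, rcons _ _).
  by apply: eq_map => u; rewrite IHk /g ?size_view ?kt //; lia.
rewrite /= last_rcons !vE // -cats1 take_size_cat ?size_view // -surjective_pairing e.
congr pair; apply: eq_map => w; rewrite vE //.
by rewrite /g size_view ltnn e.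
Qed.

Variables (q : nat) (gcoin : s.-tuple bool -> nat -> nat).
Hypothesis q_b : 3 * q <= b.
Hypothesis gcoin_lt : forall w a, gcoin w a < 2 ^ q.
Hypothesis id_q : 2 ^ (c * ceil_log2 n) <= 2 ^ q.

(* The group of an edge is drawn by its endpoint with the smaller identifier. *)
Definition group N (v w : node N) :=
  if ident v < ident w then gcoin (tape N v) (ident w) else gcoin (tape N w) (ident v).

Lemma groupC N (v w : node N) : v != w -> group v w = group w v.
Proof.
rewrite /group -(inj_eq (ident_inj N)) neq_ltn.
by case: (ltngtP (ident v) (ident w)).
Qed.

Definition base N (v : node N) :=
  (ident v, tape N v, [seq (ident w, group v w) | w <- port v]).

Lemma index_nth N (v w : node N) d (F : node N -> nat) : w \in port v ->
  nth d [seq F u | u <- port v] (index w (port v)) = F w.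
Proof. by move=> wv; rewrite (nth_map v) ?index_mem // nth_index. Qed.

(** The first round tells the identifiers of the neighbours. In the second, each node sends over
    every port its coin for that neighbour, and the endpoint with the larger identifier adopts the
    coin received. *)
Lemma computable_base : computable 2 base.
Proof.
have small1 x : x < 2 ^ q -> small q (x, 0, 0) by rewrite /small /= expn_gt0 => ->.
have idq N (v : node N) : ident v < 2 ^ q := leq_trans (ident_lt N v) id_q.
have c1 := computable_exch (fun x _ => encode b q (x.1.1, 0, 0)) computable_init.
have := computable_map (fun x => (x.1.1.1, x.1.2, [seq (decode q y).1.1 | y <- x.2])) c1.
move=> /(computable_ext (Y := fun N v => (ident v, tape N v, [seq ident w | w <- port v]))) c2.
have {c1}c2 := c2 _; have {}/c2 c2 : forall N (v : node N), 
  (ident v, tape N v, [seq (decode q y).1.1 | y <- [seq encode b q (ident w, 0,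
    0) | w <- port v]])
  = (ident v, tape N v, [seq ident w | w <- port v]).
  by move=> N v; congr (_, _); rewrite -map_comp; apply: eq_map => w /=;
    rewrite encodeK ?small1.
pose m (x : nat * s.-tuple bool * seq nat) p := encode b q (gcoin x.1.2 (nth 0 x.2 p), 0, 0).
have := computable_map (fun x => (x.1.1, [seq (z.1, if x.1.1.1 < z.1 then gcoin x.1.1.2 z.1
  else z.2) | z <- zip x.1.2 [seq (decode q y).1.1 | y <- x.2]])) (computable_exch m c2).
apply: computable_ext => N v /=; congr (_, _); rewrite -map_comp zip_map -map_comp.
apply/eq_in_map => w wv /=; rewrite encodeK ?small1 // index_nth //; last by rewrite -port_sym.
Qed.

(* [X N i v] is the value at [v] in the copy of the computation that runs on the
   edges of group [i]. *)
Definition pcomp T t (X : forall N, nat -> node N -> T) :=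
  computable t (fun N v => (base v, fun i => X N i v)).

Lemma pcomp_base : pcomp 2 (fun N i v => base v).
Proof. by have := computable_map (fun x => (x, fun _ : nat => x)) computable_base. Qed.

Lemma pcomp_ext T t (X Y : forall N, nat -> node N -> T) :
  (forall N i v, X N i v = Y N i v) -> pcomp t X -> pcomp t Y.
Proof.
move=> XY; apply: computable_ext => N v; congr pair.
by apply: funext => i.
Qed.

Lemma pcomp_map T U (F : nat -> s.-tuple bool -> nat -> T -> U) t (X : forall N,
  nat -> node N -> T) :
  pcomp t X -> pcomp t (fun N i v => F (ident v) (tape N v) i (X N i v)).
Proof.
move=> cX; by have := computable_map (fun x => (x.1, fun i => F x.1.1.1 x.1.1.2 i (x.2 i))) cX.
Qed.

(** All copies share the single message per edge and round: over each port only the copy of its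
    group speaks, and both endpoints know that group. *)
Lemma pcomp_exch T t (X : forall N, nat -> node N -> T) (m : T -> msg) :
  (forall N i v, small q (m (X N i v))) -> pcomp t X ->
  pcomp t.+1 (fun N i v =>
    (X N i v, [seq (ident w, m (X N i w)) | w <- port v & group v w == i])).
Proof.
move=> sm cX.
pose mm (x : nat * s.-tuple bool * seq (nat * nat) * (nat -> T)) p :=
  encode b q (m (x.2 (nth (0, 0) x.1.2 p).2)).
have := computable_map (fun x => (x.1.1, fun i => (x.1.2 i,
   [seq (z.1.1, decode q z.2) | z <- zip x.1.1.2 x.2 & z.1.2 == i]))) (computable_exch mm cX).
apply: computable_ext => N v /=; congr pair; apply: funext => i; congr pair.
rewrite zip_map filter_map -map_comp /=; apply/eq_in_map => w.
rewrite mem_filter => /andP[/eqP gi wv] /=; congr pair.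
have vw : v \in port w by rewrite port_sym.
rewrite /mm /= (nth_map v) ?index_mem // nth_index //=.
by move: gi => /=; rewrite (groupC (port_neq wv)) => ->; rewrite encodeK.
Qed.

Section Subgraph.
Variable e : forall N, nat -> rel (node N).
Definition nbr N i (v : node N) := [seq w <- port v | (group v w == i) && e i v w].

(** A node carries the identifiers of its neighbours in the subgraph, by which it discards messages
    from other edges of the group. *)
Definition fcomp T t (X : forall N, nat -> node N -> T) :=
  pcomp t (fun N i v => ([seq ident w | w <- nbr i v], X N i v)).

Lemma fcomp_ext T t (X Y : forall N, nat -> node N -> T) :
  (forall N i v, X N i v = Y N i v) -> fcomp t X -> fcomp t Y.
Proof. by move=> XY; apply: pcomp_ext => N i v; rewrite XY. Qed.

Lemma fcomp_map T U (F : nat -> s.-tuple bool -> nat -> T -> U) t (X : forall N,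
  nat -> node N -> T) :
  fcomp t X -> fcomp t (fun N i v => F (ident v) (tape N v) i (X N i v)).
Proof. by move=> cX; have := pcomp_map (fun a w i x => (x.1, F a w i x.2)) cX. Qed.

Lemma fcomp_exch T t (X : forall N, nat -> node N -> T) (m : T -> msg) :
  (forall N i v, small q (m (X N i v))) -> fcomp t X ->
  fcomp t.+1 (fun N i v => (X N i v, [seq (ident w, m (X N i w)) | w <- nbr i v])).
Proof.
move=> sm cX; have := @pcomp_exch _ _ (fun N i v => ([seq ident w | w <- nbr i v],
  X N i v)) (fun x => m x.2) sm cX.
move=> /(pcomp_map (fun _ _ _ x => (x.1.1, (x.1.2, [seq z <- x.2 | z.1 \in x.1.1])))).
apply: pcomp_ext => N i v /=; congr (_, (_, _)).
rewrite filter_map -filter_predI /=; congr map; apply: eq_in_filter => w wv.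
rewrite /= (mem_map (ident_inj N)) mem_filter wv andbT andbC.
by case: (group v w == i).
Qed.

Lemma fcomp_iter TK T t D (K : forall N, nat -> node N -> TK) (x0 : forall N,
  nat -> node N -> T)
    (m : TK -> T -> msg) (F : nat -> TK -> T -> seq (nat * msg) -> T)
    (step : forall N, nat -> (node N -> T) -> node N -> T) :
  (forall N i x v, step N i x v =
    F (ident v) (K N i v) (x v) [seq (ident w, m (K N i w) (x w)) | w <- nbr i v]) ->
  (forall N i d v, small q (m (K N i v) (iter d (step N i) (x0 N i) v))) ->
  fcomp t (fun N i v => (K N i v, x0 N i v)) ->
  fcomp (t + D) (fun N i v => (K N i v, iter D (step N i) (x0 N i) v)).
Proof.
move=> stepE sm c0; elim: D => [|D IHD]; first by rewrite addn0.
rewrite addnS; have sm' N i v := sm N i D v.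
have := @fcomp_exch _ _ (fun N i v => (K N i v, iter D (step N i) (x0 N i) v)) (fun x => m x.1
  x.2) sm' IHD.
move=> /(fcomp_map (fun a _ _ x => (x.1.1, F a x.1.1 x.1.2 x.2))).
by apply: fcomp_ext => N i v /=; rewrite stepE.
Qed.

End Subgraph.
End Computable.

(** * Distributed computation of one forest *)

Section ForestComputable.
Variables (c s n b q : nat) (gcoin : s.-tuple bool -> nat -> nat).
Hypothesis q_b : 3 * q <= b.
Local Notation net := (network c s n).
Local Notation b0 := (c * ceil_log2 n).
Local Notation M := (2 ^ b0).
Hypothesis M_q : M ^ 3 < 2 ^ q.
Variables (r L T : nat) (coin : s.-tuple bool -> nat).
Hypothesis L_q : L < 2 ^ q.
Variable e : forall N : net, nat -> rel (node N).

Local Notation nb N i := (@nbr _ _ _ gcoin e N i).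
Local Notation id N := (@ident _ _ _ N).
Local Notation st N := (fun v => coin (tape N v)).
Local Notation D := (r.*2 * b0).
Local Notation fcomp := (@fcomp c s n b gcoin e _).
Local Notation R0 N i := (ruling (nb N i) (id N) r).
Local Notation cluster_at N i := (cluster (nb N i) (id N) b0 r).
Local Notation parent_at N i := (parent (nb N i) (id N) b0 r).
Local Notation cmin_at N i := (cmin (nb N i) (id N) b0 r).
Local Notation mark_at N i := (mark (nb N i) (id N) b0 r (st N)).
Local Notation mark_time_at N i := (mark_time (nb N i) (id N) b0 r (st N) L).
Local Notation hub_at N i := (hub (nb N i) (id N) b0 r (st N) L).
Local Notation cutoff_at N i := (cutoff (nb N i) (id N) b0 r (st N) L).
Local Notation pointer_at N i := (pointer (nb N i) (id N) b0 r (st N) L).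
Local Notation pointers_at N i := (pointers (nb N i) (id N) b0 r (st N) L T).
Local Notation forest_at N i := (forest (nb N i) (id N) b0 r (st N) L T).

Let M_gt0 : 0 < M. Proof. by rewrite expn_gt0. Qed.
Let M_le : M <= M ^ 3. Proof. by rewrite -[X in X <= _]expn1 leq_pexp2l. Qed.
Let Mq : M < 2 ^ q. Proof. exact: leq_ltn_trans M_le M_q. Qed.
Let id_q : M <= 2 ^ q. Proof. exact: ltnW. Qed.
Let small1 x : x < 2 ^ q -> small q (x, 0, 0).
Proof. by rewrite /small /= expn_gt0 => ->. Qed.
Let small2 x y : x < 2 ^ q -> y < 2 ^ q -> small q (x, y, 0).
Proof. by rewrite /small /= expn_gt0 => -> ->. Qed.

Lemma fcomp_near TK t d (K : forall N : net, nat -> node N -> TK)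
    (x0 : forall N : net, nat -> node N -> bool) :
  fcomp t (fun N i v => (K N i v, x0 N i v)) ->
  fcomp (t + d) (fun N i v => (K N i v, near (nb N i) d (x0 N i) v)).
Proof.
apply: (fcomp_iter q_b d (K := K) (x0 := x0) (step := fun N i => spread (nb N i))
  (m := fun _ x => (x : nat, 0, 0))
  (F := fun _ _ x l => x || has (fun p => p.2.1.1 == 1) l)).
  by move=> N i x v; rewrite /spread has_map; congr orb; apply: eq_has => w /=; rewrite eqb1.
move=> N i k v; apply: small1; apply: leq_ltn_trans Mq.
by apply: leq_trans M_gt0; apply: leq_b1.
Qed.

Lemma fcomp_ruling t j : fcomp t (fun N i v => true) ->
  fcomp (t + j * r.*2) (fun N i v => R0 N i j v).
Proof.
move=> c0; elim: j => [|j IHj]; first by rewrite mul0n addn0.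
have := fcomp_map (fun a _ _ x => (x, x && ~~ bit j a)) IHj.
move=> /(fcomp_near r.*2) /(fcomp_map (fun a _ _ x => x.1 && ~~ (bit j a && x.2))).
by rewrite mulSn [r.*2 + _]addnC addnA.
Qed.

Lemma fcomp_label TK t d (K : forall N : net, nat -> node N -> TK) :
  fcomp t (fun N i v => (K N i v, R0 N i b0 v)) ->
  fcomp (t + d) (fun N i v => (K N i v, label (nb N i) (id N) b0 r d v)).
Proof.
move=> /(fcomp_map (fun a _ _ x => (x.1, if x.2 then Some (a, a) else None))).
apply: (fcomp_iter q_b d (K := K) (x0 := fun N i => label_start (nb N i) (id N) b0 r)
  (step := fun N i => label_step (nb N i) (id N)) (m := fun _ x => (label_msg x, 0, 0))
  (F := fun _ _ x l => if x is Some p then Some p else first_label [seq (p.1,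
    p.2.1.1) | p <- l])).
  by move=> N i x v; rewrite /label_step -map_comp.
move=> N i k v; apply: small1; apply: leq_ltn_trans Mq; rewrite -/(label _ _ _ _ _).
case e1: (label _ _ _ _ _ _) => [[a p]|] //=.
by have [[u <-] _] := label_ident e1; apply: ident_lt.
Qed.

Lemma cl_lt N i (v : node N) : cluster_at N i v < M.
Proof. by have [u [_ <- _]] := center_ex (nb N i) (id N) b0 r v; apply: ident_lt. Qed.

Lemma par_lt N i (v : node N) : parent_at N i v < M.
Proof.
rewrite /parent; case e1: (label _ _ _ _ _ _) => [[a p]|] //=.
by have [_ [u <-]] := label_ident e1; apply: ident_lt.
Qed.

(** The cluster travels with each value, so that receivers can ignore other clusters. The bound
    [M ^ 3] is the default of [pick_cand]. *)
Lemma fcomp_cmin TK t (clf : TK -> nat) (K : forall N : net, nat -> node N -> TK)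
    (x : forall N : net, nat -> node N -> nat) :
  (forall N i v, clf (K N i v) = cluster_at N i v) -> (forall N i v, x N i v <= M ^ 3) ->
  fcomp t (fun N i v => (K N i v, x N i v)) ->
  fcomp (t + D.*2) (fun N i v => (K N i v, cmin_at N i (x N i) v)).
Proof.
move=> clE x_le.
apply: (fcomp_iter q_b D.*2 (K := K) (x0 := x)
  (step := fun N i => cmin_step (nb N i) (id N) b0 r) (m := fun k x => (clf k, x, 0))
  (F := fun _ k x l => foldr minn x [seq p.2.1.2 | p <- l & p.2.1.1 == clf k])).
  move=> N i y v; rewrite /cmin_step filter_map -map_comp /cluster_nb.
  by congr foldr; congr map; apply: eq_filter => w /=; rewrite !clE.
move=> N i k v; rewrite clE; apply: small2; first exact: ltn_trans (cl_lt i v) Mq.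
apply: leq_ltn_trans M_q; apply: leq_trans (x_le N i v); apply: cmin_near.
by apply: (@near_le _ _ 0); rewrite //= eqxx.
Qed.

Lemma mark_cand_le N i k a (v : node N) :
  mark_cand (nb N i) (id N) b0 r (st N) k a v <= M ^ 3.
Proof.
apply: leq_trans M_le; apply: leq_trans (foldr_minn_le (mem_head _ _)) _.
by case: ifP => // _; apply: ltnW; apply: ident_lt.
Qed.

Lemma fcomp_mark TK t (clf : TK -> nat) (K : forall N : net, nat -> node N -> TK) k :
  (forall N i v, clf (K N i v) = cluster_at N i v) -> fcomp t K ->
  fcomp (t + k * D.*2.+1) (fun N i v => (K N i v, mark_at N i k v)).
Proof.
move=> clE c0; elim: k => [|k IHk].
  by rewrite mul0n addn0; have := fcomp_map (fun _ _ _ x => (x, @None (nat * nat))) c0.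
have sm N i (v : node N) : small q (mark_msg b0 (mark_at N i k v), 0, 0).
  apply/small1/(leq_ltn_trans _ Mq); case e1: (mark_at N i k v) => [[f a]|] //=.
  by have [_ /ltnW] := mark_lt e1.
have c1 := fcomp_map (fun a w _ x => (x.1, foldr minn (if (clf x.1.1 == a) && (coin w <= k)
  then a else M)
     [seq p.2.1.1 | p <- x.2])) (fcomp_exch q_b (X := fun N i v => (K N i v, mark_at N i k v))
     (m := fun x => (mark_msg b0 x.2, 0, 0)) sm IHk).
have {c1} : fcomp (t + k * D.*2.+1).+1 (fun N i v => ((K N i v, mark_at N i k v),
    mark_cand (nb N i) (id N) b0 r (st N) k (mark_at N i k) v)).
  by apply: fcomp_ext c1 => N i v; rewrite /mark_cand clE -map_comp.
move=> /(fcomp_cmin (clf := fun x => clf x.1)) c1.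
have {}c1 := c1 clE (fun N i v => mark_cand_le i k _ v).
have := fcomp_map (fun _ _ _ x => (x.1.1, if x.1.2 is Some p then Some p else
   if x.2 < M then Some (k, x.2) else None)) c1.
have -> // : t + k.+1 * D.*2.+1 = (t + k * D.*2.+1).+1 + D.*2.
by rewrite mulSn; lia.
Qed.


Lemma tm_small N i (v : node N) : mark_time_at N i v < 2 ^ q.
Proof.
rewrite /mark_time; case e1: (mark _ _ _ _ _ _ _) => [[f a]|] /=; last by rewrite expn_gt0.
by have [fL _ _ _] := mark_lt e1; apply: leq_ltn_trans L_q.
Qed.

Lemma hub_small N i (v : node N) : hub_at N i v < 2 ^ q.
Proof.
rewrite /hub; case e1: (mark _ _ _ _ _ _ _) => [[f a]|] /=; last by rewrite expn_gt0.
by have [_ aM _ _] := mark_lt e1; apply: ltn_trans Mq.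
Qed.

Lemma pick_cand_le' N i la (v : node N) :
  pick_cand (nb N i) (id N) b0 r (st N) L la v <= M ^ 3.
Proof. exact: foldr_minn_le (mem_head _ _). Qed.

Local Notation K4 N i v := (cluster_at N i v, parent_at N i v, mark_time_at N i v,
  hub_at N i v).

Lemma fcomp_pointers t k : fcomp t (fun N i v => K4 N i v) ->
  fcomp (t + k * D.*2.+1)
    (fun N i v => (K4 N i v, (cutoff_at N i k v, [seq pointer_at N i j v | j <- iota 0 k]))).
Proof.
move=> c0; elim: k => [|k IHk].
  by rewrite mul0n addn0; have := fcomp_map (fun _ _ _ x => (x, (0, @nil nat))) c0.
pose X (N : net) i (v : node N) := (K4 N i v, (cutoff_at N i k v,
  [seq pointer_at N i j v | j <- iota 0 k])).
have sm N i (v : node N) : small q ((X N i v).1.1.1.1, (X N i v).1.1.2, (X N i v).1.2).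
  by rewrite /small /= hub_small tm_small (ltn_trans (cl_lt i v) Mq).
have c1 := fcomp_map (fun a _ _ x => (x.1, foldr minn (M ^ 3)
     [seq (p.2.2 * M + a) * M + p.1 | p <- x.2 &
       ((p.2.1.1 != x.1.1.1.1.1) && ((p.2.1.2 < x.1.1.1.2) || (p.2.1.2 == x.1.1.1.2) && (p.2.2
         != x.1.1.2)))
         && (x.1.2.1 <= p.2.2)])) (fcomp_exch q_b (X := X)
     (m := fun x => (x.1.1.1.1, x.1.1.2, x.1.2)) sm IHk).
have {c1} : fcomp (t + k * D.*2.+1).+1 (fun N i v => (X N i v,
    pick_cand (nb N i) (id N) b0 r (st N) L (cutoff_at N i k) v)).
  by apply: fcomp_ext c1 => N i v; rewrite /pick_cand filter_map -map_comp.
move=> /(fcomp_cmin (clf := fun x => x.1.1.1.1)) c1.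
have {c1} := c1 (fun _ _ _ => erefl) (fun N i v => pick_cand_le' i _ v).
move=> /(fcomp_map (fun a _ _ x => (x.1.1, ((x.2 %/ M ^ 2).+1,
  rcons x.1.2.2 (if (x.2 < M ^ 3) && (x.2 %/ M %% M == a) then x.2 %% M else M))))).
have -> : t + k.+1 * D.*2.+1 = (t + k * D.*2.+1).+1 + D.*2 by rewrite mulSn; lia.
by apply: fcomp_ext => N i v; rewrite -[in iota _ k.+1]addn1 iotaD map_cat cats1 add0n.
Qed.

Lemma pts_small N i (v : node N) k : nth 0 (pointers_at N i v) k < 2 ^ q.
Proof.
apply: leq_ltn_trans Mq; have [lt|ge] := ltnP k (size (pointers_at N i v));
  last by rewrite nth_default.
have : all (geq M) (pointers_at N i v); last by move=> /all_nthP; apply.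
rewrite /= ltnW ?par_lt //; apply/allP => _ /mapP[j _ ->]; rewrite /pointer /=.
by case: ifP => // _; apply/ltnW; rewrite ltn_mod.
Qed.

(** Both ends of an edge must know whether it is in the forest: nodes broadcast their pointers, one
    per round, and collect who points to them. *)
Fixpoint incoming (N : net) i k (v : node N) : seq nat :=
  if k is k'.+1 then
    [seq ident w | w <- nb N i v & nth 0 (pointers_at N i w) k' == ident v] ++ incoming i k' v
  else [::].

Lemma mem_incoming N i k (v w : node N) : k <= T.+1 ->
  (ident w \in incoming i k v) = (w \in nb N i v) && (ident v \in take k (pointers_at N i w)).
Proof.
elim: k => [|k IHk] kT; first by rewrite take0 andbF.
rewrite [incoming i k.+1 v](_ : _ = [seq ident u | u <- nb N i v & nth 0 (pointers_at N i u) k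
  == ident v]
  ++ incoming i k v) // mem_cat (IHk (ltnW kT)) mem_map; last exact: ident_inj.
rewrite mem_filter [X in X || _]andbC -andb_orr; case: (w \in nb N i v) => //.
rewrite (take_nth 0); last by rewrite /= size_map size_iota.
by rewrite mem_rcons inE eq_sym.
Qed.

Lemma fcomp_incoming t k : fcomp t (fun N i v => pointers_at N i v) ->
  fcomp (t + k) (fun N i v => (pointers_at N i v, incoming i k v)).
Proof.
move=> c0; elim: k => [|k IHk].
  by rewrite addn0; have := fcomp_map (fun _ _ _ x => (x, @nil nat)) c0.
have sm N i (v : node N) : small q (nth 0 (pointers_at N i v, incoming i k v).1 k, 0, 0).
  by apply: small1; apply: pts_small.
rewrite addnS; have c1 := fcomp_map (fun a _ _ x => (x.1.1, [seq p.1 | p <- x.2 & p.2.1.1 == a]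
  ++ x.1.2))
   (fcomp_exch q_b (X := fun N i v => (pointers_at N i v, incoming i k v))
     (m := fun x => (nth 0 x.1 k, 0, 0)) sm IHk).
by apply: fcomp_ext c1 => N i v; rewrite /= filter_map -map_comp.
Qed.

(** In order: the ruling set, the labels, [L.+1] marking steps and [T] choices (each an exchange and
    a minimum over the cluster), and the broadcast of [T.+1] pointers. *)
Definition forest_rounds := b0 * r.*2 + D + (L.+1 * D.*2.+1 + T * D.*2.+1) + T.+1.

Lemma pcomp_forest t :
  pcomp b gcoin t (fun N i v => [seq ident w | w <- nb N i v]) ->
  pcomp b gcoin (t + forest_rounds) (fun N i v =>
    [seq ident w | w <- [seq w <- port v | (group gcoin v w == i) &&
       (e i v w && ~~ forest_at N i v w)]]).
Proof.
move=> /(pcomp_map (fun _ _ _ x => (x, true))) c0.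
have /(fcomp_ruling b0) : fcomp t (fun N i v => true) by [].
move=> /(fcomp_map (fun _ _ _ x => (tt, x))) /(fcomp_label D).
move=> /(fcomp_map (fun _ _ _ x => if x.2 is Some p then p else (0, 0))) c1.
have {c1} : fcomp (t + b0 * r.*2 + D) (fun N i v => (cluster_at N i v, parent_at N i v)).
  by apply: fcomp_ext c1 => N i v; rewrite /cluster /parent; case: (label _ _ _ _ _ _) => [[]|].
move=> /(fcomp_mark (clf := fst) L.+1) c1; have {c1} := c1 (fun _ _ _ => erefl).
move=> /(fcomp_map (fun _ _ _ x => (x.1, if x.2 is Some p then p else (0, 0)))) c1.
have {c1} : fcomp (t + b0 * r.*2 + D + L.+1 * D.*2.+1) (fun N i v => K4 N i v).
  have c2 := fcomp_map (fun _ _ _ x => (x.1.1, x.1.2, x.2.1, x.2.2)) c1.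
  by apply: fcomp_ext c2 => N i v; rewrite /mark_time /hub; case: (mark_at N i L.+1 v) => [[]|].
move=> /(fcomp_pointers T) /(fcomp_map (fun _ _ _ x => x.1.1.1.2 :: x.2.2)).
move=> /(@fcomp_incoming _ T.+1) c1.
have := pcomp_map (fun a _ _ x => [seq y <- x.1 | ~~ ((y \in x.2.1) || (y \in x.2.2))]) c1.
have -> : t + forest_rounds = t + b0 * r.*2 + D + L.+1 * D.*2.+1 + T * D.*2.+1 + T.+1.
  by rewrite /forest_rounds !addnA.
apply: pcomp_ext => N i v.
have hB w : (ident w \in incoming i T.+1 v) = (w \in nb N i v) && (ident v \in pointers_at N i
  w).
  by rewrite mem_incoming // take_oversize // /pointers /= size_map size_iota.
move: (incoming i T.+1 v) hB => B hB.
rewrite filter_map; congr map; rewrite -filter_predI; apply: eq_in_filter => w wv.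
rewrite /predI /= hB /forest [w \in nb N i v]mem_filter wv andbT.
by case: (group gcoin v w == i); case: (e i v w); rewrite ?andbT ?andbF /=.
Qed.

End ForestComputable.

Local Open Scope ring_scope.

(** * Uniform probability on finite types *)

Section Pr.
Variable R : realFieldType.

Definition pr (T : finType) (P : pred T) : R := #|[set x | P x]|%:R / #|T|%:R.

Lemma pr_sub (T : finType) (P Q : pred T) : (forall x, P x -> Q x) -> pr P <= pr Q.
Proof.
move=> PQ; rewrite ler_wpM2r ?invr_ge0 // ler_nat; apply: subset_leq_card.
by apply/subsetP => x; rewrite !inE; apply: PQ.
Qed.

Lemma pr_or (T : finType) (P Q : pred T) : pr (predU P Q) <= pr P + pr Q.
Proof.
rewrite -mulrDl ler_wpM2r ?invr_ge0 // -natrD ler_nat.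
apply: leq_trans (leq_card_setU _ _).1; apply: subset_leq_card.
by apply/subsetP => x; rewrite !inE.
Qed.

Lemma pr_sum (T I : finType) (A : pred I) (P : I -> pred T) :
  pr [pred x | [exists (i | A i), P i x]] <= \sum_(i | A i) pr (P i).
Proof.
rewrite -mulr_suml ler_wpM2r ?invr_ge0 // -natr_sum ler_nat.
have sub : [set x | [exists (i | A i), P i x]] \subset \bigcup_(i | A i) [set x | P i x].
  apply/subsetP => x; rewrite inE => /existsP[i /andP[Ai Pix]].
  by apply/bigcupP; exists i; rewrite ?inE.
apply: leq_trans (subset_leq_card sub) _; elim/big_rec2: _ => [|i m B _ IH];
  first by rewrite cards0.
by apply: leq_trans (leq_card_setU _ _).1 _; rewrite leq_add2l.
Qed.

Lemma pr_compl (T : finType) (P : pred T) : (0 < #|T|)%N -> pr P = 1 - pr (predC P).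
Proof.
move=> T0; have TN : #|T|%:R != 0 :> R by rewrite pnatr_eq0 -lt0n.
apply/eqP; rewrite eq_sym subr_eq -mulrDl -natrD -[X in X == _](divff TN); apply/eqP.
congr (_%:R / _); rewrite -(cardsC [set x | P x]); congr addn.
by apply: eq_card => x; rewrite !inE.
Qed.

(** Markov's inequality for a product of independent weights, whose mean factors by distributivity.
    It yields all tail bounds: for a single shift, for the number of keys and for the groups. *)
Lemma pr_markov (I J : finType) (w : I -> J -> R) (s : I -> R) (a : R) (B : pred {ffun I -> J})
  :
  (0 < #|J|)%N ->
  (forall i j, 0 <= w i j) -> (forall i, \sum_j w i j <= #|J|%:R * s i) ->
  (forall f, B f -> a <= \prod_i w i (f i)) -> a * pr B <= \prod_i s i.
Proof.
move=> J0 w0 ws aB; have JN : 0 < #|J|%:R :> R by rewrite ltr0n.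
rewrite /pr card_ffun natrX mulrA ler_pdivrMr ?exprn_gt0 //.
have -> : (#|J|%:R : R) ^+ #|I| = \prod_(i : I) #|J|%:R by rewrite prodr_const.
rewrite -big_split /=.
apply: (@le_trans _ _ (\prod_i \sum_j w i j)); last first.
  by apply: ler_prod => i _; rewrite sumr_ge0 //= mulrC ws.
rewrite bigA_distr_bigA /= mulr_natr -sumr_const.
rewrite [X in _ <= X](bigID (mem [set f | B f])) /= -[X in X <= _]addr0.
apply: lerD; last by apply: sumr_ge0 => f _; apply: prodr_ge0.
by apply: ler_sum => f; rewrite inE; apply: aB.
Qed.

(* The pair (state, fresh sample) is uniform, and exchanging the fresh sample with
   the corresponding part of the state is an involution. *)
Lemma pr_resample (T X : finType) (upd : T -> X -> T) (get : T -> X -> X) (P : pred T) p :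
  (0 < #|T|)%N -> (0 < #|X|)%N -> (forall r x, upd (upd r x) (get r x) = r) ->
  (forall r x, get (upd r x) (get r x) = x) ->
  (forall r, pr (fun x => P (upd r x)) <= p) -> pr P <= p.
Proof.
move=> T0 X0 e1 e2 pP.
have XN : 0 < #|X|%:R :> R by rewrite ltr0n.
have TN : 0 < #|T|%:R :> R by rewrite ltr0n.
pose h (y : T * X) := (upd y.1 y.2, get y.1 y.2).
have hK : involutive h by case=> r x; rewrite /h /= e1 e2.
have e : \sum_(y : T * X) (P y.1 : nat) = \sum_(y : T * X) (P (upd y.1 y.2) : nat).
  by rewrite (reindex_inj (inv_inj hK)).
have {e} : \sum_r \sum_(x : X) (P r : nat) = \sum_r \sum_(x : X) (P (upd r x) : nat).
  by rewrite !pair_big.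
under eq_bigr do rewrite sum_nat_const.
rewrite -big_distrr /= => e; rewrite /pr ler_pdivrMr // -(ler_pM2l XN).
have card_sum (S : finType) (Q : pred S) : #|[set x | Q x]| = \sum_x (Q x : nat).
  by rewrite -sum1_card [LHS]big_mkcond; apply: eq_bigr => x _; rewrite inE; case: (Q x).
rewrite card_sum -natrM (e : (#|X| * _ = _)%N) natr_sum [X in _ <= X](_ : _ = \sum_(r : T) (p *
  #|X|%:R)); last first.
  by rewrite sumr_const -mulr_natr; ring.
apply: ler_sum => r _; by have := pP r; rewrite /pr ler_pdivrMr // card_sum.
Qed.

End Pr.

(** * Few keys with high probability *)

(** For a uniform [X < 2 ^ L] and [j <= L], [bitlen X <= j] has probability [2 ^ j / 2 ^ L]: this is
    the shift with geometric tail. *)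
Definition bitlen a := up_log 2 a.+1.

Lemma bitlen_le a j : (bitlen a <= j)%N = (a < 2 ^ j)%N.
Proof.
apply/idP/idP => [le|lt]; last exact: up_log_min.
by apply: leq_trans (up_logP a.+1 (ltnSn 1)) _; rewrite leq_pexp2l.
Qed.

Lemma sum_ltn (n a : nat) : (\sum_(x < n) (x < a) = minn a n)%N.
Proof.
elim: n => [|n IHn]; first by rewrite big_ord0 minn0.
rewrite big_ord_recr /= IHn; lia.
Qed.

Section KeysetPr.
Variables (R : realFieldType) (V : finType) (nb : V -> seq V) (ident : V -> nat) (b0 r : nat).
Hypothesis nb_sym : forall v w, (w \in nb v) = (v \in nb w).
Hypothesis ident_inj : injective ident.
Hypothesis ident_lt : forall v, (ident v < 2 ^ b0)%N.
Variables (L T : nat).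
Local Notation coins := {ffun V -> 'I_(2 ^ L)}.
Implicit Types (X : coins).
Definition shift X v := bitlen (X v).

Lemma shift_le X v : (shift X v <= L)%N. Proof. by rewrite bitlen_le. Qed.

(** Distances are cut off at [L], the value of [find] on failure; those below a marking time, hence
    below [L], are exact. *)
Definition cdist v u := find (fun d => cnear nb ident b0 r d u v) (iota 0 L).

Lemma cdist_le v u d : (d < L)%N -> cnear nb ident b0 r d u v -> (cdist v u <= d)%N.
Proof.
move=> dL h; rewrite leqNgt; apply/negP => /(before_find 0).
by rewrite nth_iota // add0n h.
Qed.

Lemma cdistP v u : (cdist v u < L)%N -> cnear nb ident b0 r (cdist v u) u v.
Proof.
move=> dL; have h : has (fun d => cnear nb ident b0 r d u v) (iota 0 L).
  by rewrite has_find size_iota.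
by have := nth_find 0 h; rewrite nth_iota.
Qed.

(* If [t] is the time at which the cluster of [v] is reached, then nobody reaches
   it by time [t - 1], whereas all keys reach it by time [t + 1].  For each [u],
   [X u < 2 ^ j] has at least a quarter of the probability of [X u < 2 ^ j.+2]. *)
Definition crowded v t : pred coins := fun X =>
  [forall u, (cdist v u < t)%N ==> (2 ^ (t - (cdist v u).+1) <= X u)%N] &&
  (T < #|[set u | (cdist v u < t)%N && (X u < 2 ^ (t.+1 - cdist v u))%N]|)%N.

Lemma keyset_crowded X v : (T < #|keyset nb ident b0 r (shift X) L v|)%N ->
  (exists u, (X u <= 1)%N) \/ exists t : 'I_L.+1, crowded v t X.
Proof.
move=> kT; case: (pickP (fun u => X u <= 1)%N) => [u|no]; first by left; exists u.
right; have sL := shift_le X; set t := mark_time nb ident b0 r (shift X) L v.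
have tL : (t <= L)%N by apply: tm_leq.
exists (Ordinal (tL : (t < L.+1)%N)); apply/andP; split.
  apply/forallP => u; apply/implyP => /= ut.
  have := tm_le nb_sym ident_inj ident_lt sL (cdistP (leq_trans ut tL)).
  rewrite -/t => le; rewrite leqNgt -bitlen_le -/(shift X u) -ltnNge; lia.
apply: leq_trans kT _; apply: subset_leq_card; apply/subsetP => u uk.
have [d ud sd] := keyset_near nb_sym ident_inj ident_lt sL uk.
(* A key satisfies [shift X u + d <= t.+1]. Excluding the coins 0 and 1 makes the shift at least 2,
   whence [d < t]; this is why small coins form a separate event. *)
have s2 : (2 <= shift X u)%N.
  by rewrite ltnNge bitlen_le expn1 ltnS no.
rewrite -/t in sd; have := @cdist_le v u d _ ud => /(_ _) le.
have {}le : (cdist v u <= d)%N by apply: le; lia.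
rewrite inE /= -bitlen_le -/(shift X u); lia.
Qed.

Lemma pr_low u : pr R (fun X : coins => X u <= 1)%N <= 2 / 2 ^+ L.
Proof.
have Q0 : 0 < 2 ^+ L :> R by rewrite exprn_gt0.
have CQ : #|'I_(2 ^ L)|%:R = 2 ^+ L :> R by rewrite card_ord natrX.
have := @pr_markov R V _ (fun i j => if i == u then ((j : 'I_(2 ^ L)) <= 1)%N%:R else 1)
  (fun i => if i == u then 2 / 2 ^+ L else 1) 1 (fun X => X u <= 1)%N.
rewrite mul1r -[X in _ <= X]big_mkcond /= big_pred1_eq; apply.
- by rewrite card_ord expn_gt0.
- by move=> i j; case: ifP.
- move=> i; rewrite CQ; case: ifP => _; last by rewrite sumr_const CQ mulr1.
  rewrite mulrCA divff ?gt_eqF // mulr1 -natr_sum ler_nat.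
  apply: (@leq_trans (\sum_(x < 2 ^ L) (x < 2))); first exact: leq_sum.
  by rewrite sum_ltn geq_minl.
- by move=> X Xu; rewrite -big_mkcond big_pred1_eq Xu.
Qed.

(* Each [u] contributes a factor 0, 4/3 or 1 with mean at most 1. *)
Lemma pr_crowded v t : pr R (crowded v t) <= (3 / 4) ^+ T.
Proof.
have CQ : #|'I_(2 ^ L)|%:R = 2 ^+ L :> R by rewrite card_ord natrX.
pose w u (x : 'I_(2 ^ L)) : R := if (cdist v u < t)%N then
  1 + 1 / 3 * (x < 2 ^ (t.+1 - cdist v u))%N%:R - 4 / 3 * (x < 2 ^ (t - (cdist v u).+1))%N%:R
    else 1.
have e4 u : (cdist v u < t -> 2 ^ (t.+1 - cdist v u) = 4 * 2 ^ (t - (cdist v u).+1))%N.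
  by move=> lt; rewrite (_ : t.+1 - _ = 2 + (t - (cdist v u).+1))%N ?expnD //; lia.
have w0 u x : 0 <= w u x.
  rewrite /w; case: ifP => // /e4 ->; move: (2 ^ (t - _))%N => a.
  have [h|h] := ltnP x a; last by rewrite mulr0 subr0 addr_ge0 // mulr_ge0 // divr_ge0.
  by rewrite (_ : x < 4 * a)%N; [rewrite !mulr1; lra|lia].
have := @pr_markov R V _ w (fun=> 1) ((4 / 3) ^+ T) (crowded v t).
rewrite big1 // => H; have {}H : (4 / 3) ^+ T * pr R (crowded v t) <= 1.
  apply: H => //; first by rewrite card_ord expn_gt0.
    move=> u; rewrite mulr1 /w; case: (boolP (cdist v u < t)%N) => lt;
      last by rewrite sumr_const.
    rewrite sumrB big_split /= sumr_const -2!mulr_sumr -2!natr_sum 2!sum_ltn (e4 _ lt).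
    rewrite CQ -natrX; move: (2 ^ L)%N (2 ^ (t - _))%N => Q a.
    have : (minn (4 * a) Q <= 4 * minn a Q)%N by lia.
    by rewrite -(ler_nat R) natrM; lra.
  move=> X /andP[/forallP all card].
  have wX u : w u (X u) = if (cdist v u < t)%N && (X u < 2 ^ (t.+1 - cdist v u))%N then 4 / 3
    else 1.
    rewrite /w; have := all u; case: ifP => //= _ le.
    rewrite [(X u < 2 ^ (t - _))%N]ltnNge le /= mulr0 subr0; case: ifP => _ /=; lra.
  under eq_bigr do rewrite wX.
  rewrite -big_mkcond /= prodr_const ler_eXn2l; last lra.
  by rewrite -cardsE ltnW.
have e1 : (3 / 4) ^+ T * (4 / 3) ^+ T = 1 :> R.
  by rewrite -exprMn (_ : 3 / 4 * (4 / 3) = 1) ?expr1n //; lra.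
have p0 : 0 < (4 / 3) ^+ T :> R by rewrite exprn_gt0 //; lra.
by rewrite -(ler_pM2l p0) [X in _ <= X]mulrC e1.
Qed.

Theorem pr_keyset :
  pr R (fun X => ~~ [forall v, #|keyset nb ident b0 r (shift X) L v| <= T]%N) <=
  #|V|%:R * (2 / 2 ^+ L) + #|V|%:R * L.+1%:R * (3 / 4) ^+ T.
Proof.
apply: le_trans (_ : pr R (predU [pred X : coins | [exists (u | true), (X u <= 1)%N]]
   [pred X : coins | [exists (p : V * 'I_L.+1 | true), crowded p.1 p.2 X]]) <= _).
  apply: pr_sub => X; rewrite negb_forall => /existsP[v]; rewrite -ltnNge => /keyset_crowded.
  case=> [[u Xu]|[t ct]]; apply/orP; [left|right]; apply/existsP; first by exists u.
  by exists (v, t).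
apply: le_trans (pr_or _ _ _) _; apply: lerD.
  apply: le_trans (pr_sum _ _ (fun u (X : coins) => X u <= 1)%N) _.
  apply: le_trans (ler_sum _ (fun u _ => pr_low u)) _.
  by rewrite sumr_const [X in _ <= X]mulr_natl; exact: lexx.
apply: le_trans (pr_sum _ _ (fun p : V * 'I_L.+1 => crowded p.1 p.2)) _.
apply: (@le_trans _ _ (\sum_(p : V * 'I_L.+1) (3 / 4) ^+ T)).
  by apply: ler_sum => p _; apply: pr_crowded.
by rewrite sumr_const card_prod card_ord -natrM [X in _ <= X]mulr_natl; exact: lexx.
Qed.

End KeysetPr.

Local Open Scope nat_scope.

(** * Cuts *)

Section Cuts.
Variable V : finType.
Implicit Types (E H : {set {set V}}) (e S : {set V}).

Definition crosses e S := ~~ (e \subset S) && ~~ (e \subset ~: S).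
Definition cut E S := [set e in E | crosses e S].
Definition nontrivial S := (S != set0) && (S != [set: V]).

Lemma crosses2 u v S : crosses [set u; v] S = ((u \in S) != (v \in S)).
Proof. by rewrite /crosses !subUset !sub1set !inE; case: (u \in S); case: (v \in S). Qed.

Lemma simple_pair E e : simple_graph E -> e \in E -> exists u v, u != v /\ e = [set u; v].
Proof. by move=> /forall_inP sE /sE /cards2P[u [v [uv ->]]]; exists u, v. Qed.

Lemma edge_connected_cut k E S : edge_connected k E -> nontrivial S -> k <= #|cut E S|.
Proof.
move=> /forallP/(_ (cut E S)) conn /andP[S0 ST]; rewrite leqNgt; apply/negP => lt.
move: conn; rewrite lt andbT (_ : cut E S \subset E); last first.
  by apply/subsetP => e; rewrite inE => /andP[].
move=> /forallP conn; have [u uS] := set0Pn _ S0.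
have [v vS] : exists v, v \notin S.
  by apply/existsP; apply: contraR ST; rewrite negb_exists => /forallP H; apply/eqP/setP => x;
    rewrite inE; have := H x; rewrite negbK.
have /forallP/(_ v)/connectP[p] := conn u; elim: p u uS => [|w p IHp] u uS /=.
  by move=> _ e; rewrite e uS in vS.
move=> /andP[uw pp] e; apply: IHp pp e.
move: uw; rewrite /adj /= !inE crosses2 uS; case: (w \in S) => //.
by case: (_ \in E).
Qed.

Lemma cut_edge_connected k E : simple_graph E ->
  (forall S, nontrivial S -> k <= #|cut E S|) -> edge_connected k E.
Proof.
move=> sE Hcut; apply/forallP => F; apply/implyP => /andP[_ Fk].
apply/forallP => u; apply/forallP => v; apply: contraLR Fk => nuv; rewrite -leqNgt.
pose S := [set w | connect (adj (E :\: F)) u w].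
have nS : nontrivial S.
  apply/andP; split; first by apply/set0Pn; exists u; rewrite inE connect0.
  by apply: contraNneq nuv => /setP/(_ v); rewrite !inE.
apply: leq_trans (Hcut S nS) _; apply: subset_leq_card; apply/subsetP => e.
rewrite inE => /andP[eE]; have [a [b [_ ee]]] := simple_pair sE eE; rewrite ee crosses2 !inE.
rewrite ee in eE; apply: contraR => nF; apply/eqP.
have ab : adj (E :\: F) a b by rewrite /adj /= inE nF.
have ba : adj (E :\: F) b a by rewrite /adj /= setUC.
by apply/idP/idP => h; apply: connect_trans h (connect1 _).
Qed.

Definition saturated (f : V -> V) S := [forall x, forall y, (f x == f y) ==> ((x \in S) == (y
  \in S))].

Lemma saturatedP f S : reflect (forall x y, f x = f y -> (x \in S) = (y \in S)) (saturated f S).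
Proof.
apply: (iffP forallP) => [h x y e|h x]; last by apply/forallP => y; apply/implyP => /eqP/h->.
by have /forallP/(_ y) := h x; rewrite e eqxx => /eqP.
Qed.

Definition merge (f : V -> V) u v := fun x => if f x == f u then f v else f x.

Lemma merge_image f u v : f u != f v -> #|[set f x | x in V]| = #|[set merge f u v x | x in
  V]|.+1.
Proof.
move=> uv; rewrite (cardsD1 (f u)) imset_f // add1n; congr _.+1; apply: eq_card => y.
rewrite in_setD1; apply/andP/imsetP => [[yu /imsetP[x _ e]]|[x _ ->]].
  by exists x => //; rewrite /merge -e (negbTE yu).
by rewrite /merge; case: ifP => [_|/negbT ne]; rewrite imset_f // eq_sym uv.
Qed.

Section Counting.
Variables (E : {set {set V}}) (lam A : nat).
Hypothesis sE : simple_graph E.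
Hypothesis lam_gt0 : 0 < lam.
Hypothesis cut_ge : forall S, nontrivial S -> lam <= #|cut E S|.

(* The vertices with the same image under [f] have been contracted. *)
Definition light f := [set S | saturated f S && (2 * #|cut E S| <= A * lam)].

Lemma card_saturated f : #|[set S | saturated f S]| <= 2 ^ #|[set f x | x in V]|.
Proof.
rewrite -card_powerset.
have inj : {in [set S | saturated f S] &, injective (fun S => f @: S)}.
  move=> S S'; rewrite !inE => /saturatedP sS /saturatedP sS' e; apply/setP => x.
  suff H (Z : {set V}) : (forall x y, f x = f y -> (x \in Z) = (y \in Z)) -> (x \in Z) = (f x
    \in f @: Z).
    by rewrite (H S) // (H S') // e.
  move=> sZ; apply/idP/idP => [|/imsetP[y yZ fxy]]; first exact: imset_f.
  by rewrite (sZ x y).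
rewrite -(card_in_imset inj); apply: subset_leq_card; apply/subsetP => _ /imsetP[S _ ->].
by rewrite inE; apply: imsetS; apply/subsetP.
Qed.

Definition nonloops (f : V -> V) := [set e in E | ~~ [forall x in e, forall y in e,
  f x == f y]].

Lemma nonloopsP f e : e \in nonloops f -> exists u v, [/\ e = [set u; v] & f u != f v].
Proof.
rewrite inE => /andP[eE]; have [u [v [_ ->]]] := simple_pair sE eE => nl.
exists u, v; split=> //; apply: contra nl => /eqP fuv.
apply/forall_inP => x; rewrite !inE => /orP[]/eqP->; apply/forall_inP => y;
  by rewrite !inE => /orP[]/eqP->; rewrite ?fuv.
Qed.

Lemma cut_nonloops f S : saturated f S -> cut E S \subset nonloops f.
Proof.
move=> /saturatedP sS; apply/subsetP => e; rewrite inE => /andP[eE].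
have [u [v [_ ee]]] := simple_pair sE eE; rewrite inE eE ee crosses2 /=.
apply: contra => /forall_inP/(_ u); rewrite !inE eqxx => /(_ isT)/forall_inP/(_ v).
by rewrite !inE eqxx orbT => /(_ isT)/eqP/sS->.
Qed.

(** Handshake: every contracted class is the side of a nontrivial cut, and an edge between two
    classes crosses exactly two of these cuts. *)
Lemma nonloops_ge f : 1 < #|[set f x | x in V]| ->
  #|[set f x | x in V]| * lam <= 2 * #|nonloops f|.
Proof.
move=> N1; pose cls c := [set x | f x == c].
have ntc c : c \in [set f x | x in V] -> nontrivial (cls c).
  move=> /imsetP[x _ ->]; apply/andP; split; first by apply/set0Pn; exists x; rewrite inE.
  apply/eqP => /setP eT; move: N1; rewrite (_ : [set f x | x in V] = [set f x]) ?cards1 //.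
  apply/setP => y; rewrite inE; apply/imsetP/eqP => [[z _ ->]|->]; last by exists x.
  by apply/eqP; have := eT z; rewrite !inE.
have satc c : saturated f (cls c) by apply/saturatedP => x y e; rewrite !inE e.
apply: (@leq_trans (\sum_(c in [set f x | x in V]) #|cut E (cls c)|)).
  by rewrite -sum_nat_const; apply: leq_sum => c /ntc; apply: cut_ge.
apply: (@leq_trans (\sum_(e in nonloops f) \sum_c (crosses e (cls c)))).
  rewrite exchange_big /= [X in X <= _]big_mkcond; apply: leq_sum => c _.
  case: ifP => // _; rewrite -sum1_card.
  rewrite [X in X <= _]big_mkcond [X in _ <= X]big_mkcond; apply: leq_sum => e _.
  case: ifP => // h; rewrite (subsetP (cut_nonloops (satc c)) _ h).
  by move: h; rewrite inE => /andP[_ ->].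
rewrite mulnC -sum_nat_const; apply: leq_sum => e /nonloopsP[u [v [-> uv]]].
apply: (@leq_trans (\sum_c ((c == f u) + (c == f v)))).
  apply: leq_sum => c _; rewrite crosses2 !inE [f u == c]eq_sym [f v == c]eq_sym.
  by case: (c == f u); case: (c == f v).
have sum1 (a : V) : \sum_c (c == a : nat) = 1 by rewrite (bigD1 a) //= eqxx big1 // => c
  /negbTE->.
by rewrite big_split /= !sum1.
Qed.

(* Karger's contraction argument, by double counting the pairs of a light cut and
   an edge that does not cross it: such a cut survives the contraction of the
   edge, and there are at least N lam / 2 edges to contract. *)
Lemma light_step f : A < #|[set f x | x in V]| -> 0 < A ->
  (forall u v, f u != f v ->
    #|light (merge f u v)| <= 2 ^ A * 'C(#|[set f x | x in V]|.-1, A)) ->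
  #|light f| <= 2 ^ A * 'C(#|[set f x | x in V]|, A).
Proof.
set N := #|[set f x | x in V]| => AN A0 IH; set B := 2 ^ A * 'C(N.-1, A) in IH.
set m := #|nonloops f|.
have mN : N * lam <= 2 * m by apply: nonloops_ge; lia.
have sum1 : \sum_(S in light f) m <= m * B + \sum_(S in light f) #|cut E S|.
  have -> : m * B = \sum_(e in nonloops f) B by rewrite sum_nat_const.
  apply: (@leq_trans (\sum_(e in nonloops f) #|[set S in light f | ~~ crosses e S]|
     + \sum_(S in light f) #|cut E S|)).
    have -> : \sum_(e in nonloops f) #|[set S in light f | ~~ crosses e S]| =
       \sum_(S in light f) #|[set e in nonloops f | ~~ crosses e S]|.
      under eq_bigr do rewrite -sum1dep_card big_mkcondr.
      rewrite exchange_big /=; apply: eq_bigr => S _.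
      by rewrite -sum1dep_card big_mkcondr.
    rewrite -big_split /=; apply: leq_sum => S; rewrite inE => /andP[sS _].
    rewrite /m -(cardsID [set e | crosses e S] (nonloops f)) addnC; apply: leq_add.
      by apply: subset_leq_card; apply/subsetP => e; rewrite !inE => /andP[-> ->].
    apply: subset_leq_card; apply/subsetP => e; rewrite !inE => /andP[/andP[-> _] ->] //.
  rewrite leq_add2r; apply: leq_sum => e /nonloopsP[u [v [-> uv]]].
  apply: leq_trans (IH u v uv); apply: subset_leq_card; apply/subsetP => S.
  rewrite !inE crosses2 negbK => /andP[/andP[/saturatedP sS ->] /eqP uvS].
  rewrite andbT; apply/saturatedP => x y; rewrite /merge.
  case: eqP => [xu|_]; case: eqP => [yu|_] exy; try exact: sS.
  - by rewrite (sS x u) // (sS y u).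
  - by rewrite (sS x u) // uvS; apply: sS.
  - by rewrite (sS y u) // uvS; apply: sS.
have sum2 : 2 * \sum_(S in light f) #|cut E S| <= #|light f| * (A * lam).
  rewrite big_distrr /= -sum_nat_const; apply: leq_sum => S.
  by rewrite inE => /andP[].
rewrite sum_nat_const in sum1; set c := #|light f| in sum1 sum2 *.
have m0 : 0 < 2 * m by apply: leq_trans mN; rewrite muln_gt0 lam_gt0 andbT; lia.
have le : c * (2 * m) <= 2 * m * B + c * (A * lam) by lia.
have le2 : c * (2 * m) * N <= 2 * m * B * N + c * A * (2 * m).
  apply: (@leq_trans ((2 * m * B + c * (A * lam)) * N)); first by rewrite leq_mul2r le orbT.
  rewrite mulnDl leq_add2l -!mulnA leq_mul2l; apply/orP; right.
  by rewrite leq_mul2l [lam * N]mulnC mN orbT.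
have le3 : c * N <= B * N + c * A.
  by rewrite -(leq_pmul2l m0); move: le2; lia.
have NA : 0 < N - A by lia.
rewrite -(leq_pmul2l NA); apply: (@leq_trans (N * B)).
  by rewrite mulnBl; move: le3; lia.
by rewrite /B mulnCA [X in _ <= X]mulnCA mul_bin_down.
Qed.

(** Contract until [A] classes remain, which have only [2 ^ A] unions. The binomial coefficient
    collects the factors [N / (N - A)] of the single contractions. *)
Lemma card_light f : 0 < A -> A <= #|[set f x | x in V]| ->
  #|light f| <= 2 ^ A * 'C(#|[set f x | x in V]|, A).
Proof.
move=> A0; move e : #|[set f x | x in V]| => N; elim: N f e => [|N IHN] f e AN; first by lia.
have [AN'|AN'] := leqP A N; last first.
  have -> : A = N.+1 by lia.
  rewrite binn muln1 -e; apply: leq_trans (card_saturated f); apply: subset_leq_card.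
  by apply/subsetP => S; rewrite !inE => /andP[].
have := @light_step f; rewrite e => -> // u v uv; apply: IHN => //.
by have := merge_image uv; rewrite e => -[].
Qed.

Lemma card_light_cuts : 0 < A -> #|[set S | 2 * #|cut E S| <= A * lam]| <= (2 * #|V|.+1) ^ A.
Proof.
move=> A0; have e : #|[set (fun x : V => x) x | x in V]| = #|V| by rewrite card_imset // => ? ?.
have -> : [set S | 2 * #|cut E S| <= A * lam] = light (fun x => x).
  apply/setP => S; rewrite !inE (_ : saturated _ S) //.
  by apply/saturatedP => x y ->.
rewrite expnMn; have [AV|AV] := leqP A #|V|.
  have := @card_light (fun x => x) A0; rewrite e => /(_ AV) /leq_trans; apply.
  rewrite leq_mul2l; apply/orP; right; apply: leq_trans (_ : #|V| ^_ A <= _).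
    by rewrite -bin_ffact leq_pmulr // fact_gt0.
  rewrite ffact_prod; apply: (@leq_trans (\prod_(i < A) #|V|.+1)).
    by apply: leq_prod => i _; lia.
  by rewrite prod_nat_const card_ord.
apply: (@leq_trans (2 ^ A * 1)); last by rewrite leq_mul2l expn_gt0 orbT.
rewrite muln1; apply: leq_trans (_ : #|[set S | saturated (fun x : V => x) S]| <= _).
  by apply: subset_leq_card; apply/subsetP => S; rewrite !inE => /andP[].
by apply: leq_trans (card_saturated _) _; rewrite e leq_pexp2l // ltnW.
Qed.

End Counting.
Definition part E (g : nat) (c : {ffun {set V} -> 'I_g}) i := [set e in E | c e == i].

Lemma sum_part E (g : nat) (c : {ffun {set V} -> 'I_g}) S :
  \sum_i #|cut (part E c i) S| = #|cut E S|.
Proof.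
rewrite -[RHS]sum1_card (partition_big c predT) //=; apply: eq_bigr => i _.
by rewrite -sum1dep_card; apply: eq_bigl => e; rewrite !inE andbAC.
Qed.

End Cuts.

Local Open Scope ring_scope.

(** * Random splitting of the edges *)

Section Split.
Variable R : realType.

Lemma expR_le1D (x : R) : 0 <= x <= 1 -> expR (x - x ^+ 2) <= 1 + x.
Proof.
move=> /andP[x0 x1]; have y0 : 0 < 1 + (x ^+ 2 - x) by nra.
have h := expR_ge1Dx (x ^+ 2 - x).
rewrite (_ : x - x ^+ 2 = - (x ^+ 2 - x)); last by ring.
rewrite expRN; apply: le_trans (_ : (1 + (x ^+ 2 - x))^-1 <= _).
  by rewrite lef_pV2 // posrE ?expR_gt0.
rewrite -div1r ler_pdivrMr //; nra.
Qed.

Lemma expR_le1B (x : R) : 0 <= x <= 1 / 2 -> expR (- (x + 2 * x ^+ 2)) <= 1 - x.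
Proof.
move=> /andP[x0 x1]; have y0 : 0 < 1 + (x + 2 * x ^+ 2) by nra.
have h := expR_ge1Dx (x + 2 * x ^+ 2).
rewrite expRN; apply: le_trans (_ : (1 + (x + 2 * x ^+ 2))^-1 <= _).
  by rewrite lef_pV2 // posrE ?expR_gt0.
rewrite -div1r ler_pdivrMr //; nra.
Qed.

Lemma geometric_le2 (t : R) m : 0 <= t <= 1 / 2 -> \sum_(i < m) t ^+ i <= 2.
Proof.
move=> /andP[t0 t2]; have := subrX1 t m; move: (\sum_(i < m) _) => s e.
have mark_time : 0 <= t ^+ m by apply: exprn_ge0.
have t1 : 0 < 1 - t by lra.
by rewrite -(ler_pM2l t1); move: (t ^+ m) mark_time e => y; lra.
Qed.

Variables (V : finType) (E : {set {set V}}) (k g : nat).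
Hypothesis sE : simple_graph E.
Hypothesis k_gt0 : (0 < k)%N.
Hypothesis g_gt0 : (0 < g)%N.
Local Notation splits := {ffun {set V} -> 'I_g}.
Implicit Types (c : splits) (S : {set V}).

Let gR : 0 < g%:R :> R. Proof. by rewrite ltr0n. Qed.

(** Exponential moment of the share of group [i] in a cut: [z > 1] gives the upper tail, [z < 1] the
    lower one. Edges off the cut get weight 1, and [1 + x <= expR x] bounds the mean. *)
Lemma pr_part S i (z a : R) (B : pred splits) : 0 <= z ->
  (forall c, B c -> a <= z ^+ #|cut (part E c i) S|) ->
  a * pr R B <= expR ((z - 1) * (#|cut E S|%:R / g%:R)).
Proof.
move=> z0 aB.
pose w (e : {set V}) (j : 'I_g) : R := if e \in cut E S then (if j == i then z else 1) else 1.
pose s (e : {set V}) : R := if e \in cut E S then expR ((z - 1) / g%:R) else 1.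
have := @pr_markov R _ _ w s a B.
have -> : \prod_e s e = expR ((z - 1) * (#|cut E S|%:R / g%:R)).
  by rewrite -big_mkcond prodr_const -expRM_natl; congr expR; rewrite /=; ring.
rewrite card_ord; apply=> //.
- by move=> e j; rewrite /w; do 2!case: ifP => _ //.
- move=> e; rewrite /w /s; case: (boolP (e \in cut E S)) => _;
  last by rewrite sumr_const card_ord mulr1.
  rewrite (bigD1 i) //= eqxx (eq_bigr (fun=> 1)); last by move=> j /negbTE->.
  have -> : \sum_(j | j != i) 1 = g%:R - 1 :> R.
    have : \sum_(j < g) 1 = g%:R :> R by rewrite sumr_const card_ord.
    by rewrite (bigD1 i) //=; lra.
  have := expR_ge1Dx ((z - 1) / g%:R); rewrite -(ler_pM2l gR); apply: le_trans.
  by rewrite mulrDr mulrCA divff ?gt_eqF //; lra.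
- move=> c /aB; congr (_ <= _); rewrite /w.
  rewrite -big_mkcond -big_mkcondr /= prodr_const; congr (_ ^+ _).
  by apply: eq_card => e; rewrite [RHS]unfold_in /= !inE andbAC.
Qed.

Definition deviates (th : R) S i : pred splits := fun c =>
  ((1 + th) * (#|cut E S|%:R / g%:R) <= #|cut (part E c i) S|%:R) ||
  (#|cut (part E c i) S|%:R <= (1 - th) * (#|cut E S|%:R / g%:R)).

Lemma pr_deviates th S i : 0 <= th <= 1 ->
  pr R (deviates th S i) <= 2 * expR (- (th ^+ 2 / (8 * g%:R)) * #|cut E S|%:R).
Proof.
move=> /andP[t0 t1].
set mu : R := #|cut E S|%:R / g%:R.
have mu0 : 0 <= mu by rewrite divr_ge0.
have -> : - (th ^+ 2 / (8 * g%:R)) * #|cut E S|%:R = - (th ^+ 2 / 8) * mu :> R.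
  by rewrite /mu invfM; ring.
pose B1 : pred splits := fun c => (1 + th) * mu <= #|cut (part E c i) S|%:R.
pose B2 : pred splits := fun c => #|cut (part E c i) S|%:R <= (1 - th) * mu.
have h1 : pr R B1 <= expR (- (th ^+ 2 / 8) * mu).
  (* Since [expR_le1D] loses [x ^ 2], the tilt must be a fraction of [th]; [th / 4] leaves the
     exponent [th ^ 2 * (3 - th) / 16 >= th ^ 2 / 8]. *)
  pose a := expR ((th / 4 - (th / 4) ^+ 2) * ((1 + th) * mu)).
  have := @pr_part S i (1 + th / 4) a B1; rewrite -ler_pdivlMl ?expR_gt0 // => H.
  apply: le_trans (H _ _) _; first lra.
    move=> c Bc; apply: (@le_trans _ _ (expR (th / 4 - (th / 4) ^+ 2) ^+ #|cut (part E c i)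
      S|)).
      rewrite -expRM_natl ler_expR [X in _ <= X]mulrC; apply: ler_wpM2l => //; nra.
    by apply: lerXn2r; rewrite ?nnegrE ?expR_ge0 ?expR_le1D //; lra.
  rewrite -expRN -expRD ler_expR -subr_ge0.
  have -> : - (th ^+ 2 / 8) * mu - (- ((th / 4 - (th / 4) ^+ 2) * ((1 + th) * mu)) + (1 + th /
    4 - 1) * mu) =
    mu * (th ^+ 2 * (1 - th)) / 16 by field.
  by rewrite divr_ge0 // mulr_ge0 // mulr_ge0 ?sqr_ge0 //; lra.
have h2 : pr R B2 <= expR (- (th ^+ 2 / 8) * mu).
  pose a := expR (- (th / 4 + 2 * (th / 4) ^+ 2) * ((1 - th) * mu)).
  have := @pr_part S i (1 - th / 4) a B2; rewrite -ler_pdivlMl ?expR_gt0 // => H.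
  apply: le_trans (H _ _) _; first lra.
    move=> c Bc; apply: (@le_trans _ _ (expR (- (th / 4 + 2 * (th / 4) ^+ 2)) ^+ #|cut (part E
      c i) S|)).
      rewrite -expRM_natl ler_expR [X in _ <= X]mulrC !mulNr lerN2; apply: ler_wpM2l => //; nra.
    by apply: lerXn2r; rewrite ?nnegrE ?expR_ge0 ?expR_le1B //; lra.
  rewrite -expRN -expRD ler_expR -subr_ge0.
  have -> : - (th ^+ 2 / 8) * mu - (- (- (th / 4 + 2 * (th / 4) ^+ 2) * ((1 - th) * mu)) + (1 -
    th / 4 - 1) * mu) =
    mu * (th ^+ 2 * th) / 8 by field.
  by rewrite divr_ge0 // mulr_ge0 // mulr_ge0 ?sqr_ge0 //.
apply: le_trans (_ : pr R (predU B1 B2) <= _); first by apply: pr_sub.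
by apply: le_trans (pr_or _ _ _) _; lra.
Qed.

Hypothesis cut_ge : forall S, nontrivial S -> (k <= #|cut E S|)%N.

(* Cuts are sorted by [a = 2 #|cut E S| %/ k]; there are at most
   [(2 n.+1) ^ a.+1 <= ((2 n.+1) ^ 2) ^ a] of each sort. *)
Lemma sum_cuts (x t : R) : 0 <= x ->
  t = (2 * #|V|.+1)%:R ^+ 2 * expR (- (x * k%:R / 2)) -> t <= 1 / 2 ->
  \sum_(S | nontrivial S) expR (- x * #|cut E S|%:R) <= 2 * t.
Proof.
move=> x0 te t2; set b := expR _ in te; set n2 : R := (2 * #|V|.+1)%:R in te.
have n21 : 1 <= n2 by rewrite /n2 ler1n.
have b0 : 0 <= b by apply: expR_ge0.
have t0 : 0 <= t by rewrite te mulr_ge0 ?exprn_ge0.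
pose al S := (2 * #|cut E S| %/ k)%N; pose m := (2 * #|E|).+1.
have al_m S : (al S < m)%N.
  rewrite ltnS; apply: leq_trans (leq_div _ _) _; rewrite leq_mul2l /=.
  by apply: subset_leq_card; apply/subsetP => e; rewrite inE => /andP[].
have al1 S : nontrivial S -> (1 <= al S)%N.
  by move=> /cut_ge h; rewrite /al divn_gt0 //; lia.
have le1 S : expR (- x * #|cut E S|%:R) <= b ^+ al S.
  rewrite /b -expRM_natl ler_expR; have := leq_trunc_div (2 * #|cut E S|) k.
  rewrite -(ler_nat R) -/(al S) !natrM; nra.
have le2 a : (1 <= a)%N -> \sum_(S | nontrivial S && (al S == a)) b ^+ al S <= t ^+ a.
  move=> a1; rewrite (eq_bigr (fun=> b ^+ a)); last by move=> S /andP[_ /eqP->].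
  rewrite sumr_const -[_ *+ _]mulr_natl te exprMn -exprM; apply: ler_wpM2r;
    first exact: exprn_ge0.
  apply: (@le_trans _ _ (n2 ^+ a.+1)); last by rewrite ler_weXn2l //; lia.
  rewrite /n2 -natrX ler_nat.
  apply: leq_trans (card_light_cuts sE k_gt0 cut_ge (ltn0Sn a)).
  apply: subset_leq_card; apply/subsetP => S; rewrite inE /= => /andP[_ /eqP <-].
  by rewrite ltnW // ltn_ceil.
apply: le_trans (_ : \sum_(S | nontrivial S) b ^+ al S <= _); first by apply: ler_sum => S _.
rewrite (partition_big (fun S => inord (al S) : 'I_m.+1) predT) //=.
(* Sort 0 contains no nontrivial cut, so a factor [t] can be taken out of the geometric sum. *)
pose B a : R := if a is a'.+1 then t * t ^+ a' else 0.
apply: le_trans (_ : \sum_(a < m.+1) B a <= _).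
  apply: ler_sum => a _; have -> : B a = if (0 < a)%N then t ^+ a else 0.
    by rewrite /B; case: (nat_of_ord a) => // a'; rewrite exprS.
  case: posnP => a0.
    rewrite big1 // => S /andP[/al1 h /eqP e].
    by move: h; rewrite -(inordK (leqW (al_m S))) e a0.
  rewrite (eq_bigl (fun S => nontrivial S && (al S == a))); first exact: le2.
  by move=> S; congr andb; rewrite -(inj_eq val_inj) /= inordK //; exact: leqW.
rewrite big_ord_recl add0r /= -big_distrr /= [2 * t]mulrC ler_wpM2l //.
by apply: geometric_le2; rewrite t0 t2.
Qed.

Lemma pr_split (th t : R) : 0 <= th <= 1 ->
  t = (2 * #|V|.+1)%:R ^+ 2 * expR (- (th ^+ 2 / (8 * g%:R) * k%:R / 2)) -> t <= 1 / 2 ->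
  pr R [pred c : splits | [exists (p : {set V} * 'I_g | nontrivial p.1), deviates th p.1 p.2 c]]
    <= g%:R * (4 * t).
Proof.
move=> th01 te t2; have [th0 _] := andP th01.
apply: le_trans (pr_sum _ _ (fun p : {set V} * 'I_g => deviates th p.1 p.2)) _.
rewrite [X in X <= _](_ : _ = \sum_(S | nontrivial S) \sum_(i < g) pr R (deviates th S i));
  last first.
  by rewrite pair_big /=; apply: eq_bigl => p; rewrite andbT.
apply: (@le_trans _ _ (\sum_(S | nontrivial S) g%:R * (2 * expR (- (th ^+ 2 / (8 * g%:R)) *
  #|cut E S|%:R)))).
  apply: ler_sum => S _.
  apply: (@le_trans _ _ (\sum_(i < g) 2 * expR (- (th ^+ 2 / (8 * g%:R)) * #|cut E S|%:R))).
    by apply: ler_sum => i _; apply: pr_deviates.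
  by rewrite sumr_const card_ord [X in _ <= X]mulr_natl lexx.
rewrite -!big_distrr /=; apply: ler_wpM2l => //.
have x0 : 0 <= th ^+ 2 / (8 * g%:R) by rewrite divr_ge0 ?exprn_ge0 // mulr_ge0.
have := sum_cuts x0 te t2; lra.
Qed.

End Split.

(** * Truncating the groups of a well-split cut *)

Section SplitGood.
Variables (R : realType) (V : finType) (E : {set {set V}}) (k g m K : nat).
Hypothesis g_gt0 : (0 < g)%N.
Hypothesis m_gt0 : (0 < m)%N.
Hypothesis kK : (k <= g * K)%N.
Hypothesis Kk : ((3 * m + 1) * k < K.+1 * (3 * m * g))%N.

(** If [s <= (1 + 2 * th) * k], no group has more than [K] edges, because [(1 + th) * (1 + 2 * th)
    <= 1 + 4 * th = 1 + 1 / (3 * m)]; nothing is truncated. Otherwise each group has at least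
    [k / g] edges, because [(1 - th) * (1 + 2 * th) >= 1], and [K >= k / g] too. *)
Lemma split_good (c : {ffun {set V} -> 'I_g}) S : (k <= #|cut E S|)%N ->
  (forall i, ~~ deviates E (1 / (12 * m%:R) : R) S i c) ->
  (k <= \sum_i minn K #|cut (part E c i) S|)%N.
Proof.
move=> kS nd.
have gR : 0 < g%:R :> R by rewrite ltr0n.
have mR : 1 <= m%:R :> R by rewrite ler1n.
have mR0 : 0 < m%:R :> R by lra.
set th : R := 1 / (12 * m%:R) in nd.
have th_m : th * m%:R = 1 / 12 by rewrite /th invfM; field; rewrite gt_eqF.
have th0 : 0 < th by rewrite divr_gt0 ?mulr_gt0.
have th12 : th <= 1 / 12 by nra.
set s := #|cut E S| in kS nd *.
pose dl i : R := #|cut (part E c i) S|%:R.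
have dev i : (1 - th) * s%:R < g%:R * dl i < (1 + th) * s%:R.
  have := nd i; rewrite /deviates negb_or -!ltNge !mulrA => /andP[].
  by rewrite ltr_pdivrMr // ltr_pdivlMr // => h1 h2; rewrite [g%:R * _]mulrC h2.
have [le|gt] := lerP (s%:R : R) ((1 + 2 * th) * k%:R).
  apply: leq_trans kS _; rewrite /s -(sum_part E c); apply: leq_sum => i _.
  rewrite leq_min leqnn andbT -ltnS -(ltr_nat R).
  have /andP[_ d2] := dev i.
  have : (3 * m%:R + 1) * k%:R < K.+1%:R * (3 * m%:R * g%:R) :> R.
    by move: Kk; rewrite -(ltr_nat R) !natrM natrD natrM.
  have k0 : 0 <= k%:R :> R by [].
  rewrite -/(dl i) => Kr.
  have h1 : g%:R * dl i < (1 + th) * ((1 + 2 * th) * k%:R).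
    by apply: lt_le_trans d2 _; rewrite ler_wpM2l //; lra.
  have h2 : (1 + th) * (1 + 2 * th) <= 1 + 4 * th by nra.
  have h3 : g%:R * dl i < (1 + 4 * th) * k%:R.
    by apply: lt_le_trans h1 _; rewrite mulrA ler_wpM2r.
  have h4 : (1 + 4 * th) * k%:R * (3 * m%:R) = (3 * m%:R + 1) * k%:R.
    have -> : (1 + 4 * th) * k%:R * (3 * m%:R) = (3 * m%:R + 12 * (th * m%:R)) * k%:R by ring.
    by rewrite th_m; field.
  have h5 : g%:R * dl i * (3 * m%:R) < K.+1%:R * (3 * m%:R * g%:R).
    by apply: lt_trans Kr; rewrite -h4 ltr_pM2r // mulr_gt0.
  have gm : 0 < 3 * m%:R * g%:R :> R by rewrite !mulr_gt0.
  by rewrite -(ltr_pM2r gm); move: h5; rewrite (_ : g%:R * dl i * (3 * m%:R) = dl i * (3 * m%:R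
    * g%:R)) //; ring.
have key i : (k <= g * minn K #|cut (part E c i) S|)%N.
  rewrite /minn; case: ifP => // _; rewrite -(ler_nat R) natrM -/(dl i).
  have /andP[d1 _] := dev i; apply: ltW; apply: le_lt_trans d1.
  apply: (@le_trans _ _ ((1 - th) * ((1 + 2 * th) * k%:R))); last first.
    by rewrite ler_wpM2l ?ltW //; lra.
  rewrite mulrA ler_peMl //; nra.
rewrite -(leq_pmul2l g_gt0) big_distrr /=.
rewrite [X in (X <= _)%N](_ : (g * k = \sum_(i < g) k)%N); first exact: leq_sum.
by rewrite sum_nat_const card_ord.
Qed.

End SplitGood.

Local Open Scope nat_scope.

(** * Peeling off forests *)

Section Peel.
Variables (V : finType) (E : {set {set V}}) (ident : V -> nat) (port : V -> seq V).
Variables (b0 r L T g K : nat).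

(* The edges of group [i] that remain after [j] forests were removed. *)
Fixpoint alive (grp : V -> V -> nat) (start : nat -> V -> nat) j i : rel V :=
  if j is j'.+1 then fun v w => alive grp start j' i v w &&
    ~~ forest (fun v => [seq w <- port v | (grp v w == i) && alive grp start j' i v w])
         ident b0 r (start j') L T v w
  else fun _ _ => true.

Definition layer grp start j i v := [seq w <- port v | (grp v w == i) && alive grp start j i v
  w].

Lemma aliveS grp start j i v w : alive grp start j.+1 i v w =
  alive grp start j i v w && ~~ forest (layer grp start j i) ident b0 r (start j) L T v w.
Proof. by []. Qed.

(** What is left before forest [j] does not depend on the shifts of forest [j], which are therefore
    still fresh. *)
Lemma eq_alive grp start start' j : (forall j', j' < j -> start j' = start' j') ->
  alive grp start j = alive grp start' j.
Proof.
elim: j => //= j IHj e; rewrite (e j) // IHj // => j' jj'; apply: e; exact: ltnW.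
Qed.

Hypothesis sE : simple_graph E.
Hypothesis portP : port_numbering E port.
Hypothesis ident_inj : injective ident.
Hypothesis ident_lt : forall v, ident v < 2 ^ b0.

Lemma in_port v w : (w \in port v) = ([set v; w] \in E).
Proof. exact: (portP v).2. Qed.

Lemma port_symm v w : (w \in port v) = (v \in port w).
Proof. by rewrite !in_port setUC. Qed.

Variables (grp : V -> V -> nat) (start : nat -> V -> nat).
Hypothesis grpC : forall v w, w \in port v -> grp v w = grp w v.
Hypothesis grp_lt : forall v w, w \in port v -> grp v w < g.
Hypothesis start_le : forall j v, start j v <= L.
Local Notation al := (alive grp start).
Local Notation lay := (layer grp start).
Local Notation forest j i := (forest (lay j i) ident b0 r (start j) L T).

Lemma alive_sym j i v w : al j i v w = al j i w v.
Proof.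
elim: j v w => // j IHj v w; rewrite !aliveS IHj forest_sym // => v' w'.
rewrite !mem_filter (IHj w') (port_symm v').
by case: (boolP (v' \in port w')) => h; rewrite ?andbF // (grpC h).
Qed.

Lemma mem_layer j i v w : (w \in lay j i v) = [&& w \in port v, grp v w == i & al j i v w].
Proof. by rewrite mem_filter andbC. Qed.

Lemma layer_sym j i v w : (w \in lay j i v) = (v \in lay j i w).
Proof.
rewrite !mem_layer (port_symm v) (alive_sym _ _ v).
by case: (boolP (v \in port w)) => //= h; rewrite (grpC h).
Qed.

Lemma alive_le j j' i v w : j <= j' -> al j' i v w -> al j i v w.
Proof. by move=> /subnK<-; elim: (j' - j) => // d IHd; rewrite addSn aliveS => /andP[/IHd]. Qed.

Definition peeled j : {set {set V}} := [set e in E |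
  [exists v, exists w, (e == [set v; w]) && ~~ al j (grp v w) v w]].

Lemma in_peeled j v w : w \in port v -> ([set v; w] \in peeled j) = ~~ al j (grp v w) v w.
Proof.
move=> wv; rewrite inE -in_port wv; apply/existsP/idP => [[x /existsP[y /andP[/eqP e]]]|h];
  last first.
  by exists v; apply/existsP; exists w; rewrite eqxx.
have nvw : v != w.
  by have := forall_inP sE [set v; w]; rewrite -in_port => /(_ wv); rewrite cards2 eqSS;
    case: (v != w).
have : v \in [set x; y] by rewrite -e !inE eqxx.
have : w \in [set x; y] by rewrite -e !inE eqxx orbT.
rewrite !inE => /orP[]/eqP wx /orP[]/eqP vy h.
- by rewrite wx vy eqxx in nvw.
- by rewrite grpC // alive_sym wx vy.
- by rewrite wx vy.
- by rewrite wx vy eqxx in nvw.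
Qed.

Lemma peeled_sub j : peeled j \subset E.
Proof. by apply/subsetP => e; rewrite inE => /andP[]. Qed.

(** Deterministic: a cluster makes only [T] choices, so an excess of keys endangers connectivity but
    not the size. *)
Lemma card_peeled : 0 < b0 -> #|peeled K| * r.+1 <= g * K * (#|V| * (r.+1 + T)).
Proof.
move=> b00.
have sub : peeled K \subset \bigcup_(p : 'I_g * 'I_K) edges (forest p.2 p.1).
  apply/subsetP => e; rewrite inE => /andP[eE /existsP[v /existsP[w /andP[/eqP ee nal]]]].
  have wv : w \in port v by rewrite in_port -ee.
  have [j jK /andP[alj nalj]] : exists2 j, j < K & al j (grp v w) v w && ~~ al j.+1 (grp v w) v
    w.
    elim: K nal => // j IHj nal; have [al|/IHj[j' j'j h]] := boolP (al j (grp v w) v w).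
      by exists j; rewrite // al.
    by exists j' => //; apply: ltnW.
  apply/bigcupP; exists (Ordinal (grp_lt wv), Ordinal jK) => //; apply/edgesP; exists v, w;
    split=> //=.
  by move: nalj; rewrite aliveS alj negbK.
have leF (p : 'I_g * 'I_K) : #|edges (forest p.2 p.1)| * r.+1 <= #|V| * (r.+1 + T).
  have ls := layer_sym p.2 p.1.
  have h1 := card_forest r ls ident_inj ident_lt (start p.2) L T.
  have h2 : #|open_centers (lay p.2 p.1) ident b0 r| * r.+1 <= #|V|.
    by apply: card_open_centers => //; rewrite -addnn; nia.
  apply: leq_trans (leq_mul h1 (leqnn r.+1)) _.
  by rewrite mulnDl mulnDr leq_add2l mulnAC leq_mul2r h2 orbT.
apply: (@leq_trans (\sum_(p : 'I_g * 'I_K) #|edges (forest p.2 p.1)| * r.+1)); last first.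
  apply: (@leq_trans (\sum_(p : 'I_g * 'I_K) #|V| * (r.+1 + T))).
    by apply: leq_sum => p _; apply: leF.
  by rewrite sum_nat_const card_prod !card_ord.
rewrite -big_distrl leq_mul2r; apply/orP; right.
apply: leq_trans (subset_leq_card sub) _.
elim/big_rec2: _ => [|p m B _ IH]; first by rewrite cards0.
by apply: leq_trans (leq_card_setU _ _).1 _; rewrite leq_add2l.
Qed.

Hypothesis keys_small : forall j i v, j < K -> i < g ->
  #|keyset (lay j i) ident b0 r (start j) L v| <= T.
Variables (c : {ffun {set V} -> 'I_g}).
Hypothesis c_grp : forall v w, w \in port v -> c [set v; w] = grp v w :> nat.

(** The ends of a remaining edge of the cut are joined by forest [j]. The first edge of this path
    that crosses [S] was alive in the group and is peeled now. *)
Lemma cut_peeled_step (i : 'I_g) S j : j < K ->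
  cut (part (peeled j) c i) S != cut (part E c i) S ->
  #|cut (part (peeled j) c i) S| < #|cut (part (peeled j.+1) c i) S|.
Proof.
move=> jK ne; apply: proper_card.
have sub : peeled j \subset peeled j.+1.
  apply/subsetP => e; rewrite !inE => /andP[-> /existsP[v /existsP[w /andP[ee nal]]]].
  apply/existsP; exists v; apply/existsP; exists w; rewrite ee; apply: contra nal.
  exact: alive_le.
have cutE j' e : (e \in cut (part (peeled j') c i) S) = [&& e \in peeled j',
  c e == i & crosses e S].
  by rewrite 2!inE andbA.
have [e]: exists e, e \in cut (part E c i) S :\: cut (part (peeled j) c i) S.
  apply/set0Pn; rewrite setD_eq0; apply: contra ne => h; rewrite eqEsubset h andbT.
  apply/subsetP => e; rewrite cutE => /and3P[h0 h1 h2].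
  by rewrite 2!inE (subsetP (peeled_sub j) _ h0) h1 h2.
rewrite in_setD cutE [e \in cut _ _]inE [e \in part _ _ _]inE => /andP[h /andP[/andP[eE /eqP
  ci] cr]].
move: h; rewrite ci eqxx cr !andbT; have [u [v [uv ee]]] := simple_pair sE eE;
  rewrite {}ee in eE ci cr *.
have vu : v \in port u by rewrite in_port.
rewrite in_peeled // negbK => al_uv; have gi : grp u v = i by rewrite -c_grp ?ci.
rewrite gi in al_uv.
have vl : v \in lay j i u by rewrite mem_layer vu gi eqxx.
have ls := layer_sym j i.
have := forest_connect ls ident_inj ident_lt (start_le j) (fun v' => keys_small v' jK (ltn_ord
  i)) vl.
rewrite crosses2 in cr => /connectP[p]; elim: p u cr {uv eE ci vu al_uv gi vl} => [|x p IHp] u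
  cr /=.
  by move=> _ uv; rewrite uv eqxx in cr.
move=> /andP[ux px] lx; have [xS|xS] := boolP ((u \in S) == (x \in S)).
  by apply: IHp px lx; rewrite -(eqP xS).
have xl : x \in lay j i u by case/andP: ux.
move: (xl); rewrite mem_layer => /and3P[xu /eqP gx alx].
apply/properP; split.
  by apply/subsetP => e'; rewrite !cutE => /and3P[h0 h1 h2]; rewrite (subsetP sub _ h0) h1 h2.
exists [set u; x]; rewrite cutE ?crosses2 ?xS ?in_peeled // gx ?alx //.
by rewrite aliveS alx ux andbT -val_eqE /= c_grp // gx.
Qed.

Lemma cut_peeled (i : 'I_g) S j : j <= K ->
  minn j #|cut (part E c i) S| <= #|cut (part (peeled j) c i) S|.
Proof.
elim: j => [|j IHj] jK; first by rewrite min0n.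
have sub j' : #|cut (part (peeled j') c i) S| <= #|cut (part E c i) S|.
  apply: subset_leq_card; apply/subsetP => e; rewrite !inE => /andP[/andP[/andP[-> _] ->] ->].
  by [].
have [e|ne] := eqVneq (cut (part (peeled j) c i) S) (cut (part E c i) S); last first.
  by have := cut_peeled_step jK ne; have := IHj (ltnW jK); lia.
rewrite geq_min; apply/orP; right; rewrite -e; apply: subset_leq_card; apply/subsetP => x.
rewrite !inE => /andP[/andP[/andP[-> /existsP[v /existsP[w /andP[ee nal]]]] ->] ->].
rewrite andbT /=; apply/andP; split=> //; apply/existsP; exists v; apply/existsP; exists w.
by rewrite ee; apply: contra nal => /andP[].
Qed.

Lemma peeled_certificate k :
  (edge_connected k E -> forall S, nontrivial S -> k <= \sum_i minn K #|cut (part E c i) S|) ->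
  connectivity_certificate k E (peeled K).
Proof.
move=> split; rewrite /connectivity_certificate peeled_sub /=; apply/eqP; apply/idP/idP => conn.
  apply: cut_edge_connected sE _ => S nS; apply: leq_trans (edge_connected_cut conn nS) _.
  apply: subset_leq_card; apply/subsetP => e; rewrite !inE => /andP[/andP[-> _] ->].
  by [].
apply: cut_edge_connected => [|S nS].
  apply/forall_inP => e h; apply: (forall_inP sE); exact: (subsetP (peeled_sub K)).
apply: leq_trans (split conn S nS) _; rewrite -(sum_part _ c); apply: leq_sum => i _.
exact: cut_peeled.
Qed.

End Peel.

Local Open Scope ring_scope.

(** * Probability of failure *)

Section Tapes.
Variables (s b0 g K L : nat).
Local Notation Omega := ({ffun 'I_(2 ^ b0) -> 'I_g} * {ffun 'I_K -> 'I_(2 ^ L)})%type.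
Variables (dec : s.-tuple bool -> Omega) (enc : Omega -> s.-tuple bool).
Hypothesis encK : cancel enc dec.
Hypothesis decK : cancel dec enc.

(** A tape decodes to a group for each possible identifier of a neighbour and an [L]-bit number for
    each forest, whose bit length is the shift. *)
Definition gcoin (w : s.-tuple bool) (a : nat) : nat :=
  if insub a is Some a' then (dec w).1 a' else 0.
Definition coin j (w : s.-tuple bool) : nat :=
  if insub j is Some j' then bitlen ((dec w).2 j') else 0.

Lemma coin_le j w : (coin j w <= L)%N.
Proof. by rewrite /coin; case: insubP => // j' _ _; rewrite bitlen_le. Qed.

Variables (R : realType) (V : finType) (E : {set {set V}}) (ident : V -> nat) (port : V -> seq
  V).
Variables (r T k : nat).
Hypothesis sE : simple_graph E.
Hypothesis portP : port_numbering E port.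
Hypothesis ident_inj : injective ident.
Hypothesis ident_lt : forall v, (ident v < 2 ^ b0)%N.
Hypothesis g_gt0 : (0 < g)%N.
Local Notation tapes := {ffun V -> s.-tuple bool}.
Implicit Types (x : tapes).

Definition grp x v w :=
  if (ident v < ident w)%N then gcoin (x v) (ident w) else gcoin (x w) (ident v).
Definition start x j v := coin j (x v).

Let idO v := Ordinal (ident_lt v).

Lemma gcoin_id w v : gcoin w (ident v) = (dec w).1 (idO v).
Proof.
rewrite /gcoin; case: insubP => [a _ e|]; last by rewrite ident_lt.
by rewrite (_ : a = idO v) //; apply: val_inj.
Qed.

Lemma neq_port v w : w \in port v -> v != w.
Proof.
by rewrite (in_port portP) => /(forall_inP sE); rewrite cards2 eqSS; case: (v != w).
Qed.

Lemma grpC x v w : w \in port v -> grp x v w = grp x w v.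
Proof.
move=> /neq_port; rewrite /grp -(inj_eq ident_inj) neq_ltn.
by case: (ltngtP (ident v) (ident w)).
Qed.

Lemma grp_lt x v w : w \in port v -> (grp x v w < g)%N.
Proof. by rewrite /grp !gcoin_id; case: ifP. Qed.

Definition owner (e : {set V}) : option (V * V) :=
  [pick p : V * V | [&& e \in E, e == [set p.1; p.2] & (ident p.1 < ident p.2)%N]].

Lemma owner_pair v w : [set v; w] \in E -> (ident v < ident w)%N -> owner [set v; w] = Some (v,
  w).
Proof.
move=> eE lt; rewrite /owner; case: pickP => [[a b] /= /and3P[_ /eqP e lt']|/(_ (v, w))];
  last first.
  by rewrite eE eqxx lt.
have : v \in [set a; b] by rewrite -e !inE eqxx.
have : w \in [set a; b] by rewrite -e !inE eqxx orbT.
rewrite !inE => /orP[]/eqP wx /orP[]/eqP vy; rewrite ?wx ?vy //; move: lt lt'; rewrite wx vy;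
  lia.
Qed.

Lemma owner_none e : e \in E -> owner e != None.
Proof.
move=> eE; have [v [w [vw ee]]] := simple_pair sE eE.
wlog lt : v w vw ee / (ident v < ident w)%N.
  move=> H; move: (vw); rewrite -(inj_eq ident_inj) neq_ltn => /orP[]; first exact: H.
  by apply: H; [rewrite eq_sym|rewrite setUC].
by rewrite ee owner_pair // -ee.
Qed.

Lemma owner_out e : e \notin E -> owner e = None.
Proof. by move=> eE; rewrite /owner; case: pickP => // p; rewrite (negbTE eE). Qed.

(** Chernoff's bound concerns independent groups on all vertex sets. Edges take theirs from the tape
    of the owner, other sets from [y], so that [color] and [recolor] undo each other as
    [pr_resample] requires. *)
Definition color x (y : {ffun {set V} -> 'I_g}) : {ffun {set V} -> 'I_g} :=
  [ffun e => if owner e is Some p then (dec (x p.1)).1 (idO p.2) else y e].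

Lemma color_grp x y v w : w \in port v -> color x y [set v; w] = grp x v w :> nat.
Proof.
move=> wv; wlog lt : v w wv / (ident v < ident w)%N.
  move=> H; have := neq_port wv; rewrite -(inj_eq ident_inj) neq_ltn => /orP[lt|lt];
    first exact: H.
  by rewrite setUC (grpC x wv); apply: H => //; rewrite (port_symm portP).
by rewrite ffunE owner_pair -?(in_port portP) // /grp lt gcoin_id.
Qed.

(* Redraws exactly the coins that determine the groups of the edges in [E]. *)
Definition recolor x (y : {ffun {set V} -> 'I_g}) : tapes :=
  [ffun v => enc ([ffun a : 'I_(2 ^ b0) => if [pick w | [&& [set v; w] \in E,
    ident w == a & (ident v < ident w)%N]]
     is Some w then y [set v; w] else (dec (x v)).1 a], (dec (x v)).2)].

Lemma dec_recolor x y v w : [set v; w] \in E -> (ident v < ident w)%N ->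
  (dec (recolor x y v)).1 (idO w) = y [set v; w].
Proof.
move=> eE lt; rewrite ffunE encK ffunE; case: pickP => [w' /and3P[_ /eqP e _]|/(_ w)].
  by rewrite (ident_inj e).
by rewrite eE eqxx lt.
Qed.

Lemma color_recolor x y z e : e \in E -> color (recolor x y) z e = y e.
Proof.
move=> eE; have := owner_none eE; rewrite ffunE; case oe: (owner e) => [[v w]|] // _.
move: oe; rewrite /owner; case: pickP => // p /and3P[_ /eqP ee lt] [pe].
by rewrite pe /= in ee lt *; rewrite dec_recolor -?ee.
Qed.

Let two_gt0 : (0 < 2 ^ L)%N. Proof. by rewrite expn_gt0. Qed.

Lemma pr_recolor (P : pred {ffun {set V} -> 'I_g}) (z : {ffun {set V} -> 'I_g}) (p : R) :
  (forall y y' : {ffun {set V} -> 'I_g}, (forall e, e \in E -> y e = y' e) -> P y = P y') ->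
  pr R P <= p -> pr R (fun x => P (color x z)) <= p.
Proof.
move=> PE Pp; apply: (@pr_resample R _ _ recolor color).
- by apply/card_gt0P; exists ([ffun => enc ([ffun => Ordinal g_gt0],
  [ffun => Ordinal two_gt0])] : tapes).
- by apply/card_gt0P; exists z.
- move=> x y; apply/ffunP => v; rewrite ffunE -[RHS]decK; congr enc.
  rewrite [RHS]surjective_pairing; congr pair; last by rewrite ffunE encK.
  apply/ffunP => a; rewrite ffunE; case: pickP => [w /and3P[eE /eqP e lt]|no].
    rewrite ffunE owner_pair //; congr (_ _); exact: val_inj.
  rewrite ffunE encK ffunE; case: pickP => // w; by rewrite no.
- move=> x y; apply/ffunP => e; have [eE|eE] := boolP (e \in E); first exact: color_recolor.
  by rewrite !ffunE owner_out // ffunE owner_out.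
- move=> x; apply: le_trans Pp; apply: pr_sub => y; rewrite (PE _ y) // => e.
  exact: color_recolor.
Qed.

Definition set_coin (j : 'I_K) x (y : {ffun V -> 'I_(2 ^ L)}) : tapes :=
  [ffun v => enc ((dec (x v)).1, [ffun j' : 'I_K => if j' == j then y v else (dec (x v)).2
    j'])].
Definition get_coin (j : 'I_K) x (y : {ffun V -> 'I_(2 ^ L)}) : {ffun V -> 'I_(2 ^ L)} :=
  [ffun v => (dec (x v)).2 j].

Lemma gcoin_set_coin j x y v : gcoin (set_coin j x y v) = gcoin (x v).
Proof. by apply: funext => a; rewrite /gcoin ffunE encK. Qed.

Lemma grp_set_coin j x y : grp (set_coin j x y) = grp x.
Proof. by apply: funext => v; apply: funext => w; rewrite /grp !gcoin_set_coin. Qed.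

Lemma start_set_coin (j : 'I_K) x y j' : (j' < j)%N -> start (set_coin j x y) j' = start x j'.
Proof.
move=> jj; apply: funext => v; rewrite /start /coin; case: insubP => // j1 _ e.
by rewrite ffunE encK ffunE -val_eqE e /= ltn_eqF.
Qed.

Lemma start_set_coin_same (j : 'I_K) x y : start (set_coin j x y) j = shift y.
Proof.
apply: funext => v; rewrite /start /coin insubT // => jK; rewrite ffunE encK ffunE.
by rewrite (_ : Sub _ _ == j) //; apply/eqP/val_inj.
Qed.

Definition bad_keys (p : 'I_g * 'I_K) : pred tapes := fun x => ~~ [forall v,
  #|keyset (layer ident port b0 r L T (grp x) (start x) p.2 p.1) ident b0 r (start x p.2) L v|
    <= T]%N.

(** Redrawing the [j]-th shifts of all nodes changes neither the groups nor the subgraph on which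
    forest [j] is built, so [pr_keyset] applies to a fixed graph. *)
Lemma pr_bad_keys p :
  pr R (bad_keys p) <= #|V|%:R * (2 / 2 ^+ L) + #|V|%:R * L.+1%:R * (3 / 4) ^+ T.
Proof.
case: p => i j; apply: (@pr_resample R _ _ (set_coin j) (get_coin j)).
- by apply/card_gt0P; exists ([ffun => enc ([ffun => Ordinal g_gt0],
  [ffun => Ordinal two_gt0])] : tapes).
- by apply/card_gt0P; exists [ffun => Ordinal two_gt0].
- move=> x y; apply/ffunP => v; rewrite ffunE -[RHS]decK; congr enc.
  rewrite [RHS]surjective_pairing; congr pair; first by rewrite ffunE encK.
  apply/ffunP => j'; rewrite ffunE; case: eqP => [->|/eqP ne]; first by rewrite ffunE.
  by rewrite ffunE encK ffunE (negbTE ne).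
- by move=> x y; apply/ffunP => v; rewrite !ffunE encK ffunE eqxx.
- move=> x; have ls := layer_sym ident b0 r L T portP (start x) (grpC x) j i.
  apply: le_trans (pr_keyset R (nb := layer ident port b0 r L T (grp x) (start x) j i) r _
    ident_inj ident_lt L T).
    apply: pr_sub => y; rewrite /bad_keys /= grp_set_coin start_set_coin_same.
    by rewrite /layer (eq_alive ident port b0 r L T (grp x) (start' := start x)) // => j' jj;
      apply: start_set_coin.
  exact: ls.
Qed.

End Tapes.

Lemma minn_sum_le (I : finType) K (a : I -> nat) :
  (minn K (\sum_i a i) <= \sum_i minn K (a i))%N.
Proof. by elim/big_rec2: _ => [|i x y _ IH]; lia. Qed.

(** * Union bound over the failures *)

Section Uncertified.
Variables (s b0 g K L : nat).
Local Notation Omega := ({ffun 'I_(2 ^ b0) -> 'I_g} * {ffun 'I_K -> 'I_(2 ^ L)})%type.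
Variables (dec : s.-tuple bool -> Omega) (enc : Omega -> s.-tuple bool).
Hypothesis encK : cancel enc dec.
Hypothesis decK : cancel dec enc.
Variables (R : realType) (V : finType) (E : {set {set V}}) (ident : V -> nat) (port : V -> seq
  V).
Variables (r T k m : nat).
Hypothesis sE : simple_graph E.
Hypothesis portP : port_numbering E port.
Hypothesis ident_inj : injective ident.
Hypothesis ident_lt : forall v, (ident v < 2 ^ b0)%N.
Hypothesis g_gt0 : (0 < g)%N.
Hypothesis m_gt0 : (0 < m)%N.
Hypothesis k_gt0 : (0 < k)%N.
Hypothesis kK : (k <= g * K)%N.
Hypothesis Kk : ((3 * m + 1) * k < K.+1 * (3 * m * g))%N.
Local Notation tapes := {ffun V -> s.-tuple bool}.

Definition peel (x : tapes) :=
  peeled E ident port b0 r L T (grp dec ident x) (start dec x) K.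
Let th : R := 1 / (12 * m%:R).
Variable t : R.
Hypothesis t_ge0 : 0 <= t.
Hypothesis tE : (1 < g)%N ->
  t = (2 * #|V|.+1)%:R ^+ 2 * expR (- (th ^+ 2 / (8 * g%:R) * k%:R / 2)) /\ t <= 1 / 2.

Let z : {ffun {set V} -> 'I_g} := [ffun => Ordinal g_gt0].
Let col (x : tapes) := color dec E ident_lt x z.
Let Dev (y : {ffun {set V} -> 'I_g}) :=
  [exists (p : {set V} * 'I_g | nontrivial p.1), deviates E th p.1 p.2 y].
Let BK (x : tapes) := [exists (p : 'I_g * 'I_K | true), bad_keys dec ident port r T p x].

Lemma certified (x : tapes) : ~~ BK x ->
  ((1 < g)%N -> edge_connected k E -> ~~ Dev (col x)) ->
  connectivity_certificate k E (peel x).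
Proof.
move=> nBK nD; apply: (@peeled_certificate _ _ _ _ _ _ _ _ _ _ sE portP ident_inj ident_lt
   _ _ (grpC dec sE portP ident_inj x) _ _ (col x)).
- by move=> j v; apply: coin_le.
- move=> j i v jK ig; apply: contraNT nBK => h; apply/existsP; exists (Ordinal ig, Ordinal jK).
  by rewrite /= /bad_keys negb_forall; apply/existsP; exists v.
- by move=> v w wv; apply: color_grp.
move=> conn S nS; have kS := edge_connected_cut conn nS.
have [g1|g1] := ltnP 1 g; last first.
  (* A single group calls for no concentration, as then [K >= k]. *)
  apply: leq_trans (minn_sum_le _ _); rewrite sum_part leq_min kS andbT.
  by apply: leq_trans kK _; rewrite -[X in (_ <= X)%N]mul1n leq_mul2r g1 orbT.
apply: (@split_good R _ _ _ _ m) => // i.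
have := nD g1 conn; apply: contra => h; apply/existsP; exists (S, i).
by rewrite /= nS.
Qed.

Lemma pr_BK : pr R BK <=
  g%:R * K%:R * (#|V|%:R * (2 / 2 ^+ L) + #|V|%:R * L.+1%:R * (3 / 4) ^+ T).
Proof.
apply: le_trans (pr_sum _ _ (fun p => bad_keys dec ident port r T p)) _.
apply: (@le_trans _ _ (\sum_(p : 'I_g * 'I_K)
   (#|V|%:R * (2 / 2 ^+ L) + #|V|%:R * L.+1%:R * (3 / 4) ^+ T))).
  by apply: ler_sum => p _; apply: (pr_bad_keys encK decK _ _ _ sE portP).
by rewrite sumr_const card_prod !card_ord -[X in X <= _]mulr_natl natrM lexx.
Qed.

Lemma pr_uncertified :
  pr R (fun x => ~~ connectivity_certificate k E (peel x)) <= g%:R * (4 * t) +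
  g%:R * K%:R * (#|V|%:R * (2 / 2 ^+ L) + #|V|%:R * L.+1%:R * (3 / 4) ^+ T).
Proof.
have [/andP[g1 conn]|no] := boolP ((1 < g)%N && edge_connected k E); last first.
  apply: (@le_trans _ _ (pr R BK)).
    apply: pr_sub => x; apply: contraR => nBK; apply: certified => // g1 conn.
    by rewrite g1 conn in no.
  by apply: le_trans pr_BK _; rewrite ler_wpDl // !mulr_ge0.
apply: (@le_trans _ _ (pr R (predU (fun x => Dev (col x)) BK))).
  apply: pr_sub => x; apply: contraR; rewrite negb_or => /andP[nD nBK].
  exact: certified.
apply: le_trans (pr_or _ _ _) _; apply: lerD pr_BK.
have [te t2] := tE g1; apply: (@pr_recolor _ _ _ _ _ dec enc encK decK) => //.
  move=> y y' e; apply: eq_existsb => p; congr andb; rewrite /deviates.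
  rewrite (_ : part E y p.2 = part E y' p.2) //; apply/setP => a; rewrite !inE.
  by case: (boolP (a \in E)) => // /e->.
apply: (pr_split sE k_gt0 g_gt0 _ _ te t2).
  by move=> S nS; apply: edge_connected_cut conn nS.
have m1 : 1 <= m%:R :> R by rewrite ler1n.
by rewrite /th divr_ge0 ?mulr_ge0 //= ler_pdivrMr; lra.
Qed.

End Uncertified.

Local Open Scope nat_scope.

(** * The algorithm *)

Section Algorithm.
Variables (c s n b q : nat) (gcoin : s.-tuple bool -> nat -> nat) (coin : nat -> s.-tuple bool
  -> nat).
Variables (r L T : nat).
Hypothesis q_b : 3 * q <= b.
Hypothesis gcoin_lt : forall w a, gcoin w a < 2 ^ q.
Hypothesis L_q : L < 2 ^ q.
Hypothesis M_q : (2 ^ (c * ceil_log2 n)) ^ 3 < 2 ^ q.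
Local Notation b0 := (c * ceil_log2 n).

Definition alive_in (N : network c s n) j : nat -> rel (node N) :=
  alive (@ident _ _ _ N) (@port _ _ _ N) b0 r L T (group gcoin (N := N)) (fun j v => coin j
    (tape N v)) j.

Lemma pcomp_alive j : pcomp b gcoin (2 + j * forest_rounds c n r L T)
  (fun N i v => [seq ident w | w <- nbr gcoin (fun N => @alive_in N j) i v]).
Proof.
have M1 : 2 ^ b0 <= 2 ^ q.
  apply: ltnW; apply: leq_ltn_trans M_q; rewrite -[X in X <= _]expn1.
  by rewrite leq_pexp2l // expn_gt0.
elim: j => [|j IHj].
  have := pcomp_map (fun _ _ i x => [seq p.1 | p <- x.2 & p.2 == i]) (pcomp_base q_b gcoin_lt
    M1).
  rewrite mul0n addn0; apply: pcomp_ext => N i v; rewrite /nbr /base /= filter_map -map_comp.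
  by congr map; apply: eq_filter => w /=; rewrite andbT.
have := pcomp_forest q_b M_q r T (coin j) L_q IHj.
by rewrite mulSn addnA addnAC.
Qed.

Definition view_algorithm t (f : history s b -> nat -> {bseq b of bool})
    (out : history s b -> nat -> bool) : congest_algorithm b :=
  CongestAlgorithm t (fun i d w => (i, d, w, [::])) f
    (fun h ms => (h.1, rcons h.2 ms)) out.

Lemma run_view t f out (N : network c s n) t' (v : node N) :
  run (A := view_algorithm t f out) (@ident _ _ _ N) (@port _ _ _ N) (tape N) t' v = view f t'
    v.
Proof.
elim: t' v => // t' IHt v; rewrite [LHS]/= IHt; congr (_, rcons _ _).
by apply: eq_map => w; rewrite IHt.
Qed.

Definition peeled_in (N : network c s n) j : {set {set node N}} :=
  peeled (link N) (@ident _ _ _ N) (@port _ _ _ N) b0 r L T (group gcoin (N := N))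
    (fun j v => coin j (tape N v)) j.

Lemma algorithm_outputs j : exists f out, forall N : network c s n,
  outputs (A := view_algorithm (2 + j * forest_rounds c n r L T) f out)
    (@ident _ _ _ N) (@port _ _ _ N) (tape N) (peeled_in N j).
Proof.
have [f [phi e]] := pcomp_alive j.
pose out h p := let x := phi h in let y := nth (0, 0) x.1.2 p in y.1 \notin x.2 y.2.
exists f, out => N; apply/forallP => v; apply/forall_inP => w wv.
rewrite run_view /= /out e /= (nth_map v) ?index_mem // nth_index //=.
rewrite (mem_map (ident_inj N)).
rewrite mem_filter eqxx wv andbT /= /peeled_in in_peeled //.
- exact: (link_simple N).
- exact: (portP N).
- by move=> x y yx; apply: groupC; apply: port_neq.
Qed.

End Algorithm.

Lemma card_bij (S S' : finType) : #|S| = #|S'| ->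
  exists (f : S -> S') (h : S' -> S), cancel f h /\ cancel h f.
Proof.
move=> e; exists (fun x => enum_val (cast_ord e (enum_rank x))),
  (fun y => enum_val (cast_ord (esym e) (enum_rank y))); split=> x.
  by rewrite enum_valK cast_ordK enum_rankK.
by rewrite enum_valK cast_ordKV enum_rankK.
Qed.

(** A vertex of a simple graph has fewer than [#|V|] edges. So for [1 < n <= k] the empty subgraph
    is a certificate, and [k < n] may be assumed elsewhere. *)
Lemma not_edge_connected (V : finType) (E : {set {set V}}) k :
  simple_graph E -> 1 < #|V| <= k -> ~~ edge_connected k E.
Proof.
move=> sE /andP[V1 Vk]; apply/negP => conn.
have [u _] : exists u : V, u \in V by apply/card_gt0P/ltnW.
have nt : nontrivial [set u].
  apply/andP; split; first by apply/set0Pn; exists u; rewrite inE.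
  by apply/eqP => /(congr1 (fun A : {set V} => #|A|)); rewrite cards1 cardsT => e;
    rewrite -e in V1.
have := edge_connected_cut conn nt.
have : cut E [set u] \subset [set [set u; v] | v in [set~ u]].
  apply/subsetP => e; rewrite inE => /andP[eE]; have [x [y [xy ->]]] := simple_pair sE eE.
  rewrite crosses2 !inE => ne; apply/imsetP; case: (eqVneq x u) ne => [xu|xu] ne.
    by exists y; rewrite ?xu // !inE; move: ne; case: (y == u).
  have yu : y = u by apply/eqP; move: ne; case: (y == u).
  by exists x; rewrite ?yu 1?setUC // !inE.
move=> /subset_leq_card /leq_trans/(_ (leq_imset_card _ _)).
by rewrite cardsC1; lia.
Qed.

Definition idle b : congest_algorithm b :=
  @CongestAlgorithm b unit 0 0 (fun _ _ _ => tt) (fun _ _ => [bseq]) (fun x _ => x) (fun _ _ =>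
    false).

Lemma idle_computes (R : realType) b (V : finType) (E : {set {set V}})
    (ident : V -> nat) (port : V -> seq V) k (eps : R) r :
  (0 <= eps)%R -> simple_graph E -> (#|V| <= 1) || (#|V| <= k) ->
  computes_certificate (A := idle b) E ident port k eps r.
Proof.
move=> eps0 sE Vk; apply/existsP; exists set0; apply/and3P; split.
- by apply/forallP => v; apply/forall_inP => w _; rewrite inE.
- rewrite /connectivity_certificate sub0set /=.
  have s0 : simple_graph (set0 : {set {set V}}) by apply/forall_inP => e; rewrite inE.
  have [V1|V1] := leqP #|V| 1.
    have all_eq (u v : V) : u = v by apply: (card_le1_eqP V1).
    have H F : edge_connected k (F : {set {set V}}).
      apply/forallP => F'; apply/implyP => _; apply/forallP => u; apply/forallP => v.
      by rewrite (all_eq u v) connect0.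
    by rewrite !H.
  have Vk' : 1 < #|V| <= k by rewrite V1; move: Vk; rewrite leqNgt V1.
  by rewrite (negbTE (not_edge_connected s0 Vk')) (negbTE (not_edge_connected sE Vk')).
- by rewrite cards0 mulr_ge0 ?mulr_ge0 // addr_ge0.
Qed.

Local Open Scope ring_scope.

(** * Choice of the parameters *)

(** Here [X = 2 ^ l >= n]. The splitting contributes [64 * X^-1 ^+ (d + 9)], at most 1/8 of
    [X^-1 ^+ d]; the keys contribute [6 * X^-1 ^+ (d + 3)], at most 6/8 of it. This dictates the
    exponents [d + 12] and [d + 5]. *)
Lemma failure_bound (R : realType) (X N G GK L1 p2 pT t : R) d :
  2 <= X -> 0 <= N <= X -> 0 <= G <= X -> 0 <= GK <= 2 * X -> 0 <= L1 <= X ^+ (d + 5) ->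
  p2 = X^-1 ^+ (d + 5) -> 0 <= pT <= X^-1 ^+ (2 * (d + 5)) ->
  0 <= t <= 16 * X ^+ 2 * X^-1 ^+ (d + 12) ->
  G * (4 * t) + GK * (N * (2 * p2) + N * L1 * pT) <= X^-1 ^+ d.
Proof.
move=> X2 /andP[N0 NX] /andP[G0 GX] /andP[K0 KX] /andP[L0 LX] p2E /andP[p0 pX] /andP[t0 tX].
have X0 : 0 < X by lra.
set y := X^-1 in p2E pX tX *; have yX : y * X = 1 by rewrite mulVf // gt_eqF.
have y0 : 0 < y by rewrite invr_gt0.
have y2 : y <= 1 / 2 by rewrite -(ler_pM2r X0) yX; lra.
have yd0 : 0 <= y ^+ d by rewrite exprn_ge0 // ltW.
have yn a e : y ^+ (a + e) * X ^+ a = y ^+ e.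
  by rewrite exprD mulrAC -exprMn yX expr1n mul1r.
have e3 : y ^+ 3 <= 1 / 8.
  by apply: le_trans (_ : (1 / 2) ^+ 3 <= _); [apply: lerXn2r; rewrite ?nnegrE;
    lra|rewrite !exprS expr0; lra].
have h1 : G * (4 * t) <= 1 / 8 * y ^+ d.
  apply: (@le_trans _ _ (X * (4 * (16 * X ^+ 2 * y ^+ (d + 12))))).
    by apply: ler_pM => //; [lra|apply: ler_wpM2l].
  have -> : X * (4 * (16 * X ^+ 2 * y ^+ (d + 12))) = 64 * (y ^+ (3 + (9 + d)) * X ^+ 3).
    have e12 : (d + 12 = 3 + (9 + d))%N by clear; lia.
    by rewrite e12; move: (y ^+ (3 + (9 + d))) => w; ring.
  rewrite yn exprD mulrA; apply: ler_wpM2r => //.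
  have -> : y ^+ 9 = (y ^+ 3) ^+ 3 by rewrite -exprM.
  have e30 : 0 <= y ^+ 3 by rewrite exprn_ge0 // ltW.
  have e33 : (y ^+ 3) ^+ 3 <= (1 / 8) ^+ 3 by apply: lerXn2r; rewrite ?nnegrE; lra.
  by move: e33; rewrite (_ : (1 / 8) ^+ 3 = 1 / 512 :> R) ?exprS ?expr0; lra.
have h2 : N * (2 * p2) + N * L1 * pT <= X * (3 * y ^+ (d + 5)).
  have -> : X * (3 * y ^+ (d + 5)) = X * (2 * y ^+ (d + 5)) + X * (X ^+ (d + 5) * y ^+ (2 * (d
    + 5))).
    by rewrite [X ^+ _ * _]mulrC mul2n -addnn yn; move: (y ^+ _) => w; ring.
  apply: lerD; first by rewrite p2E; apply: ler_wpM2r => //; rewrite mulr_ge0 ?exprn_ge0 // ltW.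
  by rewrite -mulrA; apply: ler_pM => //; [rewrite mulr_ge0|apply: ler_pM].
have h3 : GK * (N * (2 * p2) + N * L1 * pT) <= 6 / 8 * y ^+ d.
  apply: (@le_trans _ _ (2 * X * (X * (3 * y ^+ (d + 5))))).
    apply: ler_pM => //; rewrite addr_ge0 ?mulr_ge0 // p2E exprn_ge0 // ltW //.
  have -> : 2 * X * (X * (3 * y ^+ (d + 5))) = 6 * (y ^+ (2 + (3 + d)) * X ^+ 2).
    have e5 : (d + 5 = 2 + (3 + d))%N by clear; lia.
    by rewrite e5; move: (y ^+ (2 + (3 + d))) => w; ring.
  rewrite yn exprD mulrA; apply: ler_wpM2r => //; lra.
lra.
Qed.

(* The left-hand side is [2 + K * forest_rounds], in expanded form. *)
Lemma rounds_bound c l m lam tau C0 K r T L : (0 < l)%N -> (0 < m)%N ->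
  (K <= 3 * (C0 * l * m ^ 2))%N -> T = (3 * tau * l)%N -> r = (3 * m * T)%N -> L = (lam * l)%N
    ->
  (2 + K * ((c * l) * r.*2 + r.*2 * (c * l) + (L.+1 * (r.*2 * (c * l)).*2.+1 + T * (r.*2 * (c *
    l)).*2.+1) + T.+1)
   <= (2 + 3 * C0 * (2 * (18 * tau * c) + (lam + 1 + 3 * tau) * (2 * (18 * tau * c) + 1) + 3 *
     tau + 1))
       * (m ^ 3 * l ^ 4))%N.
Proof.
move=> l0 m0 Kle -> -> ->.
set D := ((3 * m * (3 * tau * l)).*2 * (c * l))%N.
have De : D = (18 * tau * c * (m * l ^ 2))%N by rewrite /D; lia.
rewrite [(c * l * _)%N]mulnC -/D De; set D0 := (18 * tau * c)%N.
set u := (m * l ^ 2)%N; have u0 : (0 < u)%N by rewrite muln_gt0 m0 expn_gt0 l0.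
have ml : (m * l ^ 3 = u * l)%N by rewrite /u; lia.
set F0 := (2 * D0 + (lam + 1 + 3 * tau) * (2 * D0 + 1) + 3 * tau + 1)%N.
have F : (D0 * u + D0 * u + ((lam * l).+1 * (D0 * u).*2.+1 + 3 * tau * l * (D0 * u).*2.+1) + (3
  * tau * l).+1 <= F0 * (m * l ^ 3))%N.
  rewrite ml.
  have a1 : ((D0 * u).*2.+1 <= (2 * D0 + 1) * u)%N by nia.
  have a2 : ((lam * l).+1 + 3 * tau * l <= (lam + 1 + 3 * tau) * l)%N by nia.
  have a3 := leq_mul a2 a1; rewrite mulnDl in a3.
  have a4 : (u <= u * l)%N by rewrite leq_pmulr.
  have a5 : (l <= u * l)%N by rewrite leq_pmull.
  have a6 : (D0 * u + D0 * u <= 2 * D0 * (u * l))%N by nia.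
  have a7 : ((3 * tau * l).+1 <= (3 * tau + 1) * (u * l))%N by nia.
  have a8 : ((lam + 1 + 3 * tau) * l * ((2 * D0 + 1) * u) = (lam + 1 + 3 * tau) * (2 * D0 + 1)
    * (u * l))%N by lia.
  rewrite a8 in a3; rewrite /F0 !mulnDl; lia.
have KF := leq_mul Kle F; apply: (@leq_trans (2 + 3 * (C0 * l * m ^ 2) * (F0 * (m * l ^ 3)))%N).
  by rewrite leq_add2l.
have -> : (3 * (C0 * l * m ^ 2) * (F0 * (m * l ^ 3)) = 3 * C0 * F0 * (m ^ 3 * l ^ 4))%N by lia.
by rewrite [X in (_ <= X)%N]mulnDl leq_add2r leq_pmulr // muln_gt0 !expn_gt0 m0 l0.
Qed.

(** Two factors [1 + 1 / (3 * m)]: one bounds [(r.+1 + T) / r.+1], the other [g * K / k]. *)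
Lemma forests_size_bound H gK n k m r T K g : gK = (g * K)%N ->
  (H * r.+1 <= gK * (n * (r.+1 + T)))%N -> (3 * m * T <= r)%N ->
  (K * (3 * m * g) <= (3 * m + 1) * k)%N ->
  (H * (3 * m) ^ 2 <= k * n * (3 * m + 1) ^ 2)%N.
Proof.
move=> gKE h1 Tr h2; set v := (3 * m)%N in h2 Tr *.
have h3 : ((r.+1 + T) * v <= (v + 1) * r.+1)%N by nia.
have h4 : (H * v <= gK * (n * (v + 1)))%N.
  rewrite -(leq_pmul2r (ltn0Sn r)) mulnAC; apply: leq_trans (leq_mul h1 (leqnn v)) _.
  by rewrite -!mulnA !leq_mul2l h3 !orbT.
rewrite expnS expn1 mulnA; apply: leq_trans (leq_mul h4 (leqnn v)) _.
have -> : (gK * (n * (v + 1)) * v = K * (v * g) * (n * (v + 1)))%N by rewrite gKE; ring.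
apply: leq_trans (leq_mul h2 (leqnn _)) _.
by rewrite [X in (_ <= X)%N](_ : _ = ((v + 1) * k * (n * (v + 1)))%N) // expnS expn1; ring.
Qed.

Section Main.
Variables (R : realType) (c d : nat).
(* [2 ^ - L = 2 ^ (- l * lam)] bounds the probability that a given cluster starts
   too early, [(3 / 4) ^ T <= 2 ^ (- l * tau)] that it has too many keys, and
   [2 ^ (- l * C1)] that the splitting of a given cut deviates by more than a
   factor [1 +- 1 / (12 * m)], where [48 * 48 = 8 * 2 * 12 ^ 2]. *)
Let lam := (d + 5)%N.
Let tau := (2 * lam)%N.
Let C1 := (d + 12)%N.
Let C0 := (48 * 48 * C1)%N.

(** A message consists of three numbers. An edge code takes [3 * c * l] bits, and [d + 6] makes room
    for [L] and [g]. *)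
Definition msg_factor := (3 * (3 * c + d + 6))%N.
Definition round_factor :=
  (2 + 3 * C0 * (2 * (18 * tau * c) + (lam + 1 + 3 * tau) * (2 * (18 * tau * c) + 1) + 3 * tau
    + 1))%N.

Section Fixed.
Variables (n k m : nat).
Hypothesis n_gt1 : (1 < n)%N.
Hypothesis k_gt0 : (0 < k)%N.
Hypothesis k_lt : (k < n)%N.
Hypothesis m_gt0 : (0 < m)%N.
Local Notation l := (ceil_log2 n).
Let b0 := (c * l)%N.
Let kap := (C0 * l * m ^ 2)%N.
Let h := trunc_log 2 (k %/ kap).
Let g := (2 ^ h)%N.
Let K := ((3 * m + 1) * k %/ (3 * m * g))%N.
Let L := (lam * l)%N.
Let T := (3 * tau * l)%N.
Let r := (3 * m * T)%N.
Let q := ((3 * c + d + 6) * l)%N.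

Lemma l_gt0 : (0 < l)%N. Proof. by rewrite up_log_gt0. Qed.
Lemma n_le : (n <= 2 ^ l)%N. Proof. exact: up_logP. Qed.
Let kap_gt0 : (0 < kap)%N. Proof. by rewrite /kap !muln_gt0 ?expn_gt0 ?m_gt0 l_gt0 /C1 addn_gt0
  orbT. Qed.
Let g_gt0 : (0 < g)%N. Proof. by rewrite expn_gt0. Qed.

Let g_big : (1 < g)%N -> (g * kap <= k)%N.
Proof.
rewrite /g -{1}(expn0 2) ltn_exp2l // => h0.
have k1 : (0 < k %/ kap)%N by move: h0; rewrite /h; case: (k %/ kap)%N.
by rewrite -leq_divRL // trunc_logP.
Qed.

Let g_le : (g <= k)%N.
Proof.
have [/g_big|g1] := ltnP 1 g; last exact: leq_trans g1 k_gt0.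
by apply: leq_trans; rewrite leq_pmulr.
Qed.

Let k_small : (k < 2 * g * kap)%N.
Proof.
rewrite /g -expnS; have := trunc_log_ltn (k %/ kap) (ltnSn 1); rewrite -/h.
by rewrite ltn_divLR.
Qed.

Let mg_gt0 : (0 < 3 * m * g)%N. Proof. by rewrite !muln_gt0 m_gt0 g_gt0. Qed.

Let Kk : ((3 * m + 1) * k < K.+1 * (3 * m * g))%N.
Proof. exact: ltn_ceil. Qed.

Let K_le : (K * (3 * m * g) <= (3 * m + 1) * k)%N.
Proof. exact: leq_trunc_div. Qed.

Let kK : (k <= g * K)%N.
Proof.
have m3 : (0 < 3 * m)%N by rewrite muln_gt0.
have [g1|g1] := ltnP 1 g.
  have gk := g_big g1; have m3k : (3 * m <= kap)%N.
    have C0_ge : (3 <= C0 * l)%N.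
      by rewrite (@leq_trans (48 * 48)%N) // /C0 -mulnA leq_pmulr // muln_gt0 l_gt0 /C1
        addn_gt0 orbT.
    by apply: leq_mul => //; rewrite expnS expn1 leq_pmulr.
  have h1 : (3 * m * g <= k)%N by apply: leq_trans gk; rewrite mulnC leq_mul2l m3k orbT.
  rewrite -(leq_pmul2l m3); move: Kk; rewrite mulnDl mul1n [(K.+1 * _)%N]mulSn.
  have -> : (K * (3 * m * g) = 3 * m * (g * K))%N by lia.
  by clear -h1; lia.
have g1' : g = 1%N by apply/eqP; rewrite eqn_leq g1 g_gt0.
move: Kk; rewrite g1' muln1 mul1n => lt; rewrite -ltnS -(ltn_pmul2r m3).
by apply: leq_ltn_trans lt; rewrite mulnDl mulnC leq_addr.
Qed.

(** By the maximality of [h], [k / g < 2 * kap]; this frees the number of successive forests from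
    [k]. *)
Let K_small : (K <= 3 * kap)%N.
Proof.
have h1 : (K * (3 * m * g) <= 4 * m * k)%N by apply: leq_trans K_le _; rewrite leq_mul2r;
  apply/orP; right; lia.
have h2 : (3 * K * g <= 4 * k)%N by rewrite -(leq_pmul2l m_gt0); lia.
have h3 : (3 * K * g < 8 * kap * g)%N by apply: leq_ltn_trans h2 _; have := k_small; lia.
have : (3 * K < 8 * kap)%N by move: h3; rewrite ltn_mul2r => /andP[].
by clear; lia.
Qed.

Let gK_le : (g * K <= 2 * k)%N.
Proof.
have h1 : (K * (3 * m * g) <= 4 * m * k)%N by apply: leq_trans K_le _; rewrite leq_mul2r;
  apply/orP; right; lia.
have h2 : (3 * (g * K) <= 4 * k)%N by rewrite -(leq_pmul2l m_gt0); lia.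
by clear -h2; lia.
Qed.

Let q_b : (3 * q <= msg_factor * l)%N.
Proof. by rewrite /q /msg_factor mulnA. Qed.

Let pow_le a b : (a <= b)%N -> (2 ^ (a * l) <= 2 ^ (b * l))%N.
Proof. by move=> ab; rewrite leq_pexp2l // leq_mul2r ab orbT. Qed.

Let M_q : ((2 ^ b0) ^ 3 < 2 ^ q)%N.
Proof.
rewrite -expnM ltn_exp2l // /b0 /q mulnAC ltn_mul2r l_gt0; lia.
Qed.

Let L_q : (L < 2 ^ q)%N.
Proof.
apply: (@leq_trans (2 ^ (lam * l))); first exact: ltn_expl.
by rewrite /q; apply: pow_le; rewrite /lam; lia.
Qed.

Let g_q : (g < 2 ^ q)%N.
Proof.
apply: leq_ltn_trans g_le _; apply: leq_trans k_lt _; apply: leq_trans n_le _.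
by rewrite -{1}[l]mul1n; apply: pow_le; lia.
Qed.

Variable eps : R.
Hypothesis eps_m : 1 / m%:R <= eps.

Let X : R := 2 ^+ l.
Let X2 : 2 <= X.
Proof. by rewrite -[X in X <= _]expr1 ler_weXn2l ?l_gt0 // ler1n. Qed.
Let nX : n%:R <= X.
Proof. by rewrite /X -natrX ler_nat n_le. Qed.

Let beta_le : (1 < g)%N ->
  expR (- ((1 / (12 * m%:R)) ^+ 2 / (8 * g%:R) * k%:R / 2)) <= X^-1 ^+ C1 :> R.
Proof.
move=> /g_big gk.
have gR : 0 < g%:R :> R by rewrite ltr0n.
have mR : 0 < m%:R :> R by rewrite ltr0n.
have e1 : expR (- (C1 * l)%:R) <= X^-1 ^+ C1 :> R.
  rewrite -[- _]mulrN1 expRM_natl /X -exprVn -exprM [(l * C1)%N]mulnC.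
  apply: lerXn2r; rewrite ?nnegrE ?invr_ge0 ?expR_ge0 // expRN.
  by rewrite lef_pV2 ?posrE ?expR_gt0 //; have := expR_ge1Dx (1 : R); lra.
apply: le_trans e1; rewrite ler_expR lerN2.
have -> : (1 / (12 * m%:R)) ^+ 2 / (8 * g%:R) * k%:R / 2 = k%:R / (48 * 48 * m%:R ^+ 2 * g%:R)
  :> R.
  by field; rewrite !gt_eqF.
rewrite ler_pdivlMr ?mulr_gt0 ?exprn_gt0 //.
have -> : (C1 * l)%:R * (48 * 48 * m%:R ^+ 2 * g%:R) = (g * kap)%:R :> R.
  by rewrite /kap /C0 !natrM natrX; ring.
by rewrite ler_nat.
Qed.

Lemma certificate_algorithm : exists A : congest_algorithm (msg_factor * l),
  (rounds A <= round_factor * (m ^ 3 * l ^ 4))%N /\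
  forall (V : finType) (E : {set {set V}}) (ident : V -> nat) (port : V -> seq V),
    #|V| = n -> simple_graph E -> injective ident ->
    (forall v, (ident v < 2 ^ (c * l))%N) -> port_numbering E port ->
    1 - (n%:R ^+ d)^-1 <= Pr_tapes R (computes_certificate (A := A) E ident port k eps).
Proof.
(* As [g] and [2 ^ L] are powers of two, [s] fair bits encode the coins of a node bijectively, and
   uniformity is exact. *)
pose s := (h * 2 ^ b0 + L * K)%N.
have cardO : #|{: s.-tuple bool}| = #|{: {ffun 'I_(2 ^ b0) -> 'I_g} * {ffun 'I_K -> 'I_(2 ^
  L)}}|.
  by rewrite card_tuple card_bool card_prod !card_ffun !card_ord -!expnM -expnD.
have [dec [enc [decK encK]]] := card_bij cardO.
have gcoin_lt w a : (gcoin dec w a < 2 ^ q)%N.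
  rewrite /gcoin; case: insubP => [a' _ _|_]; last by rewrite expn_gt0.
  by apply: ltn_trans (ltn_ord _) g_q.
have [f [out outP]] := @algorithm_outputs c s n _ q (gcoin dec) (coin dec) r L T q_b gcoin_lt
  L_q M_q K.
set A := view_algorithm _ _ _ in outP; exists A; split.
  by apply: rounds_bound => //; exact: l_gt0.
move=> V E ident port Vn sE ident_inj ident_lt portP.
pose ok (x : {ffun V -> s.-tuple bool}) :=
  connectivity_certificate k E (peel dec E ident port r T x).
have okP x : ok x -> computes_certificate (A := A) E ident port k eps x.
  move=> okx; apply/existsP; exists (peel dec E ident port r T x); apply/and3P; split=> //.
    exact: (outP (@Network c s n V E ident port x Vn sE ident_inj ident_lt portP)).
  (* The case [c = 0] is excluded by two distinct identifiers; [b0 > 0] ensures that the label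
     radius is at least [r]. *)
  have b00 : (0 < b0)%N.
    rewrite lt0n; apply/eqP => b0E; move: n_gt1; rewrite -Vn => /card_gt1P[u [v [_ _ /eqP[]]]].
    apply: ident_inj; have := ident_lt v; have := ident_lt u.
    by rewrite -/b0 b0E expn0 !ltnS !leqn0 => /eqP-> /eqP->.
  have := card_peeled r L T K sE portP ident_inj ident_lt (start dec x)
    (grpC dec sE portP ident_inj x) (grp_lt dec ident_lt x) b00.
  rewrite -/(peel dec E ident port r T x) Vn => le.
  have mR : 1 <= m%:R :> R by rewrite ler1n.
  set H := #|peel dec E ident port r T x| in le *.
  have le2 := forests_size_bound (erefl _) le (leqnn _) K_le.
  have {}le2 : H%:R * (3 * m%:R) ^+ 2 <= k%:R * n%:R * (3 * m%:R + 1) ^+ 2 :> R.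
    rewrite (_ : _ * _ ^+ 2 = (H * (3 * m) ^ 2)%:R); last by rewrite natrM natrX natrM.
    rewrite [leRHS](_ : _ = (k * n * (3 * m + 1) ^ 2)%:R) ?ler_nat //.
    by rewrite natrM natrX natrD !natrM.
  have m9 : 0 < (3 * m%:R) ^+ 2 :> R by rewrite exprn_gt0 // mulr_gt0 //; lra.
  rewrite -(ler_pM2r m9); apply: le_trans le2 _; rewrite -!mulrA !ler_wpM2l //.
  have e1 : (3 * m%:R + 1) ^+ 2 <= (1 + 1 / m%:R) * (3 * m%:R) ^+ 2 :> R.
    have -> : (1 + 1 / m%:R) * (3 * m%:R) ^+ 2 = 9 * m%:R ^+ 2 + 9 * m%:R :> R.
      by field; rewrite gt_eqF //; lra.
    by rewrite (_ : (3 * m%:R + 1) ^+ 2 = 9 * m%:R ^+ 2 + 6 * m%:R + 1 :> R); [lra|ring].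
  by apply: le_trans e1 _; apply: ler_wpM2r; [exact: ltW|rewrite lerD2l].
apply: (@le_trans _ _ (pr R ok)); last by apply: pr_sub.
rewrite (pr_compl R); last first.
  by apply/card_gt0P; exists [ffun => [tuple of nseq s false]].
rewrite lerD2l lerN2.
pose t : R := if (1 < g)%N then (2 * #|V|.+1)%:R ^+ 2 *
  expR (- ((1 / (12 * m%:R)) ^+ 2 / (8 * g%:R) * k%:R / 2)) else 0.
have t0 : 0 <= t by rewrite /t; case: ifP => // _; rewrite mulr_ge0 ?exprn_ge0 ?expR_ge0.
have y0 : 0 < X^-1 by rewrite invr_gt0; apply: lt_le_trans X2.
have y2 : X^-1 <= 1 / 2 by rewrite -div1r ler_pdivrMr; have := X2; lra.
have tX : t <= 16 * X ^+ 2 * X^-1 ^+ C1.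
  rewrite /t; case: ifP => [g1|_]; last by rewrite !mulr_ge0 ?exprn_ge0 ?invr_ge0 //;
    have := X2; lra.
  apply: ler_pM; rewrite ?exprn_ge0 ?expR_ge0 ?beta_le //.
  have -> : 16 * X ^+ 2 = (4 * X) ^+ 2 by rewrite exprMn; ring.
  apply: lerXn2r; rewrite ?nnegrE //; first by have := X2; lra.
  have : (2 * #|V|.+1 <= 4 * n)%N by rewrite Vn; move: n_gt1; clear; lia.
  by rewrite -(ler_nat R) [(4 * n)%:R]natrM; have := nX; lra.
have t2 : t <= 1 / 2.
  apply: le_trans tX _; have -> : 16 * X ^+ 2 * X^-1 ^+ C1 = 16 * X^-1 ^+ (10 + d).
    have -> : (C1 = 2 + (10 + d))%N by rewrite /C1; clear; lia.
    rewrite exprD mulrA -[16 * X ^+ 2 * _]mulrA -exprMn mulfV ?expr1n ?mulr1 // gt_eqF //.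
    by apply: lt_le_trans X2.
  have e1 : X^-1 ^+ (10 + d) <= (1 / 2) ^+ 5.
    have y1 : X^-1 <= 1 by apply: le_trans y2 _; lra.
    apply: (@le_trans _ _ (X^-1 ^+ 5)); first by apply: ler_wiXn2l => //; exact: ltW.
    by apply: lerXn2r y2; rewrite nnegrE; [exact: ltW|lra].
  by apply: le_trans (_ : 16 * (1 / 2) ^+ 5 <= _); [rewrite ler_wpM2l|rewrite !exprS expr0;
    lra].
apply: le_trans (_ : pr R (fun x => ~~ ok x) <= _); first by apply: pr_sub.
have tE : (1 < g)%N -> t = (2 * #|V|.+1)%:R ^+ 2 *
    expR (- ((1 / (12 * m%:R)) ^+ 2 / (8 * g%:R) * k%:R / 2)) /\ t <= 1 / 2.
  by move=> g1; split=> //; rewrite /t g1.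
apply: le_trans (pr_uncertified encK decK r T sE portP ident_inj ident_lt g_gt0 m_gt0 k_gt0 kK
  Kk t0 tE) _.
rewrite Vn; apply: (@le_trans _ _ (X^-1 ^+ d)); last first.
  rewrite exprVn lef_pV2 ?posrE ?exprn_gt0 ?ltr0n ?(ltnW n_gt1) //.
  by apply: lerXn2r; rewrite ?nnegrE //; apply: le_trans X2.
have X0 : 0 <= X by apply: le_trans X2.
apply: (@failure_bound R X) => //.
- by rewrite ler0n nX.
- by rewrite ler0n (le_trans _ nX) // ler_nat (leq_trans g_le) // ltnW.
- rewrite mulr_ge0 //= -natrM; apply: (@le_trans _ _ (2 * k)%:R); first by rewrite ler_nat.
  by rewrite natrM ler_wpM2l // (le_trans _ nX) // ler_nat ltnW.
- rewrite ler0n /= /X -exprM mulnC -/lam -/L -natrX ler_nat; exact: ltn_expl.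
- by rewrite /L /X mulnC exprM exprVn.
- have e3 : 0 <= 3 / 4 :> R by lra.
  rewrite exprn_ge0 //= /T -/lam -/tau /X -exprVn -exprM -mulnA exprM [(tau * l)%N]mulnC.
  apply: lerXn2r; rewrite ?nnegrE ?exprn_ge0 //.
  by rewrite !exprS expr0; lra.
by rewrite t0 tX.
Qed.

End Fixed.
End Main.

Lemma ceil_log2_le_ln (R : realType) n : (1 < n)%N ->
  (ceil_log2 n)%:R <= 2 / ln 2 * ln (n%:R : R).
Proof.
move=> n1; have ln2 : 0 < ln (2 : R) by rewrite ln_gt0 // ltr1n.
have n0 : 0 < n%:R :> R by rewrite ltr0n ltnW.
have h1 : ln 2 <= ln (n%:R : R) by rewrite ler_ln ?posrE // ler_nat.
have h2 : (ceil_log2 n).-1%:R * ln 2 <= ln (n%:R : R).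
  rewrite mulr_natl -lnXn // ler_ln ?posrE ?exprn_gt0 // -natrX ler_nat.
  by apply: ltnW; apply: up_log_gtn.
have e : (ceil_log2 n)%:R = (ceil_log2 n).-1%:R + 1 :> R.
  by rewrite natr1 prednK // up_log_gt0.
rewrite -(ler_pM2r ln2) mulrAC divfK ?gt_eqF // e; lra.
Qed.

Definition certified_by (R : realType) (c d C k : nat) (eps : R) n (b : nat) (A :
  congest_algorithm b) :=
  (rounds A)%:R <= C%:R * ln (n%:R : R) ^+ 4 / eps ^+ 3 /\
  forall (V : finType) (E : {set {set V}}) (ident : V -> nat) (port : V -> seq V),
    #|V| = n -> simple_graph E -> injective ident ->
    (forall v, (ident v < 2 ^ (c * ceil_log2 n))%N) -> port_numbering E port ->
    1 - (n%:R ^+ d)^-1 <= Pr_tapes R (computes_certificate (A := A) E ident port k eps).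

Lemma certified_by_idle (R : realType) (c d C k : nat) (eps : R) n b :
  0 < eps -> (n <= 1)%N || (n <= k)%N -> certified_by c d C k eps n (idle b).
Proof.
move=> eps0 nk; split.
  rewrite mulr_ge0 // ?invr_ge0 ?exprn_ge0 ?(ltW eps0) // mulr_ge0 //.
  by rewrite exprn_even_ge0.
move=> V E ident port Vn sE _ _ _.
have all_ok r : computes_certificate (A := idle b) E ident port k eps r.
  by apply: idle_computes; rewrite ?Vn ?ltW.
have -> : Pr_tapes R (computes_certificate (A := idle b) E ident port k eps) = 1.
  rewrite /Pr_tapes (_ : [set r | _] = [set: tapes (idle b) V]); last first.
    by apply/setP => r; rewrite !inE all_ok.
  rewrite cardsT divff // pnatr_eq0 -lt0n; apply/card_gt0P.
  by exists [ffun => [tuple]].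
by rewrite gerBl invr_ge0 exprn_ge0.
Qed.

Theorem theorem1p9 (R : realType) :
  exists a : nat,
  forall c d : nat,
  exists B C : nat,
  forall (eps : R) (k : nat), 0 < eps -> eps < 1 / 2 -> (0 < k)%N ->
  exists A : forall n : nat, congest_algorithm (B * ceil_log2 n),
  forall n : nat,
    (rounds (A n))%:R <= C%:R * ln (n%:R : R) ^+ a / eps ^+ 3 /\
    forall (V : finType) (E : {set {set V}})
           (ident : V -> nat) (port : V -> seq V),
      #|V| = n ->
      simple_graph E ->
      injective ident ->
      (forall v, (ident v < 2 ^ (c * ceil_log2 n))%N) ->
      port_numbering E port ->
      1 - (n%:R ^+ d)^-1 <=
        Pr_tapes R (computes_certificate (A := A n) E ident port k eps).
Proof.
(* The 8 is [2 ^ 3], from [m <= 2 / eps]; the fourth power comes from [ceil_log2_le_ln]. *)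
exists 4%N => c d; pose C := (Num.truncn ((round_factor c d)%:R * (8 * (2 / ln 2) ^+ 4) :
  R)).+1.
exists (msg_factor c d), C => eps k eps0 eps1 k0.
suff H n : exists A : congest_algorithm (msg_factor c d * ceil_log2 n),
    certified_by c d C k eps n A.
  by exists (fun n => projT1 (cid (H n))) => n; case: (cid (H n)).
have [nk|] := boolP ((n <= 1)%N || (n <= k)%N).
  by exists (idle _); apply: certified_by_idle.
rewrite negb_or -!ltnNge => /andP[n1 kn].
(* An integer substitute for 1 / eps: [1 / m <= eps] controls the size, [m <= 2 / eps] the
   rounds. *)
pose m := (Num.truncn eps^-1).+1.
have em : eps^-1 < m%:R by apply: truncnS_gt.
have me : m%:R <= 2 / eps.
  have ei : 0 <= eps^-1 by rewrite invr_ge0 ltW.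
  have h2 : 1 <= eps^-1 by rewrite -div1r ler_pdivlMr //; lra.
  have h1 : (Num.truncn eps^-1)%:R <= eps^-1 by rewrite truncn_le.
  by rewrite /m -addn1 natrD; move: h1 h2; move: eps^-1 (Num.truncn _)%:R => u w; lra.
have epsm : 1 / m%:R <= eps.
  by rewrite div1r -[leRHS]invrK lef_pV2 ?posrE ?invr_gt0 ?ltr0n // ltW.
have [A [rA PA]] := @certificate_algorithm R c d n k m n1 k0 kn (ltn0Sn _) eps epsm.
exists A; split=> //.
have ln2 : 0 < ln (2 : R) by rewrite ln_gt0 // ltr1n.
have lnn : 0 <= ln (n%:R : R) by rewrite ln_ge0 // ler1n ltnW.
apply: (@le_trans _ _ (round_factor c d * (m ^ 3 * ceil_log2 n ^ 4))%:R);
  first by rewrite ler_nat.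
rewrite natrM natrM !natrX.
have hm : m%:R ^+ 3 <= (2 / eps) ^+ 3 :> R.
  by apply: lerXn2r; rewrite ?nnegrE // divr_ge0 // ltW.
have hl : (ceil_log2 n)%:R ^+ 4 <= (2 / ln 2 * ln (n%:R : R)) ^+ 4.
  apply: lerXn2r; last exact: ceil_log2_le_ln.
    by rewrite nnegrE.
  by rewrite nnegrE mulr_ge0 // divr_ge0 // ltW.
apply: (@le_trans _ _ ((round_factor c d)%:R * ((2 / eps) ^+ 3 * (2 / ln 2 * ln (n%:R : R)) ^+
  4))).
  by apply: ler_wpM2l => //; apply: ler_pM; rewrite ?exprn_ge0.
have CE : (round_factor c d)%:R * (8 * (2 / ln 2) ^+ 4) <= C%:R :> R by apply/ltW/truncnS_gt.
have -> : (round_factor c d)%:R * ((2 / eps) ^+ 3 * (2 / ln 2 * ln (n%:R : R)) ^+ 4) =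
   (round_factor c d)%:R * (8 * (2 / ln 2) ^+ 4) * (ln (n%:R : R) ^+ 4 / eps ^+ 3).
  have e8 : 2 ^+ 3 = 8 :> R by rewrite !exprS expr0; lra.
  rewrite [(2 / eps) ^+ 3]exprMn exprVn e8 [(2 / ln 2 * _) ^+ 4]exprMn.
  move: (round_factor c d)%:R ((2 / ln 2) ^+ 4) (ln n%:R ^+ 4) (eps ^+ 3)^-1 => x y w z; ring.
rewrite -[X in _ <= X]mulrA; apply: ler_wpM2r CE.
by rewrite divr_ge0 ?exprn_ge0 // ltW.
Qed.
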